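(* Fix $n\ge 1$. The category $\mathcal K$ of double cosets and the category $\mathrm{PsBor}$ of (colored, $n$-dimensional) pseudobordisms, both described in the context, are equivalent. The equivalence $F:\mathcal K\to\mathrm{PsBor}$ is given by the following construction. On objects $F$ is the identity. Given a morphism $\mathfrak g\in \mathrm{Mor}_{\mathcal K}(\beta,\alpha)=K(\alpha)\backslash G/K(\beta)$, choose a representative $g\in\mathfrak g$, take the labeled colored normal infinite pseudomanifold $\Sigma_g$ corresponding to $g\in G=S(\infty)^{n+1}$ (as described in the context), forget all labels $>\alpha$ on plus-chambers and all labels $>\beta$ on minus-chambers, and delete all components that are double-chambers without labels; the resulting pseudobordism is $F(\mathfrak g)\in \mathrm{Mor}_{\mathrm{PsBor}}(\beta,\alpha)$. That is, $F(\mathfrak g)$ does not depend on the choice of $g$, $F$ is a functor, and $F$ is an equivalence of categories.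
   Context: **Simplicial cell complexes.** A simplicial cell complex $\Sigma$ is a topological quotient of a disjoint union $\coprod \Xi_j$ of a finite collection of simplices such that: (a) each tautological map $\xi_i:\Xi_i\to\Sigma$ is an embedding; (b) for any $i,j$, the set $\xi_i^{-1}(\xi_i(\Xi_i)\cap\xi_j(\Xi_j))$ is a union of faces of $\Xi_i$, and the partially defined map $\xi_j^{-1}\circ\xi_i:\Xi_i\to\Xi_j$ is affine on each face. (Two faces may intersect in a union of several faces.) Faces of $\Sigma$ are the images of faces of the $\Xi_i$. **Pseudomanifolds.** A pseudomanifold of dimension $n$ is a simplicial cell complex such that each face is contained in an $n$-dimensional face ($n$-dimensional faces are called chambers) and each $(n-1)$-dimensional face is contained in precisely two chambers. It may be disconnected (or empty). **Links, normality, normalization.** Let $\Gamma$ be a $k$-dimensional face of $\Sigma$. Choose a point $\phi_j$ in the relative interior of each $(k+1)$-dimensional face $\Phi_j\supset\Gamma$. For each face $\Psi\supset\Gamma$ take the convex hull in $\Psi$ of all $\phi_j$ contained in $\Psi$. The link of $\Gamma$ is the simplicial cell complex whose faces are these convex hulls. A pseudomanifold is normal if the link of every face of codimension $\ge 2$ is connected. The normalization of $\Sigma$ is obtained as follows: cut $\Sigma$ into the disjoint union of its chambers $\Xi_i$ (with embeddings $\xi_i:\Xi_i\to\Sigma$); for $x\in\Xi_i$, $y\in\Xi_j$ put $x\sim y$ if $\xi_i(x)=\xi_j(y)$ and this point lies in a common $(n-1)$-dimensional face of the chambers $\xi_i(\Xi_i)$, $\xi_j(\Xi_j)$; extend $\sim$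 by transitivity to an equivalence relation and take the quotient of $\coprod\Xi_i$. It is a normal pseudomanifold with the same chambers and $(n-1)$-faces. **Colorings.** Fix $n+1$ colors. A coloring of an $n$-dimensional normal pseudomanifold is: (a) an assignment of a sign $+$ or $-$ to each chamber such that chambers sharing an $(n-1)$-face have opposite signs (plus-chambers and minus-chambers); (b) a coloring of vertices such that the vertices of each chamber have pairwise different colors; (c) a coloring of $(n-1)$-faces such that the faces of each chamber have pairwise different colors and the color of an $(n-1)$-face equals the color of the opposite vertex in any chamber containing it. A double-chamber is the colored pseudomanifold obtained from two identical copies of an $n$-simplex (one plus, one minus) by identifying corresponding points of their boundaries. Colored (and labeled) pseudomanifolds are considered up to isomorphisms (homeomorphisms that are affine on faces) preserving signs, colors and labels. **The category $\mathrm{PsBor}$.** Objects are nonnegative integers. A morphism $\beta\to\alpha$ is a colored normal $n$-dimensional pseudomanifold (generally disconnected), with an injective map from $\{1,\dots,\alpha\}$ to the set of plus-chambers and an injective map from $\{1,\dots,\beta\}$ to the set of minus-chambers (labels), such that each component that is a double-chamber has at least one label. Composition of $\Sigma\in\mathrm{Mor}(\beta,\alpha)$ and $\Lambda\in\mathrm{Mor}(\gamma,\beta)$: remove the interiors of labeled minus-chambers of $\Sigma$ and of labeled plus-chambers of $\Lambda$; for each $s\le\beta$ glue the boundary of the removed minus-chamber of $\Sigma$ with label $s$ to the boundary of the removed plus-chamber of $\Lambda$ with label $s$, respecting the simplicial structure and the colorings; normalize the result; remove label-less double-chambers. The plus-labels come from $\Sigma$ and the minus-labels from $\Lambda$. The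 result is $\Sigma\diamond\Lambda\in\mathrm{Mor}(\gamma,\alpha)$. **The category $\mathcal K$.** $S(\infty)$ is the group of finitely supported permutations of $\mathbb N=\{1,2,\dots\}$. $G=S(\infty)^{n+1}$, the $n+1$ factors being indexed by the $n+1$ colors. $K\simeq S(\infty)$ is the diagonal subgroup $\{(g,\dots,g)\}$ of $G$, and $K(\alpha)\subset K$ is the subgroup of $(g,\dots,g)$ with $g$ fixing $1,\dots,\alpha$. Permutations are identified with $0$-$1$-matrices so that the entry $(p,q)$ equals $1$ iff $p\mapsto q$, and products are matrix products (so $gh$ means first $g$, then $h$). Objects of $\mathcal K$ are nonnegative integers and $\mathrm{Mor}_{\mathcal K}(\beta,\alpha)=K(\alpha)\backslash G/K(\beta)$. Let $\theta_\beta[j]\in K(\beta)$ be the diagonal element given by the permutation exchanging $\beta+i$ and $\beta+j+i$ for $1\le i\le j$ and fixing all other points. For $\mathfrak g\in K(\alpha)\backslash G/K(\beta)$ and $\mathfrak h\in K(\beta)\backslash G/K(\gamma)$ with representatives $g,h$, the composition $\mathfrak g\circ\mathfrak h\in K(\alpha)\backslash G/K(\gamma)$ is the eventual (limit) value, as $j\to\infty$, of the sequence of double cosets $K(\alpha)\,g\,\theta_\beta[j]\,h\,K(\gamma)$; this sequence is eventually constant with a limit independent of the representatives. **The correspondence $g\mapsto\Sigma_g$.** An infinite pseudomanifold is a disjoint union of a countable collection of (compact) pseudomanifolds, all but finitely many of which are double-chambers; a coloring of an infinite pseudomanifold with normal components is an assignment of a sign $+$ or $-$ to each chamber such that chambers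 sharing an $(n-1)$-face have opposite signs, together with a coloring of vertices in the fixed $n+1$ colors such that the vertices of each chamber have pairwise different colors, and a coloring of $(n-1)$-faces in the same $n+1$ colors such that the faces of each chamber have pairwise different colors and the color of an $(n-1)$-face equals the color of the opposite vertex in any chamber containing it. A labeled colored infinite pseudomanifold is one with a numbering (bijection with $\mathbb N$) of plus-chambers and a numbering of minus-chambers by natural numbers such that all but finitely many double-chambers carry the same label on both chambers. For $g=(g^{(c)})_{c}\in G$, $\Sigma_g$ is obtained from a collection of plus-chambers labeled by $\mathbb N$ and a collection of minus-chambers labeled by $\mathbb N$ (copies of one colored $n$-simplex) by gluing, for each color $c$ and each $p\in\mathbb N$, the plus-chamber with label $p$ to the minus-chamber with label $g^{(c)}(p)$ along their faces of color $c$, preserving colors of vertices. *)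

(* Defs.v *)
From HB Require Import structures.
From mathcomp Require Import all_boot all_order all_algebra.
From mathcomp Require Import generic_quotient.
From mathcomp Require Import all_classical all_reals all_analysis.
From Stdlib Require Import Relation_Operators.

Set Implicit Arguments.
Unset Strict Implicit.
Unset Printing Implicit Defensive.
Import Order.TTheory GRing.Theory Num.Theory.
Import numFieldNormedType.Exports.
Local Open Scope classical_set_scope.
Local Open Scope ring_scope.
Local Open Scope convex_scope.
Local Open Scope quotient_scope.

Definition simplex (R : realType) (d : nat) : set 'rV[R]_d.+1 :=
  [set x | (forall k, 0 <= x 0 k) /\ \sum_k x 0 k = 1].
Arguments simplex : clear implicits.

Section Simplex.
Context {R : realType}.

Definition coord d (x : simplex R d) (k : 'I_d.+1) : R := set_val x 0 k.

Definition face d (S : {set 'I_d.+1}) : set (simplex R d) :=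
  [set x : simplex R d | forall k, k \notin S -> coord x k = 0].

Definition face_interior d (S : {set 'I_d.+1}) : set (simplex R d) :=
  [set x : simplex R d | face S x /\ forall k, k \in S -> 0 < coord x k].

Definition simplex_boundary d : set (simplex R d) :=
  [set x : simplex R d | exists k, coord x k = 0].

Definition point_conv d (t : {i01 R}) (x y : simplex R d) : 'rV[R]_d.+1 :=
  (set_val x : convex_lmodType 'rV[R]_d.+1) <| t |> set_val y.

(* The graph h of a partial map between simplices preserves the convex
   combinations that stay in A. *)
Definition affine_on d e (A : set (simplex R d))
    (h : simplex R d -> simplex R e -> Prop) : Prop :=
  forall (x x' z : simplex R d) (y y' w : simplex R e) (t : {i01 R}),
    A x -> A x' -> A z -> h x y -> h x' y' -> h z w ->
    set_val z = point_conv t x x' -> set_val w = point_conv t y y'.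

Definition convex_hull d (A : set 'rV[R]_d.+1) : set 'rV[R]_d.+1 :=
  \bigcap_(B in [set B : set 'rV[R]_d.+1 |
                 convex_set (B : set (convex_lmodType 'rV[R]_d.+1)) /\
                 A `<=` B]) B.

End Simplex.

Section GeneratedEquivalence.
Context {T : choiceType} (G : T -> T -> Prop).

Definition generated_rel : rel T :=
  fun x y => `[< clos_refl_sym_trans T G x y >].

Lemma generated_refl : reflexive generated_rel.
Proof. by move=> x; apply/asboolP/rst_refl. Qed.

Lemma generated_sym : symmetric generated_rel.
Proof.
by move=> x y; apply/idP/idP => /asboolP H; apply/asboolP/rst_sym.
Qed.

Lemma generated_trans : transitive generated_rel.
Proof.
move=> y x z /asboolP xy /asboolP yz; apply/asboolP.
exact: rst_trans xy yz.
Qed.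

Definition generated_equiv : equiv_rel T :=
  EquivRel generated_rel generated_refl generated_sym generated_trans.

End GeneratedEquivalence.

Definition simplex_sum (R : realType) (I : choiceType) (d : I -> nat) :
    topologicalType :=
  {i : I & simplex R (d i)}.
Arguments simplex_sum R {I} d.

Record simplex_quotient (R : realType) := SimplexQuotient {
  sidx : choiceType;
  sdim : sidx -> nat;
  sglue : equiv_rel (simplex_sum R sdim)
}.

(* The gluing generated by identifying x in the i-th simplex with y in the
   j-th one whenever G i j x y. *)
Definition glue_simplices (R : realType) (I : choiceType) (d : I -> nat)
    (G : forall i j, simplex R (d i) -> simplex R (d j) -> Prop) :
    simplex_quotient R :=
  SimplexQuotient
    (@generated_equiv (simplex_sum R d)
       (fun p q => G _ _ (projT2 p) (projT2 q))).

Section Complexes.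
Context {R : realType}.
Implicit Types (X Y : simplex_quotient R).

Definition realization X : topologicalType :=
  quotient_topology {eq_quot (sglue X)}.

Definition chart X (i : sidx X) (x : simplex R (sdim i)) : realization X :=
  \pi_{eq_quot (sglue X)} (existT (fun i => simplex R (sdim i)) i x).
Global Arguments chart {X} i x.

Definition simplex_image X (i : sidx X) : set (realization X) := range (chart i).
Global Arguments simplex_image {X} i.

Definition face_image X (i : sidx X) (S : {set 'I_(sdim i).+1}) :
    set (realization X) :=
  chart i @` face S.
Global Arguments face_image {X} i S.

Definition embedding (T U : topologicalType) (f : T -> U) : Prop :=
  [/\ injective f, continuous f &
      forall A : set T, open A -> exists2 B : set U, open B & A = f @^-1` B].

Definition overlap X (i j : sidx X) : set (simplex R (sdim i)) :=
  chart i @^-1` simplex_image j.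
Global Arguments overlap {X} i j.

Definition is_simplicial_cell_complex X : Prop :=
  [/\ finite_set [set: sidx X],
      forall i : sidx X, embedding (chart i),
      forall i j : sidx X, exists F : set {set 'I_(sdim i).+1},
        overlap i j = \bigcup_(S in F) face S &
      forall (i j : sidx X) (S : {set 'I_(sdim i).+1}),
        face S `<=` overlap i j ->
        affine_on (face S) (fun x y => chart i x = chart j y)].

(* Faces are subsets of the realization: the images of the faces of the
   simplices, with k + 1 vertices for a face of dimension k. *)
Definition is_face X (k : nat) (A : set (realization X)) : Prop :=
  exists (i : sidx X) (S : {set 'I_(sdim i).+1}),
    #|S| = k.+1 /\ A = face_image i S.

Definition relative_interior X (A : set (realization X)) : set (realization X) :=
  [set p | exists (i : sidx X) (S : {set 'I_(sdim i).+1}),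
     A = face_image i S /\ (chart i @` face_interior S) p].

Definition is_pseudomanifold (n : nat) X : Prop :=
  [/\ is_simplicial_cell_complex X,
      forall k (A : set (realization X)), is_face k A ->
        exists2 C, is_face n C & A `<=` C &
      forall A : set (realization X), is_face n.-1 A ->
        exists C D, C <> D /\
          [set E | is_face n E /\ A `<=` E] = [set C; D]].

(* The link of a k-dimensional face A, for the choice phi of a point in each
   (k+1)-dimensional face containing A. *)
Definition link X (k : nat) (A : set (realization X))
    (phi : set (realization X) -> realization X) :
    set (realization X) :=
  [set p | exists (i : sidx X) (S : {set 'I_(sdim i).+1}),
     A `<=` face_image i S /\
     exists2 x : simplex R (sdim i), p = chart i x &
       convex_hull
         (set_val @` [set y : simplex R (sdim i) | face S y /\
            exists B, [/\ is_face k.+1 B, A `<=` B, B `<=` face_image i S &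
                          chart i y = phi B]])
         (set_val x)].

Definition is_normal (n : nat) X : Prop :=
  forall k (A : set (realization X)) (phi : set (realization X) -> realization X),
    is_face k A -> (k + 2 <= n)%N ->
    (forall B, is_face k.+1 B -> A `<=` B -> relative_interior B (phi B)) ->
    connected (link k A phi).

Definition homeomorphism (T U : topologicalType) (f : T -> U) : Prop :=
  continuous f /\ exists g : U -> T, [/\ cancel f g, cancel g f & continuous g].

Definition affine_on_faces X Y (f : realization X -> realization Y) : Prop :=
  forall (i : sidx X) (S : {set 'I_(sdim i).+1}), S != finset.set0 ->
  exists (j : sidx Y) (T : {set 'I_(sdim j).+1}),
    f @` face_image i S = face_image j T /\
    affine_on (face S) (fun x y => f (chart i x) = chart j y).

End Complexes.

(* Data attached to faces of the quotient are recorded on the faces of the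
   simplices; [is_coloring] and [is_labeling] require that they descend to the
   quotient. In an n-dimensional pseudomanifold no simplex has dimension > n,
   so the chambers are the images of the n-dimensional simplices. Only the
   values of [is_plus] and of the labels on n-dimensional simplices and of [fcol] on
   faces with n vertices are meaningful. *)
Record colored (R : realType) (n : nat) := Colored {
  carrier :> simplex_quotient R;
  is_plus : sidx carrier -> bool; (* true for plus *)
  vcol : forall i : sidx carrier, 'I_(sdim i).+1 -> 'I_n.+1;
  fcol : forall i : sidx carrier, {set 'I_(sdim i).+1} -> 'I_n.+1
}.
Arguments is_plus {R n c} i.
Arguments vcol {R n c} i k.
Arguments fcol {R n c} i S.

(* Plus-labels in L, minus-labels in M; [plab s] consists of all the simplices
   whose image is the chamber with label s. *)
Record labeled (R : realType) (n : nat) (L M : Type) := Labeled {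
  underlying :> colored R n;
  plab : L -> set (sidx underlying);
  mlab : M -> set (sidx underlying)
}.
Arguments plab {R n L M l} s.
Arguments mlab {R n L M l} s.

Section Colored.
Context {R : realType} {n : nat}.
Implicit Types X Y : colored R n.

Definition is_coloring X : Prop :=
  [/\ [/\ forall i j : sidx X, sdim i = n -> sdim j = n ->
            simplex_image i = simplex_image j -> is_plus i = is_plus j,
          forall (i j : sidx X) k l,
            face_image i [set k] = face_image j [set l] ->
            vcol i k = vcol j l &
          forall (i j : sidx X) (S : {set 'I_(sdim i).+1})
            (T : {set 'I_(sdim j).+1}), #|S| = n -> #|T| = n ->
            face_image i S = face_image j T -> fcol i S = fcol j T],
      forall i j : sidx X, sdim i = n -> sdim j = n ->
        simplex_image i <> simplex_image j ->
        (exists A, [/\ is_face n.-1 A, A `<=` simplex_image i &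
                       A `<=` simplex_image j]) ->
        is_plus i <> is_plus j,
      forall (i : sidx X) (S : {set 'I_(sdim i).+1}), #|S| = n.+1 ->
        {in S &, injective (vcol i)} &
      forall (i : sidx X) (S : {set 'I_(sdim i).+1}), #|S| = n.+1 ->
        {in S &, injective (fun k => fcol i (S :\ k))} /\
        {in S, forall k, fcol i (S :\ k) = vcol i k}].

(* Barycentric coordinates, indexed by the colors of vertices. *)
Definition color_coord X (i : sidx X) (x : simplex R (sdim i)) : 'rV[R]_n.+1 :=
  \row_c \sum_(k | vcol i k == c) coord x k.
Global Arguments color_coord {X} i x.

Definition is_component (T : topologicalType) (D : set T) : Prop :=
  exists p, D = connected_component setT p.

(* D is the union of a plus- and a minus-chamber glued along their boundaries
   by the correspondence of points with the same color coordinates. *)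
Definition is_double_chamber X (D : set (realization X)) : Prop :=
  exists i j : sidx X,
    [/\ sdim i = n /\ sdim j = n, is_plus i /\ ~~ is_plus j,
        D = simplex_image i `|` simplex_image j &
        forall (x : simplex R (sdim i)) (y : simplex R (sdim j)),
          chart i x = chart j y <->
          color_coord i x = color_coord j y /\ simplex_boundary x].

Section Labeled.
Context {L M : Type}.
Implicit Types P Q : labeled R n L M.

Definition is_injective_chamber_map X (b : bool) (K : Type)
    (lab : K -> set (sidx X)) : Prop :=
  [/\ forall s, exists2 i, sdim i = n /\ is_plus i = b &
        lab s = [set j | sdim j = n /\ simplex_image j = simplex_image i] &
      forall s t i, lab s i -> lab t i -> s = t].

Definition is_labeling P : Prop :=
  is_injective_chamber_map true (@plab _ _ _ _ P) /\
  is_injective_chamber_map false (@mlab _ _ _ _ P).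

Definition labelless P (D : set (realization P)) : Prop :=
  forall i : sidx P, simplex_image i `<=` D ->
    (forall s, ~ plab s i) /\ (forall s, ~ mlab s i).

Definition labelless_double_chamber P (D : set (realization P)) : Prop :=
  [/\ is_component D, is_double_chamber D & labelless D].

(* Labeled colored normal n-dimensional pseudomanifolds all of whose
   double-chambers have a label. *)
Definition is_pseudobordism P : Prop :=
  [/\ is_pseudomanifold n P, is_normal n P, is_coloring P, is_labeling P &
      forall D : set (realization P), ~ labelless_double_chamber D].

Definition isomorphic P Q : Prop :=
  exists f : realization P -> realization Q,
  [/\ homeomorphism f,
      affine_on_faces f,
      forall (i : sidx P) (j : sidx Q), sdim i = n -> sdim j = n ->
        f @` simplex_image i = simplex_image j ->
        [/\ is_plus i = is_plus j, forall s, plab s i <-> plab s j &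
            forall s, mlab s i <-> mlab s j],
      forall (i : sidx P) (j : sidx Q) k l,
        f @` face_image i [set k] = face_image j [set l] ->
        vcol i k = vcol j l &
      forall (i : sidx P) (j : sidx Q) (S : {set 'I_(sdim i).+1})
        (T : {set 'I_(sdim j).+1}), #|S| = n -> #|T| = n ->
        f @` face_image i S = face_image j T -> fcol i S = fcol j T].

(* Cut P into some of its simplices and reglue them along G. *)
Definition reglue P (I : choiceType) (v : I -> sidx P)
    (G : forall i j : I,
       simplex R (sdim (v i)) -> simplex R (sdim (v j)) -> Prop) :
    labeled R n L M :=
  @Labeled R n L M
    (@Colored R n (@glue_simplices R I (fun i => sdim (v i)) G)
       (fun i => is_plus (v i)) (fun i => vcol (v i)) (fun i => fcol (v i)))
    (fun s => v @^-1` plab s) (fun s => v @^-1` mlab s).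

(* The first alternative only matters when several simplices of P have the
   same chamber as image. *)
Definition normalization P : labeled R n L M :=
  @reglue P {i : sidx P | sdim i == n} (fun i => \val i)
    (fun i j x y =>
       chart (\val i) x = chart (\val j) y /\
       (simplex_image (\val i) = simplex_image (\val j) \/
        exists A : set (realization P),
          [/\ is_face n.-1 A, A `<=` simplex_image (\val i),
              A `<=` simplex_image (\val j) & A (chart (\val i) x)])).

Definition remove_labelless_double_chambers P : labeled R n L M :=
  @reglue P
    {i : sidx P | `[< ~ exists D : set (realization P),
                         labelless_double_chamber D /\
                         simplex_image i `<=` D >] }
    (fun i => \val i)
    (fun i j x y => chart (\val i) x = chart (\val j) y).

Definition relabel (L' M' : Type) (u : L' -> L) (v : M' -> M) P :
    labeled R n L' M' :=
  @Labeled R n L' M' P (fun s => plab (u s)) (fun s => mlab (v s)).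

End Labeled.

Section Composition.
Context {L M N : Type} (P : labeled R n L M) (Q : labeled R n M N).

(* In a pseudobordism two chambers of the same sign have no common
   (n-1)-dimensional face, so that the boundary of a removed chamber is covered
   by the remaining chambers: removing the interiors of chambers amounts to
   discarding the corresponding simplices. *)
Definition cut_idx : choiceType :=
  ({i : sidx P | `[< forall s, ~ mlab s i >]} +
   {j : sidx Q | `[< forall s, ~ plab s j >]})%type.

Definition cut_dim (i : cut_idx) : nat :=
  match i with inl i => sdim (\val i) | inr j => sdim (\val j) end.

(* p and q are corresponding points of the boundaries of the chambers with
   label s. *)
Definition corresponding (s : M) (p : realization P) (q : realization Q) : Prop :=
  exists (i : sidx P) (j : sidx Q),
    [/\ mlab s i, plab s j &
        exists (x : simplex R (sdim i)) (y : simplex R (sdim j)),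
        [/\ p = chart i x, q = chart j y, simplex_boundary x, simplex_boundary y &
            color_coord i x = color_coord j y]].

Definition cut_glue (i j : cut_idx) :
    simplex R (cut_dim i) -> simplex R (cut_dim j) -> Prop :=
  match i, j return simplex R (cut_dim i) -> simplex R (cut_dim j) -> Prop with
  | inl i, inl j => fun x y => chart (\val i) x = chart (\val j) y
  | inr i, inr j => fun x y => chart (\val i) x = chart (\val j) y
  | inl i, inr j => fun x y =>
      exists s, corresponding s (chart (\val i) x) (chart (\val j) y)
  | inr _, inl _ => fun _ _ => False
  end.

Definition cut_and_glue : labeled R n L N :=
  @Labeled R n L N
    (@Colored R n (glue_simplices cut_glue)
       (fun i : cut_idx => match i with
          inl i => is_plus (\val i) | inr j => is_plus (\val j) end)
       (fun i : cut_idx =>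
          match i return 'I_(cut_dim i).+1 -> 'I_n.+1 with
          inl i => vcol (\val i) | inr j => vcol (\val j) end)
       (fun i : cut_idx =>
          match i return {set 'I_(cut_dim i).+1} -> 'I_n.+1 with
          inl i => fcol (\val i) | inr j => fcol (\val j) end))
    (fun s => [set i : cut_idx |
                 match i with inl i => plab s (\val i) | inr _ => False end])
    (fun s => [set i : cut_idx |
                 match i with inl _ => False | inr j => mlab s (\val j) end]).

Definition bordism_comp : labeled R n L N :=
  remove_labelless_double_chambers (normalization cut_and_glue).

End Composition.

End Colored.

(* The set {1,2,...} is represented by nat through m |-> m - 1; accordingly
   the labels 1, ..., a are represented by 'I_a. *)
Definition Sinf : set (nat -> nat) :=
  [set f | bijective f /\ exists N, forall m, (N <= m)%N -> f m = m].

Definition tuple_perm (n : nat) : choiceType := 'I_n.+1 -> nat -> nat.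

Section DoubleCosets.
Context {n : nat}.

Definition Ginf : set (tuple_perm n) := [set g | forall c, Sinf (g c)].

Definition Gone : tuple_perm n := fun=> id.

(* First g, then h. *)
Definition Gmul (g h : tuple_perm n) : tuple_perm n := fun c => h c \o g c.

Definition Kdiag (a : nat) : set (tuple_perm n) :=
  [set k | exists f, [/\ Sinf f, forall m, (m < a)%N -> f m = m & k = fun=> f]].

Definition dcoset (a b : nat) (g : tuple_perm n) : set (tuple_perm n) :=
  [set x | exists k l, [/\ Kdiag a k, Kdiag b l & x = Gmul (Gmul k g) l]].

Definition theta (b j : nat) : tuple_perm n := fun _ m =>
  if (b <= m < b + j)%N then (m + j)%N
  else if (b + j <= m < b + j + j)%N then (m - j)%N else m.

Definition is_dcoset (a b : nat) (gg : set (tuple_perm n)) : Prop :=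
  exists2 g, Ginf g & gg = dcoset a b g.

Definition is_dcoset_comp (a b c : nat) (gg hh ff : set (tuple_perm n)) : Prop :=
  forall g h, gg g -> hh h ->
    \forall j \near \oo, dcoset a c (Gmul (Gmul g (theta b j)) h) = ff.

(* The default value set0 is not a double coset. *)
Definition dcoset_comp (a b c : nat) (gg hh : set (tuple_perm n)) :
    set (tuple_perm n) :=
  xget set0 (is_dcoset_comp a b c gg hh).

End DoubleCosets.

Section Correspondence.
Context (R : realType) {n : nat}.

(* The simplex (true, p), resp. (false, p), is the plus-, resp. minus-chamber
   with label p; its k-th vertex has color k, and the points of its face of
   color c are those with x_c = 0. *)
Definition Sigma_glue (g : tuple_perm n) (i j : (bool * nat)%type)
    (x y : simplex R n) : Prop :=
  exists c p, [/\ i = (true, p), j = (false, g c p), x = y &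
                  face [set~ c] x].

Definition Sigma (g : tuple_perm n) : labeled R n nat nat :=
  @Labeled R n nat nat
    (@Colored R n
       (@glue_simplices R (bool * nat)%type (fun=> n) (Sigma_glue g))
       (fun i : bool * nat => i.1)
       (fun _ k => k)
       (fun _ S => odflt ord0 [pick c | c \notin S]))
    (fun p => [set (true, p)])
    (fun p => [set (false, p)]).

Definition bordism_of (a b : nat) (g : tuple_perm n) :
    labeled R n 'I_a 'I_b :=
  remove_labelless_double_chambers
    (relabel (@nat_of_ord a) (@nat_of_ord b) (Sigma g)).

End Correspondence.

(* Arrows are taken up to [same], among the elements of [arr a b] that satisfy
   [is_arr]. *)
Record category_data := CategoryData {
  obj : Type;
  arr : obj -> obj -> Type;
  is_arr : forall a b, arr a b -> Prop;
  same : forall a b, arr a b -> arr a b -> Prop;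
  compose : forall a b c, arr b c -> arr a b -> arr a c
}.

Arguments is_arr {_ _ _}.
Arguments same {_ _ _}.
Arguments compose {_ _ _ _}.

Definition is_identity (C : category_data) (a : obj C) (e : arr a a) : Prop :=
  [/\ is_arr e,
      forall b (f : arr a b), is_arr f -> same (compose f e) f &
      forall b (f : arr b a), is_arr f -> same (compose e f) f].

Record is_category (C : category_data) : Prop := {
  same_refl : forall (a b : obj C) (f : arr a b), is_arr f -> same f f;
  same_sym : forall (a b : obj C) (f g : arr a b), is_arr f -> is_arr g ->
    same f g -> same g f;
  same_trans : forall (a b : obj C) (f g h : arr a b),
    is_arr f -> is_arr g -> is_arr h -> same f g -> same g h -> same f h;
  comp_arr : forall (a b c : obj C) (g : arr b c) (f : arr a b),
    is_arr g -> is_arr f -> is_arr (compose g f);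
  comp_same : forall (a b c : obj C) (g g' : arr b c) (f f' : arr a b),
    is_arr g -> is_arr g' -> is_arr f -> is_arr f' ->
    same g g' -> same f f' -> same (compose g f) (compose g' f');
  comp_assoc : forall (a b c d : obj C)
    (h : arr c d) (g : arr b c) (f : arr a b),
    is_arr h -> is_arr g -> is_arr f ->
    same (compose h (compose g f)) (compose (compose h g) f);
  identity_ex : forall a : obj C, exists e : arr a a, is_identity e
}.

Record functor_data (C D : category_data) := FunctorData {
  fobj :> obj C -> obj D;
  farr : forall a b, arr a b -> arr (fobj a) (fobj b)
}.

Arguments farr {C D} f {a b}.

Record is_functor (C D : category_data) (F : functor_data C D) : Prop := {
  farr_arr : forall (a b : obj C) (f : arr a b), is_arr f -> is_arr (farr F f);
  farr_same : forall (a b : obj C) (f g : arr a b), is_arr f -> is_arr g ->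
    same f g -> same (farr F f) (farr F g);
  farr_comp : forall (a b c : obj C) (g : arr b c) (f : arr a b),
    is_arr g -> is_arr f ->
    same (farr F (compose g f)) (compose (farr F g) (farr F f));
  farr_id : forall (a : obj C) (e : arr a a),
    is_identity e -> is_identity (farr F e)
}.

Definition functor_id (C : category_data) : functor_data C C :=
  @FunctorData C C id (fun _ _ f => f).

Definition functor_comp (B C D : category_data)
    (F : functor_data C D) (E : functor_data B C) : functor_data B D :=
  @FunctorData B D (fun a => F (E a)) (fun _ _ f => farr F (farr E f)).

Definition is_iso (C : category_data) (a b : obj C) (f : arr a b) : Prop :=
  is_arr f /\ exists g : arr b a,
    [/\ is_arr g, is_identity (compose g f) & is_identity (compose f g)].

Definition naturally_isomorphic (C D : category_data)
    (F E : functor_data C D) : Prop :=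
  exists eta : forall a, arr (F a) (E a),
    (forall a, is_iso (eta a)) /\
    forall a b (f : arr a b), is_arr f ->
      same (compose (eta b) (farr F f)) (compose (farr E f) (eta a)).

Definition is_equivalence (C D : category_data) (F : functor_data C D) : Prop :=
  is_functor F /\ exists E : functor_data D C,
    [/\ is_functor E, naturally_isomorphic (functor_comp E F) (functor_id C) &
        naturally_isomorphic (functor_comp F E) (functor_id D)].

(* An arrow from b to a is a double coset in Kdiag a \ Ginf / Kdiag b. *)
Definition double_coset_category (n : nat) : category_data :=
  @CategoryData nat (fun _ _ => set (tuple_perm n))
    (fun b a gg => is_dcoset a b gg)
    (fun _ _ gg hh => gg = hh)
    (fun c b a gg hh => dcoset_comp a b c gg hh).

(* An arrow from b to a has a plus-labels and b minus-labels. *)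
Definition PsBor (R : realType) (n : nat) : category_data :=
  @CategoryData nat (fun b a => labeled R n 'I_a 'I_b)
    (fun _ _ P => is_pseudobordism P)
    (fun _ _ P Q => isomorphic P Q)
    (fun _ _ _ P Q => bordism_comp P Q).

Definition bordism_functor (R : realType) (n : nat) :
    functor_data (double_coset_category n) (PsBor R n) :=
  @FunctorData (double_coset_category n) (PsBor R n) id
    (fun b a gg => bordism_of R a b (xget Gone gg)).

(* Main.v *)
(* A pseudobordism is determined by its chambers, by the (n-1)-faces along which
   they are glued, and by the labels. For this combinatorial structure, say that
   a tuple g presents P when P is the part of Sigma g left after the removal of
   unlabeled double-chambers. In P, points of two chambers with the same
   color-indexed barycentric coordinates x coincide exactly when the chambers are
   joined by a gallery crossing only faces of colors c with x_c = 0: for a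
   pseudobordism this is what connectedness of links gives, by descending
   induction on the dimension of the face carrying the point.

   Every pseudobordism is presented by some g: number the plus- and the
   minus-chambers, labels first. Isomorphic pseudobordisms have tuples in the
   same double coset and conversely: an isomorphism matches the chambers other
   than unlabeled double-chambers, and the matching extends to permutations.

   If P and Q are presented by g and h and the permutation tau fixing 1, ..., b
   never sends a chamber kept in P to a chamber kept in Q beyond the labels, then
   the composite is presented by g tau h. Hence the double coset of g tau h
   depends only on those of g and h, the shuffles theta_b[j] with j large being
   such permutations, and both categories inherit their laws from the product of
   tuples. *)
Require Import Defs.
From HB Require Import structures.
From mathcomp Require Import all_boot all_order all_algebra.
From mathcomp Require Import generic_quotient.
From mathcomp Require Import all_classical all_reals all_analysis.
From mathcomp Require Import lra zify_ssreflect.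
From Stdlib Require Import Relation_Operators Lia.

Import Defs.

Set Implicit Arguments.
Unset Strict Implicit.
Unset Printing Implicit Defensive.
Import Order.TTheory GRing.Theory Num.Theory.
Import numFieldNormedType.Exports.
Local Open Scope classical_set_scope.
Local Open Scope ring_scope.
Local Open Scope convex_scope.
Local Open Scope quotient_scope.

(** * Points of a simplex *)

(** A simplicial cell complex may contain redundant simplices: several with the same image, or some
    of dimension less than n that lie in several chambers. Hence a presentation is a map from
    simplices, not from chambers, and points are compared through their color coordinates, which do
    not depend on the simplex chosen to contain them. Gluing alone can identify points of two
    chambers that no gallery through the point connects. Normalization keeps only the
    identifications made across (n-1)-faces, and this is what makes galleries describe a composite.
    The condition on tau works for the following reason. If q is beyond the labels, the
    minus-chamber q of Sigma g or the plus-chamber tau q of Sigma h lies in an unlabeled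
    double-chamber. There all colors agree, so in the product g tau h this passage merely renames
    the other chamber. At a label q the product concatenates an edge of g with an edge of h of the
    same color, exactly as the gluing along the removed chambers does. *)

Section SimplexPoints.
Context {R : realType}.

Lemma coord_ge0 d (x : simplex R d) k : 0 <= coord x k.
Proof. by have [+ _] := set_valP x; apply. Qed.

Lemma sum_coord d (x : simplex R d) : \sum_k coord x k = 1.
Proof. by have [_] := set_valP x. Qed.

Lemma coord_inj d (x y : simplex R d) : coord x =1 coord y -> x = y.
Proof.
by move=> xy; apply/val_inj/rowP => k; apply: xy.
Qed.

Lemma simplex_val d (x : simplex R d) : simplex R d (set_val x).
Proof. exact: set_valP. Qed.

Definition simplex_point d (v : 'rV[R]_d.+1) (Hv : simplex R d v) : simplex R d :=
  exist _ v (mem_set Hv).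

Lemma coord_simplex_point d v (Hv : simplex R d v) k :
  coord (simplex_point Hv) k = v 0 k.
Proof. by []. Qed.

(** Taken on row vectors, so that one notion serves barycentric coordinates, indexed by vertices,
    and color coordinates, indexed by colors. *)
Definition support d (v : 'rV[R]_d) : {set 'I_d} := [set k | v 0 k != 0].

Lemma in_support d (v : 'rV[R]_d) k : (k \in support v) = (v 0 k != 0).
Proof. by rewrite inE. Qed.

Lemma support_simplex_neq0 d (v : 'rV[R]_d.+1) :
  simplex R d v -> support v != finset.set0.
Proof.
move=> [_ sv]; apply: contra_eq_neq sv => /finset.setP sv; rewrite big1 ?(eq_sym 0) ?oner_neq0// => k _.
by have := sv k; rewrite in_support finset.in_set0 => /negbFE/eqP.
Qed.

Lemma faceE d (S : {set 'I_d.+1}) (x : simplex R d) :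
  face S x <-> support (set_val x) \subset S.
Proof.
split=> [xS|/fintype.subsetP xS k].
  by apply/fintype.subsetP => k; rewrite in_support; apply: contra_neqT => /xS.
by apply: contraNeq => xk; apply: xS; rewrite in_support.
Qed.

Lemma face_interiorE d (S : {set 'I_d.+1}) (x : simplex R d) :
  face_interior S x <-> support (set_val x) = S.
Proof.
split=> [[/faceE xS x0]|<-].
  apply/eqP; rewrite finset.eqEsubset xS; apply/fintype.subsetP => k /x0.
  by rewrite in_support => /lt0r_neq0.
split; first exact/faceE.
by move=> k; rewrite in_support lt0r coord_ge0 andbT.
Qed.

Definition uniform_row d (S : {set 'I_d}) : 'rV[R]_d :=
  \row_k (if k \in S then #|S|%:R^-1 else 0).

Lemma uniform_row_simplex d (S : {set 'I_d.+1}) :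
  S != finset.set0 -> simplex R d (uniform_row S).
Proof.
move=> S0; have cS : #|S|%:R != 0 :> R by rewrite pnatr_eq0 cards_eq0.
split=> [k|]; first by rewrite mxE; case: ifP; rewrite // invr_ge0 ler0n.
under eq_bigr do rewrite mxE.
by rewrite -big_mkcond /= sumr_const -[LHS]mulr_natr mulVf.
Qed.

Lemma support_uniform_row d (S : {set 'I_d}) : support (uniform_row S) = S.
Proof.
apply/finset.setP => k; rewrite in_support mxE; case: ifP => [kS|_]; last by rewrite eqxx.
by rewrite invr_eq0 pnatr_eq0 cards_eq0; apply/finset.set0Pn; exists k.
Qed.

Definition barycenter d (S : {set 'I_d.+1}) (S0 : S != finset.set0) : simplex R d :=
  simplex_point (uniform_row_simplex S0).

Lemma support_barycenter d (S : {set 'I_d.+1}) (S0 : S != finset.set0) :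
  support (set_val (barycenter S0)) = S.
Proof. exact: support_uniform_row. Qed.

Lemma finset1_neq0 (T : finType) (x : T) : [set x]%SET != finset.set0.
Proof. by apply/finset.set0Pn; exists x; rewrite finset.in_set1. Qed.

Definition vertex d (k : 'I_d.+1) : simplex R d := barycenter (finset1_neq0 k).

Lemma coord_vertex d (k l : 'I_d.+1) : coord (vertex k) l = (l == k)%:R.
Proof. by rewrite coord_simplex_point mxE inE cards1 invr1; case: ifP. Qed.

Lemma coord_le1 d (x : simplex R d) k : coord x k <= 1.
Proof.
by rewrite -(sum_coord x) (bigD1 k)//= lerDl sumr_ge0// => l _; exact: coord_ge0.
Qed.

Lemma coord_eq1 d (x : simplex R d) k : coord x k = 1 -> x = vertex k.
Proof.
move=> xk; apply: coord_inj => l; rewrite coord_vertex.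
case: eqVneq => [->//|lk]; have := sum_coord x.
rewrite (bigD1 k)//= (bigD1 l)//= xk => /eqP; rewrite -subr_eq0 addrAC subrr add0r.
rewrite paddr_eq0 ?coord_ge0 ?sumr_ge0//; first by case/andP => /eqP.
by move=> *; exact: coord_ge0.
Qed.

Lemma conv_coord d (t : {i01 R}) (x y z : simplex R d) :
  set_val z = point_conv t x y <->
  forall k, coord z k = t%:num * coord x k + (1 - t%:num) * coord y k.
Proof.
split=> [zxy k|zxy]; first by rewrite /coord zxy !mxE.
by apply/rowP => k; rewrite !mxE -[LHS]/(coord z k) zxy.
Qed.

End SimplexPoints.

(** * Color coordinates and connection of chambers *)

Lemma finsetT_neq0 d : [set: 'I_d.+1]%SET != finset.set0.
Proof. by apply/finset.set0Pn; exists ord0; rewrite finset.in_setT. Qed.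

Lemma missing_color n (S : {set 'I_n.+1}) c d : #|S| = n ->
  c \notin S -> d \notin S -> c = d.
Proof.
move=> cS cn dn; have /cards1P[e eS] : #|~: S| == 1%N.
  by rewrite cardsCs finset.setCK cS card_ord subSn// subnn.
have : c \in ~: S by rewrite finset.in_setC.
have : d \in ~: S by rewrite finset.in_setC.
by rewrite eS !inE => /eqP -> /eqP.
Qed.

Section ColorCoordinates.
Context {R : realType} {n : nat}.
Implicit Types X : colored R n.

Lemma color_coord_simplex X (i : sidx X) x : simplex R n (color_coord i x).
Proof.
split=> [c|]; first by rewrite mxE sumr_ge0// => k _; exact: coord_ge0.
under eq_bigr do rewrite mxE.
rewrite (exchange_big_dep xpredT)//= -[RHS](sum_coord x); apply: eq_bigr => k _.
by rewrite (eq_bigl (pred1 (vcol i k))) ?big_pred1_eq// => c; rewrite /= eq_sym.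
Qed.

Lemma color_coord_conv X (i : sidx X) (t : {i01 R}) (x y z : simplex R (sdim i)) c :
  set_val z = point_conv t x y ->
  color_coord i z 0 c =
    t%:num * color_coord i x 0 c + (1 - t%:num) * color_coord i y 0 c.
Proof.
move=> /conv_coord zxy; rewrite !mxE !mulr_sumr -big_split/=.
by apply: eq_bigr => k _; exact: zxy.
Qed.

Section Injective.
Context {X} {i : sidx X} (vi : injective (vcol i)).

Lemma color_coord_vcol x k : color_coord i x 0 (vcol i k) = coord x k.
Proof. by rewrite mxE (eq_bigl (pred1 k)) ?big_pred1_eq// => l; rewrite /= inj_eq. Qed.

Lemma support_color_coord x :
  support (color_coord i x) = vcol i @: support (set_val x).
Proof.
apply/finset.setP => c; rewrite in_support; apply/idP/imsetP => [|[k + ->]]; last first.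
  by rewrite in_support color_coord_vcol.
rewrite mxE => xc; have [k /andP[/eqP <- xk]|x0] := pickP [pred k | (vcol i k == c) && (coord x k != 0)].
  by exists k; rewrite // in_support.
case/eqP: xc; apply: big1 => k kc; move: (x0 k); rewrite /= kc /=.
by move/negbFE/eqP.
Qed.

Lemma face_color_coord (S : {set 'I_(sdim i).+1}) x :
  face S x <-> support (color_coord i x) \subset vcol i @: S.
Proof.
rewrite faceE support_color_coord; split; first exact: imsetS.
move=> /fintype.subsetP h; apply/fintype.subsetP => k kx.
by have /imsetP[l lS /vi ->] := h _ (imset_f _ kx).
Qed.

Lemma color_coord_inj : injective (color_coord i).
Proof.
by move=> x y xy; apply: coord_inj => k; rewrite -!color_coord_vcol xy.
Qed.

Lemma color_coord_onto v : simplex R n v -> support v \subset vcol i @: [set: 'I_(sdim i).+1]%SET ->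
  exists x, color_coord i x = v.
Proof.
move=> [v0 v1] /fintype.subsetP vS.
have v_out c : c \notin codom (vcol i) -> v 0 c = 0.
  apply: contraNeq => vc; have /imsetP[k _ ->] : c \in vcol i @: [set: 'I_(sdim i).+1]%SET.
    by apply: vS; rewrite in_support.
  exact: codom_f.
(* Pulling [v] back along [vcol i] loses no mass, since [v] vanishes on the colors that do not occur
   in the simplex. *)
have Hw : simplex R (sdim i) (\row_k v 0 (vcol i k)).
  split=> [k|]; first by rewrite mxE.
  under eq_bigr do rewrite mxE.
  rewrite -v1 -(big_map (vcol i) xpredT (v 0)) /=.
  rewrite [RHS](bigID (mem (codom (vcol i))))/= [X in _ + X]big1 ?addr0; last first.
    by move=> c; exact: v_out.
  rewrite big_uniq/= ?map_inj_uniq ?index_enum_uniq//.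
  by apply: eq_bigl => c; rewrite codomE enumT.
exists (simplex_point Hw); apply/rowP => c.
have [/codomP[k ->]|ck] := boolP (c \in codom (vcol i)).
  by rewrite color_coord_vcol coord_simplex_point mxE.
rewrite v_out// mxE big1// => k /eqP kc.
by case/negP: ck; rewrite -kc codom_f.
Qed.

Lemma color_coord_conv_iff (t : {i01 R}) (x y z : simplex R (sdim i)) :
  set_val z = point_conv t x y <->
  forall c, color_coord i z 0 c =
    t%:num * color_coord i x 0 c + (1 - t%:num) * color_coord i y 0 c.
Proof.
split=> [zxy c|zxy]; first exact: color_coord_conv.
by apply/conv_coord => k; rewrite -!color_coord_vcol zxy.
Qed.

End Injective.

Lemma imset_vcol_full X (i : sidx X) : injective (vcol i) -> sdim i = n ->
  vcol i @: [set: 'I_(sdim i).+1]%SET = [set: 'I_n.+1]%SET.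
Proof.
move=> vi di; apply/eqP; rewrite eqEcard finset.subsetT/= card_imset//.
by rewrite !cardsT !card_ord di.
Qed.

Lemma color_point X (i : sidx X) v : injective (vcol i) -> sdim i = n ->
  simplex R n v -> exists x, color_coord i x = v.
Proof.
move=> vi di Hv; apply: color_coord_onto => //.
by rewrite imset_vcol_full// finset.subsetT.
Qed.

Lemma color_support_point X (i : sidx X) (S : {set 'I_n.+1}) : injective (vcol i) ->
  sdim i = n -> S != finset.set0 -> exists x, support (color_coord i x) = S.
Proof.
move=> vi di S0; have [x xS] := color_point vi di (uniform_row_simplex (R := R) S0).
by exists x; rewrite xS support_uniform_row.
Qed.

Lemma boundary_support X (i : sidx X) x : injective (vcol i) -> sdim i = n ->
  simplex_boundary x <-> exists c, c \notin support (color_coord i x).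
Proof.
move=> vi di; split=> [[k xk]|[c]].
  by exists (vcol i k); rewrite in_support negbK color_coord_vcol// xk.
have : c \in vcol i @: [set: 'I_(sdim i).+1]%SET by rewrite imset_vcol_full.
move=> /imsetP[k _ ->]; rewrite in_support color_coord_vcol// negbK => /eqP ?.
by exists k.
Qed.

End ColorCoordinates.

Definition chamber := (bool * nat)%type.

Section Connection.
Context {n : nat}.
Implicit Types (g : tuple_perm n) (S : {set 'I_n.+1}) (u v : chamber).

(* In Sigma g, chambers u and v share a face of some color outside S. *)
Definition adjacent g S u v : Prop :=
  exists c p, [/\ c \notin S, u = (true, p) & v = (false, g c p)].

(** By [chart_Sigma], this is the identification in [Sigma g] of the points of [u] and [v] that have
    the same coordinates, with support [S]. *)
Definition conn g S : chamber -> chamber -> Prop :=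
  clos_refl_sym_trans chamber (adjacent g S).

Lemma conn_refl g S u : conn g S u u.
Proof. exact: rst_refl. Qed.

Lemma conn_sym g S u v : conn g S u v -> conn g S v u.
Proof. exact: rst_sym. Qed.

Lemma conn_trans g S v u w : conn g S u v -> conn g S v w -> conn g S u w.
Proof. exact: rst_trans. Qed.

Lemma clos_rst_mono (T : Type) (r r' : T -> T -> Prop) :
  (forall x y, r x y -> clos_refl_sym_trans T r' x y) ->
  forall x y, clos_refl_sym_trans T r x y -> clos_refl_sym_trans T r' x y.
Proof.
move=> rr' x y; elim=> {x y} [x y /rr'//|x|x y _|x y z _ + _].
- exact: rst_refl.
- exact: rst_sym.
- exact: rst_trans.
Qed.

Lemma conn_mono g S S' u v : S' \subset S -> conn g S u v -> conn g S' u v.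
Proof.
move=> /fintype.subsetP SS; apply: clos_rst_mono => x y [c [p [cS -> ->]]].
by apply: rst_step; exists c, p; split=> //; apply: contra cS => /SS.
Qed.

Lemma conn_full g u v : conn g [set: 'I_n.+1]%SET u v -> u = v.
Proof.
elim=> {u v} [u v [c [p []]]|//|//|u v w _ -> _ ->//].
by rewrite finset.in_setT.
Qed.

Lemma conn_neq g S u v : u <> v -> conn g S u v -> exists c, c \notin S.
Proof.
move=> uv h; apply: contrapT => /forallNP nS; apply: uv.
elim: h => {u v} [u v [c [p [cS _ _]]]|//|//|u v w _ -> _ ->//].
by case: (nS c).
Qed.

(* A color-c edge of the bipartite graph of g is named by its plus end. *)
Definition plus_end (f : nat -> nat) (u : chamber) : nat :=
  if u.1 then u.2 else xget 0%N [set p | f p = u.2].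

Lemma plus_end_plus f p : plus_end f (true, p) = p.
Proof. by []. Qed.

Lemma plus_end_minus f p : injective f -> plus_end f (false, f p) = p.
Proof. by move=> fi; apply: fi; apply: (@xgetPex _ 0%N [set q | f q = f p]); exists p. Qed.

Lemma plus_endK f u : bijective f -> ~~ u.1 -> f (plus_end f u) = u.2.
Proof.
case: u => -[]//= q [h fh hf] _; rewrite -[in plus_end _ _](hf q) plus_end_minus ?hf//.
exact: can_inj fh.
Qed.

(** At most the color [c] is outside [S], so the gallery can only go to and fro along a single
    edge. *)
Lemma conn_plus_end g S c u v : injective (g c) -> [set~ c]%SET \subset S ->
  conn g S u v -> plus_end (g c) u = plus_end (g c) v.
Proof.
move=> gi /fintype.subsetP cS; elim=> {u v} [u v [d [p [dS -> ->]]]|//|//|u v w _ -> _ ->//].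
have -> : d = c by apply: contraNeq dS => dc; apply: cS; rewrite !inE.
by rewrite plus_end_minus.
Qed.

Lemma plus_end_conn g S c u v : bijective (g c) -> c \notin S ->
  plus_end (g c) u = plus_end (g c) v -> conn g S u v.
Proof.
move=> gb cS; have gi := bij_inj gb.
suff H w : conn g S (true, plus_end (g c) w) w.
  by move=> uv; apply: (@conn_trans _ _ (true, plus_end (g c) u)); [exact/conn_sym|rewrite uv].
have [[]|] := boolP w.1; case: w => -[] p//= _; first exact: conn_refl.
apply: rst_step; exists c, (plus_end (g c) (false, p)); split=> //.
by rewrite plus_endK.
Qed.

End Connection.

(** * Topology of the realization *)

Section Realization.
Context {R : realType}.
Implicit Types X : simplex_quotient R.

Lemma row_continuous (T : topologicalType) m (f : T -> 'rV[R]_m) :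
  (forall k, continuous (fun z => f z 0 k)) -> continuous f.
Proof.
move=> fc z A [P /= Pn PA].
have : \forall w \near z, forall k : 'I_m, P 0 k (f w 0 k).
  by apply: filter_forall => k; apply: fc; exact: Pn.
apply: filterS => w Pw; apply: PA => i k; rewrite [i]ord1; exact: Pw.
Qed.

Lemma coord_continuous_simplex d (k : 'I_d.+1) : continuous (fun x : simplex R d => coord x k).
Proof.
move=> x; apply: (@continuous_comp _ _ _ set_val (fun v : 'rV[R]_d.+1 => v 0 k)).
  exact: initial_continuous.
exact: coord_continuous.
Qed.

Lemma simplex_continuous (T : topologicalType) d (f : T -> simplex R d) :
  (forall k, continuous (fun z => coord (f z) k)) -> continuous f.
Proof.
move=> fc; apply: continuous_comp_initial; apply: row_continuous => k.
exact: fc.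
Qed.

Lemma chart_continuous X (i : sidx X) : continuous (chart i).
Proof.
move=> x; apply: (@continuous_comp _ _ _ (existT _ i) (\pi_(realization X))).
  exact: existT_continuous.
exact: pi_continuous.
Qed.

Lemma chart_surj X (p : realization X) : exists i (x : simplex R (sdim i)), p = chart i x.
Proof. by case: (repr p) (reprK p) => i x <-; exists i, x. Qed.

Lemma realization_openP X (A : set (realization X)) :
  open A <-> forall i, open (chart i @^-1` A).
Proof. exact: sigT_openP. Qed.

Lemma realization_closedP X (A : set (realization X)) :
  closed A <-> forall i, closed (chart i @^-1` A).
Proof.
rewrite -openC realization_openP; split=> h i; first by rewrite -openC preimage_setC.
by rewrite -preimage_setC openC.
Qed.

Lemma realization_continuous X (Z : topologicalType) (f : realization X -> Z) :
  (forall i, continuous (f \o chart i)) -> continuous f.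
Proof.
move=> fc; apply/continuousP => A oA; apply/realization_openP => i.
by rewrite -comp_preimage; move/continuousP: (fc i); exact.
Qed.

Lemma chart_glue (I : choiceType) (d : I -> nat) G i j (x : simplex R (d i)) (y : simplex R (d j)) :
  @chart R (@glue_simplices R I d G) i x = @chart R (@glue_simplices R I d G) j y <->
  clos_refl_sym_trans (simplex_sum R d) (fun p q => G _ _ (projT2 p) (projT2 q))
    (existT _ i x) (existT _ j y).
Proof.
have E : (@chart R (glue_simplices G) i x = @chart R (glue_simplices G) j y) =
  (\pi_{eq_quot (sglue (glue_simplices G))} (existT _ i x : simplex_sum R d) =
   \pi_{eq_quot (sglue (glue_simplices G))} (existT _ j y : simplex_sum R d)) by [].
rewrite E; split=> [/eqmodP/asboolP //|h]; exact/eqmodP/asboolP.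
Qed.

Definition is_convex d (A : set (simplex R d)) : Prop :=
  forall x y z t, A x -> A y -> set_val z = point_conv t x y -> A z.

(** Makes [segment_path] a total continuous function of a real parameter. *)
Definition clamp (t : R) : R := Num.max 0 (Num.min t 1).

Lemma clamp01 t : 0 <= clamp t <= 1.
Proof. by rewrite /clamp le_max lexx/= ge_max ler01 ge_min lexx orbT. Qed.

Lemma clamp_continuous : continuous clamp.
Proof.
move=> t; apply: (@continuous_max R R (cst 0) (fun t => Num.min t 1)); first exact: cvg_cst.
by apply: (@continuous_min R R id (cst 1)); [exact: cvg_id|exact: cvg_cst].
Qed.

Lemma path_proof d (x y : simplex R d) (t : R) :
  simplex R d (\row_k (clamp t * coord x k + (1 - clamp t) * coord y k)).
Proof.
have /andP[t0 t1] := clamp01 t.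
split=> [k|]; first by rewrite mxE addr_ge0// mulr_ge0// ?coord_ge0// subr_ge0.
under eq_bigr do rewrite mxE.
by rewrite big_split/= -!mulr_sumr !sum_coord !mulr1 addrC subrK.
Qed.

Definition segment_path d (x y : simplex R d) (t : R) : simplex R d :=
  simplex_point (path_proof x y t).

Lemma segment_path_continuous d (x y : simplex R d) : continuous (segment_path x y).
Proof.
apply: simplex_continuous => k.
rewrite (_ : (fun _ => _) = fun t => clamp t * coord x k + (1 - clamp t) * coord y k); last first.
  by apply/funext => t; rewrite coord_simplex_point mxE.
move=> t; apply: cvgD; apply: cvgMl; first exact: clamp_continuous.
by apply: cvgB; [exact: cvg_cst|exact: clamp_continuous].
Qed.

Lemma convex_connected d (A : set (simplex R d)) : is_convex A -> connected A.
Proof.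
move=> Ac; have [[x0 Ax0]|A0] := pselect (A !=set0); last first.
  have -> : A = set0 by apply/seteqP; split=> // x Ax; case: A0; exists x.
  exact: connected0.
have -> : A = \bigcup_(y in A) (segment_path x0 y @` `[0, 1]).
  apply/seteqP; split=> [y Ay|z [y Ay [t /=]]].
    exists y => //; exists 0; first by rewrite /= in_itv/= lexx ler01.
    apply: coord_inj => k; rewrite coord_simplex_point mxE /clamp.
    by rewrite min_l// maxxx mul0r add0r subr0 mul1r.
  rewrite in_itv/= => /andP[t0 t1] <-.
  apply: (Ac x0 y _ (Itv01 t0 t1)) => //; apply/conv_coord => k.
  by rewrite coord_simplex_point mxE /clamp min_l// max_r.
apply: bigcup_connected.
  exists x0 => y Ay; exists 1; first by rewrite /= in_itv/= lexx ler01.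
  apply: coord_inj => k; rewrite coord_simplex_point mxE /clamp.
  by rewrite minxx max_r// subrr mul0r addr0 mul1r.
move=> y Ay; apply: connected_continuous_connected; first exact: segment_connected.
exact/continuous_subspaceT/segment_path_continuous.
Qed.

Lemma simplex_image_connected X (i : sidx X) : connected (simplex_image i).
Proof.
apply: connected_continuous_connected; first exact: convex_connected.
exact/continuous_subspaceT/chart_continuous.
Qed.

End Realization.

Lemma color_coord_continuous {R : realType} {n : nat} (X : colored R n) (i : sidx X) :
  continuous (color_coord i).
Proof.
apply: row_continuous => c.
rewrite (_ : (fun _ => _) = fun x => \sum_(k | vcol i k == c) coord x k); last first.
  by apply/funext => x; rewrite mxE.
by apply: continuous_big => [|k _]; [exact: add_continuous|exact: coord_continuous_simplex].
Qed.

(** * Presentations by tuples of permutations *)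

Section Presentation.
Context {R : realType} {n : nat}.

(* r sends a simplex to a chamber of Sigma g, in the set U, whose copy in P
   contains the image of the simplex: P is Sigma g restricted to U. Simplices of
   dimension < n may lie in several chambers, any of which is allowed. *)
Record presentation (U : set chamber) (a b : nat) (g : tuple_perm n)
    (P : labeled R n 'I_a 'I_b) (r : sidx P -> chamber) : Prop := Presentation {
  pr_vcol : forall i : sidx P, injective (vcol i);
  pr_fcol : forall (i : sidx P) (S : {set 'I_(sdim i).+1}), #|S| = n ->
    fcol i S \notin vcol i @: S;
  pr_chart : forall (i j : sidx P) x y, chart i x = chart j y <->
    color_coord i x = color_coord j y /\ conn g (support (color_coord i x)) (r i) (r j);
  pr_plus : forall i : sidx P, sdim i = n -> is_plus i = (r i).1;
  pr_plab : forall (i : sidx P) s, plab s i <-> sdim i = n /\ r i = (true, val s);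
  pr_mlab : forall (i : sidx P) s, mlab s i <-> sdim i = n /\ r i = (false, val s);
  pr_in : forall i, U (r i);
  pr_onto : forall u, U u -> exists2 i : sidx P, sdim i = n & r i = u
}.

Definition adjacency_closed (g : tuple_perm n) (U : set chamber) : Prop :=
  forall c p, U (true, p) <-> U (false, g c p).

Lemma conn_closed g U S u v : adjacency_closed g U -> conn g S u v -> (U u <-> U v).
Proof.
move=> Uc; elim=> {u v} [u v [c [p [_ -> ->]]]|//|u v _ -> //|u v w _ -> _ ->//].
exact: Uc.
Qed.

(** The two chambers are glued along all their faces and lose their labels when only the labels
    below [a] and [b] are kept. [labelless_double_iff] shows that these are the unlabeled
    double-chambers. *)
Definition trivial_pair (a b : nat) (g : tuple_perm n) (p q : nat) : Prop :=
  [/\ (a <= p)%N, (b <= q)%N & forall c, g c p = q].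

Definition trivial_chamber (a b : nat) (g : tuple_perm n) (u : chamber) : Prop :=
  exists p q, trivial_pair a b g p q /\ (u = (true, p) \/ u = (false, q)).

Definition nontrivial (a b : nat) (g : tuple_perm n) : set chamber :=
  [set u | ~ trivial_chamber a b g u].

Lemma trivial_pair_closed a b g p q : (forall c, injective (g c)) ->
  trivial_pair a b g p q ->
  adjacency_closed g [set u | u = (true, p) \/ u = (false, q)].
Proof.
move=> gi [_ _ gpq] c p'; split=> -[] //=.
- by case=> ->; right; rewrite gpq.
- by case; rewrite -(gpq c) => /gi ->; left.
Qed.

Lemma trivial_chamber_closed a b g : (forall c, injective (g c)) ->
  adjacency_closed g (trivial_chamber a b g).
Proof.
move=> gi c p; split=> -[p' [q' [pq upq]]]; exists p', q'; split=> //.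
- exact: (trivial_pair_closed gi pq c p).1.
- exact: (trivial_pair_closed gi pq c p).2.
Qed.

Lemma nontrivial_closed a b g : (forall c, injective (g c)) ->
  adjacency_closed g (nontrivial a b g).
Proof. by move=> gi c p; split; apply: contra_not => /(trivial_chamber_closed a b gi). Qed.

Section Theory.
Context {U : set chamber} {a b : nat} {g : tuple_perm n}
  {P : labeled R n 'I_a 'I_b} {r : sidx P -> chamber}.
Hypothesis pr : presentation U g r.

Lemma presentation_image_eq (i j : sidx P) : sdim j = n -> r i = r j ->
  simplex_image i `<=` simplex_image j.
Proof.
move=> dj ij _ [x _ <-].
have [y yx] := color_point (pr_vcol pr (i := j)) dj (color_coord_simplex x).
exists y => //; apply/esym/(pr_chart pr); split; first exact/esym.
by rewrite ij; exact: conn_refl.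
Qed.

Lemma presentation_chart_inj (i : sidx P) : injective (chart i).
Proof. by move=> x y /(pr_chart pr)[/(color_coord_inj (pr_vcol pr (i := i)))]. Qed.

Lemma presentation_chart_share (i j : sidx P) x : sdim j = n ->
  simplex_image j (chart i x) <-> conn g (support (color_coord i x)) (r i) (r j).
Proof.
move=> dj; split=> [[y _ /esym /(pr_chart pr)[]//]|ij].
have [y yx] := color_point (pr_vcol pr (i := j)) dj (color_coord_simplex x).
exists y => //; apply/esym/(pr_chart pr); split=> //; exact/esym.
Qed.


Hypothesis n_gt0 : (1 <= n)%N.
Hypothesis gb : forall c, bijective (g c).
Hypothesis Uc : adjacency_closed g U.

Lemma setC1_neq0 (c : 'I_n.+1) : [set~ c]%SET != finset.set0.
Proof. by rewrite -cards_eq0 cardsC1 card_ord; case: (n) n_gt0. Qed.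

Lemma presentation_sharing_color (i j : sidx P) c x : [set~ c]%SET \subset support (color_coord i x) ->
  simplex_image j (chart i x) -> plus_end (g c) (r i) = plus_end (g c) (r j).
Proof.
move=> cx [y _ /esym/(pr_chart pr)[_]]; apply: conn_plus_end => //.
exact: bij_inj.
Qed.

Lemma presentation_in_pair p q (k l : sidx P) : trivial_pair a b g p q ->
  sdim k = n -> sdim l = n -> r k = (true, p) -> r l = (false, q) ->
  forall (i : sidx P) x, (simplex_image k `|` simplex_image l) (chart i x) <->
    (r i = (true, p) \/ r i = (false, q)).
Proof.
move=> pq dk dl rk rl i x.
have gi c := bij_inj (gb c).
split=> [[]|[]] => [/presentation_chart_share|/presentation_chart_share|ri|ri].
- move=> /(_ dk) h; apply: (conn_closed (trivial_pair_closed gi pq) h).2.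
  by left.
- move=> /(_ dl) h; apply: (conn_closed (trivial_pair_closed gi pq) h).2.
  by right.
- by left; apply: (presentation_image_eq dk (etrans ri (esym rk))); exists x.
- by right; apply: (presentation_image_eq dl (etrans ri (esym rl))); exists x.
Qed.

(** Galleries do not leave the pair, so each simplex is mapped entirely into [D] or entirely outside
    it. Thus [D] is open and closed; being also connected, it is a component. *)
Lemma trivial_labelless_double p q (k l : sidx P) : trivial_pair a b g p q ->
  sdim k = n -> sdim l = n -> r k = (true, p) -> r l = (false, q) ->
  labelless_double_chamber (simplex_image k `|` simplex_image l).
Proof.
move=> pq dk dl rk rl; have in_pair := presentation_in_pair pq dk dl rk rl.
have vk := pr_vcol pr (i := k); have vl := pr_vcol pr (i := l).
have glue (x : simplex R (sdim k)) (y : simplex R (sdim l)) :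
    chart k x = chart l y <-> color_coord k x = color_coord l y /\ simplex_boundary x.
  rewrite (pr_chart pr) rk rl; split=> -[xy].
    by move=> /conn_neq[]// c cx; split=> //; apply/boundary_support => //; exists c.
  move=> /(boundary_support _ vk dk)[c cx]; split=> //.
  by apply: rst_step; exists c, p; case: pq => _ _ ->.
set D := _ `|` _.
have clopen_chart (m : sidx P) : chart m @^-1` D = setT \/ chart m @^-1` D = set0.
  have [rm|rm] := pselect (r m = (true, p) \/ r m = (false, q)); [left|right].
    by apply/seteqP; split=> // x _; apply/in_pair.
  by apply/seteqP; split=> // x /in_pair.
have oD : open D.
  by apply/realization_openP => m; case: (clopen_chart m) => ->; [exact: openT|exact: open0].
have cD : closed D.
  by apply/realization_closedP => m; case: (clopen_chart m) => ->; [exact: closedT|exact: closed0].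
split.
- pose x0 : simplex R (sdim k) := vertex ord0.
  have Dx0 : D (chart k x0) by left; exists x0.
  exists (chart k x0); apply/seteqP; split.
    apply: connected_component_max => //; apply: connectedU; try exact: simplex_image_connected.
    have [y yx0] := color_point vl dl (color_coord_simplex x0).
    exists (chart k x0); split; first by exists x0.
    exists y => //; apply/esym/glue; split; first exact/esym.
    (* As n is positive, [ord_max] differs from [ord0]: the vertex [x0] lies on the boundary, where
       the two chambers meet. *)
    exists ord_max; rewrite coord_vertex -val_eqE /= dk.
    by case: (n) n_gt0.
  move=> y [C [Cx0 _ Cc] Cy].
  have CD : C `&` D = C by apply: Cc; [exists (chart k x0)|exists D|exists D].
  by move: Cy; rewrite -CD => -[].
- exists k, l; split=> //.
  by rewrite !(pr_plus pr)// rk rl.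
- move=> m mD; have /in_pair rm : D (chart m (vertex ord0)) by apply: mD; exists (vertex ord0).
  case: pq => ap bq _; split=> s.
  + move=> /(pr_plab pr)[_ rms]; rewrite rms in rm; case: rm => -[] // sp.
    by move: (ltn_ord s); rewrite sp ltnNge ap.
  + move=> /(pr_mlab pr)[_ rms]; rewrite rms in rm; case: rm => -[] // sq.
    by move: (ltn_ord s); rewrite sq ltnNge bq.
Qed.

Lemma labelless_double_trivial (D : set (realization P)) (i : sidx P) :
  labelless_double_chamber D -> simplex_image i `<=` D -> trivial_chamber a b g (r i).
Proof.
have gi c := bij_inj (gb c).
move=> [_ [k [l [[dk dl] [pk pl] DE glue]]] Dl] iD.
have vk := pr_vcol pr (i := k); have vl := pr_vcol pr (i := l).
move: pk pl; rewrite !(pr_plus pr)//.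
case rk : (r k) => [[] p]//= _; case rl : (r l) => [[] q]//= _.
have pq : trivial_pair a b g p q.
  split=> [||c].
  - rewrite leqNgt; apply/negP => pa; have [|/(_ (Ordinal pa))+ _] := Dl k.
      by rewrite DE; exact: subsetUl.
    by apply; apply/(pr_plab pr).
  - rewrite leqNgt; apply/negP => qb; have [|_ /(_ (Ordinal qb))+] := Dl l.
      by rewrite DE; exact: subsetUr.
    by apply; apply/(pr_mlab pr).
  (* The barycenter of the face of color [c] lies in both chambers, and its support contains every
     color but [c]. It therefore determines the edge of color [c], which gives [g c p = q]. *)
  - have Hc := uniform_row_simplex (setC1_neq0 c) : simplex R n _.
    have [x xc] := color_point vk dk Hc; have [y yc] := color_point vl dl Hc.
    have /presentation_sharing_color : simplex_image l (chart k x).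
      exists y => //; apply/esym/glue; split; first by rewrite xc yc.
      apply/boundary_support => //; exists c; rewrite xc support_uniform_row.
      by rewrite !inE eqxx.
    move=> /(_ c); rewrite xc support_uniform_row fintype.subxx rk rl => /(_ isT).
    rewrite plus_end_plus => ->.
    by rewrite plus_endK.
pose x : simplex R (sdim i) := vertex ord0.
have : D (chart i x) by apply: iD; exists x.
have in_pair := presentation_in_pair pq dk dl rk rl.
by rewrite DE => /in_pair ri; exists p, q.
Qed.

Lemma labelless_double_iff (i : sidx P) :
  (exists D : set (realization P), labelless_double_chamber D /\ simplex_image i `<=` D) <->
  trivial_chamber a b g (r i).
Proof.
split=> [[D [Dd iD]]|[p [q [pq ri]]]]; first exact: labelless_double_trivial iD.
have Upq : U (true, p) <-> U (false, q) by case: pq => _ _ /(_ ord0) <-; exact: Uc.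
have [Up Uq] : U (true, p) /\ U (false, q) by case: ri (pr_in pr i) => -> /[dup]/Upq.
have [k dk rk] := pr_onto pr Up; have [l dl rl] := pr_onto pr Uq.
exists (simplex_image k `|` simplex_image l); split.
  exact: trivial_labelless_double rk rl.
by move=> _ [x _ <-]; apply/(presentation_in_pair pq dk dl rk rl).
Qed.

End Theory.
End Presentation.

(** * Removal of unlabeled double-chambers *)

Section Removal.
Context {R : realType} {n : nat}.

Lemma clos_rst_eq (T V : Type) (f : T -> V) x y :
  clos_refl_sym_trans T (fun p q => f p = f q) x y <-> f x = f y.
Proof.
split=> [|xy]; last exact: rst_step.
by elim=> {x y} [//|//|//|x y z _ -> _ ->].
Qed.

(** The set [U] is allowed to contain trivial chambers: all those of [Sigma g] in the case of
    [bordism_of], and those that gluing creates in the case of a composite. *)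
Lemma remove_presentation (U : set chamber) a b g (P : labeled R n 'I_a 'I_b) r :
  (1 <= n)%N -> (forall c, bijective (g c)) -> adjacency_closed g U ->
  nontrivial a b g `<=` U -> presentation U g r ->
  presentation (nontrivial a b g) g
    (fun i : sidx (remove_labelless_double_chambers P) => r (\val i)).
Proof.
move=> n_gt0 gb Uc nU pr; split.
- by move=> i; exact: pr_vcol pr (\val i).
- by move=> i; exact: pr_fcol pr (\val i).
- move=> i j x y; rewrite -(pr_chart pr) chart_glue.
  exact: (clos_rst_eq (fun p : simplex_sum R
    (fun i : sidx (remove_labelless_double_chambers P) => sdim (\val i)) =>
    chart (\val (projT1 p)) (projT2 p))).
- by move=> i; exact: pr_plus pr (\val i).
- by move=> i; exact: pr_plab pr (\val i).
- by move=> i; exact: pr_mlab pr (\val i).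
- by move=> [i /= /asboolP iD] /(labelless_double_iff pr n_gt0 gb Uc).
- move=> u nu; have [i di riu] := pr_onto pr (nU _ nu).
  have iD : `[< ~ exists D : set (realization P),
                   labelless_double_chamber D /\ simplex_image i `<=` D >].
    by apply/asboolP => /(labelless_double_iff pr n_gt0 gb Uc); rewrite riu.
  by exists (exist _ i iD).
Qed.

Lemma color_coord_Sigma (g : tuple_perm n) (i : sidx (Sigma R g)) x :
  color_coord i x = set_val x.
Proof.
apply/rowP => c; have vi : injective (vcol i) by [].
by rewrite -[c in LHS]/(vcol i c) (color_coord_vcol vi).
Qed.

(** A gluing along color [c] leaves [x] unchanged and applies to it only if its coordinate [c]
    vanishes, so chains of gluings at [x] are galleries crossing colors outside its support. *)
Lemma chart_Sigma (g : tuple_perm n) (i j : sidx (Sigma R g)) (x y : simplex R n) :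
  @chart R (Sigma R g) i x = @chart R (Sigma R g) j y <->
    x = y /\ conn g (support (set_val x)) i j.
Proof.
rewrite chart_glue; split=> [|[<-]].
  suff H (p q : simplex_sum R (fun=> n : nat)) : clos_refl_sym_trans (simplex_sum R (fun=> n))
      (fun p q => Sigma_glue g (projT1 p) (projT1 q) (projT2 p) (projT2 q)) p q ->
      projT2 p = projT2 q :> simplex R n /\
      conn g (support (set_val (projT2 p))) (projT1 p) (projT1 q) by move=> /H.
  elim=> {p q} [p q [c [k [-> -> <- /faceE h]]]|p|p q _ [<-]|p q r _ [<-] pq _ [<-]].
  - split=> //; apply: rst_step; exists c, k; split=> //.
    by apply/negP => /(fintype.subsetP h); rewrite !inE eqxx.
  - by split=> //; exact: conn_refl.
  - by move=> /conn_sym.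
  - by split=> //; exact: conn_trans pq _.
elim=> {i j} [i j [c [p [cx -> ->]]]|i|i j _|i j k _ + _].
- apply: rst_step; exists c, p; split=> //=; apply/faceE.
  by apply/fintype.subsetP => k kx; rewrite !inE; apply: contraNneq cx => <-.
- exact: rst_refl.
- exact: rst_sym.
- exact: rst_trans.
Qed.

Lemma Sigma_presentation a b (g : tuple_perm n) :
  presentation setT g (id : sidx (relabel (@nat_of_ord a) (@nat_of_ord b) (Sigma R g)) -> chamber).
Proof.
split=> //.
- by move=> i k l.
- move=> i S cS; apply/imsetP => -[k kS /=]; case: pickP => [c /= cS0 kc|S0 _].
    by rewrite -kc (negbTE cS0) in kS.
  have : #|S| = n.+1 by rewrite -[RHS]card_ord; apply: eq_card => c; rewrite (negbFE (S0 c)).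
  by rewrite cS => /n_Sn.
- move=> i j x y; rewrite !color_coord_Sigma; split=> [/chart_Sigma[<- h]//|[/val_inj <- h]].
  exact/chart_Sigma.
- by move=> i s; split=> [->//|[_ ->]].
- by move=> i s; split=> [->//|[_ ->]].
- by move=> u _; exists u.
Qed.

Lemma bordism_of_presentation a b (g : tuple_perm n) :
  (1 <= n)%N -> (forall c, bijective (g c)) ->
  presentation (nontrivial a b g) g (fun i : sidx (bordism_of R a b g) => \val i).
Proof.
by move=> n_gt0 gb; apply: (remove_presentation _ _ _ _ (@Sigma_presentation a b g)).
Qed.

End Removal.

(** * Isomorphisms of presented pseudomanifolds *)

Section Comparison.
Context {R : realType} {n : nat} {a b : nat}.
Implicit Types P Q : labeled R n 'I_a 'I_b.

Section OneWay.
Context {P Q : labeled R n 'I_a 'I_b} {U : set chamber} {g : tuple_perm n}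
  {rP : sidx P -> chamber} {rQ : sidx Q -> chamber}.
Hypotheses (prP : presentation U g rP) (prQ : presentation U g rQ).

(** The graph of the isomorphism to be built. As a relation symmetric in [P] and [Q] it yields the
    inverse map by the same lemmas with the roles exchanged. *)
Definition matching (p : realization P) (q : realization Q) : Prop :=
  exists i j x y, [/\ p = chart i x, q = chart j y, color_coord i x = color_coord j y &
    conn g (support (color_coord i x)) (rP i) (rQ j)].

Lemma matching_chart i j x y : matching (chart i x) (chart j y) <->
  color_coord i x = color_coord j y /\ conn g (support (color_coord i x)) (rP i) (rQ j).
Proof.
split=> [|[xy ij]]; last by exists i, j, x, y.
move=> [i' [j' [x' [y' [/(pr_chart prP)[xx ii] /(pr_chart prQ)[yy jj] xy ij]]]]].
split; first by rewrite xx xy yy.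
apply: conn_trans ii _; rewrite xx; apply: conn_trans ij _.
by rewrite xy -yy; exact: conn_sym.
Qed.

Lemma matching_functional p q q' : matching p q -> matching p q' -> q = q'.
Proof.
have [i [x ->]] := chart_surj p; have [j [y ->]] := chart_surj q.
have [j' [y' ->]] := chart_surj q'.
move=> /matching_chart[xy ij] /matching_chart[xy' ij']; apply/(pr_chart prQ).
by rewrite -xy; split=> //; exact: conn_trans (conn_sym ij) ij'.
Qed.

Lemma matching_index i : exists2 j : sidx Q, sdim j = n & rQ j = rP i.
Proof. by have [j] := pr_onto prQ (pr_in prP i); exists j. Qed.

(** A chamber [j] at the same place as [i] has all colors, so the matching lifts to a map of
    simplices that preserves color coordinates; continuity can be read off there. *)
Lemma matching_point i j : sdim j = n -> rQ j = rP i ->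
  exists s : simplex R (sdim i) -> simplex R (sdim j),
    [/\ forall x, color_coord j (s x) = color_coord i x,
        forall x, matching (chart i x) (chart j (s x)) & continuous s].
Proof.
move=> dj ji; have vj := pr_vcol prQ (i := j).
have /choice[s sE] (x : simplex R (sdim i)) :
  exists y : simplex R (sdim j), color_coord j y = color_coord i x.
  exact/color_point/color_coord_simplex.
exists s; split=> // [x|].
  by apply/matching_chart; rewrite sE ji; split=> //; exact: conn_refl.
apply: simplex_continuous => k.
rewrite (_ : (fun _ => _) = fun x => color_coord i x 0 (vcol j k)); last first.
  by apply/funext => x; rewrite -sE color_coord_vcol.
move=> x; apply: (@continuous_comp _ _ _ (color_coord i) (fun v : 'rV[R]_n.+1 => v 0 (vcol j k))).
  exact: color_coord_continuous.
exact: coord_continuous.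
Qed.

Lemma matching_total p : exists q, matching p q.
Proof.
have [i [x ->]] := chart_surj p; have [j dj ji] := matching_index i.
by have [s [_ ms _]] := matching_point dj ji; exists (chart j (s x)).
Qed.

Lemma matching_continuous (f : realization P -> realization Q) :
  (forall p, matching p (f p)) -> continuous f.
Proof.
move=> mf; apply: realization_continuous => i.
have [j dj ji] := matching_index i; have [s [_ ms sc]] := matching_point dj ji.
have -> : f \o chart i = chart j \o s.
  by apply/funext => x; exact: matching_functional (mf _) (ms x).
by move=> x; apply: continuous_comp; [exact: sc|exact: chart_continuous].
Qed.

Lemma matching_affine (f : realization P -> realization Q) :
  (forall p, matching p (f p)) -> affine_on_faces f.
Proof.
move=> mf i S S0; have [j dj ji] := matching_index i.
have [s [sc ms _]] := matching_point dj ji.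
have vi := pr_vcol prP (i := i); have vj := pr_vcol prQ (i := j).
have fs x : f (chart i x) = chart j (s x) by exact: matching_functional (mf _) (ms x).
pose T := [set l | vcol j l \in vcol i @: S]%SET.
have vT : vcol j @: T = vcol i @: S.
  apply/finset.setP => c; apply/imsetP/idP => [[l + ->]|cS]; first by rewrite inE.
  have : c \in vcol j @: [set: 'I_(sdim j).+1]%SET by rewrite imset_vcol_full.
  by move=> /imsetP[l _ cl]; exists l => //; rewrite inE -cl.
exists j, T; split.
  apply/seteqP; split=> [_ [_ [x xS <-] <-]|_ [y yT <-]].
    exists (s x); last exact/esym.
    by apply/(face_color_coord vj); rewrite vT sc; apply/(face_color_coord vi).
  have yS : support (color_coord j y) \subset vcol i @: S.
    by rewrite -vT; apply/(face_color_coord vj).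
  have [x xy] := color_coord_onto vi (color_coord_simplex y)
    (fintype.subset_trans yS (imsetS _ (finset.subsetT S))).
  exists (chart i x); first by exists x => //; apply/(face_color_coord vi); rewrite xy.
  by rewrite fs; congr chart; apply: (color_coord_inj vj); rewrite sc.
move=> x x' z y y' w t _ _ _; rewrite !fs.
have inj := presentation_chart_inj prQ (i := j).
move=> /inj <- /inj <- /inj <- /(color_coord_conv_iff vi) zxx.
by apply/(color_coord_conv_iff vj) => c; rewrite !sc.
Qed.

End OneWay.

Lemma matching_sym P Q g (rP : sidx P -> chamber) (rQ : sidx Q -> chamber) p q :
  @matching P Q g rP rQ p q -> @matching Q P g rQ rP q p.
Proof.
by move=> [i [j [x [y [-> -> xy ij]]]]]; exists j, i, y, x; split=> //; rewrite -xy; exact: conn_sym.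
Qed.

Lemma presentation_isomorphic P Q U g rP rQ :
  @presentation R n U a b g P rP -> @presentation R n U a b g Q rQ -> (1 <= n)%N -> isomorphic P Q.
Proof.
move=> prP prQ n_gt0.
have [f mf] := choice (matching_total prP prQ).
have [f' mf'] := choice (matching_total prQ prP).
have fchart i j x y : f (chart i x) = chart j y ->
    color_coord i x = color_coord j y /\ conn g (support (color_coord i x)) (rP i) (rQ j).
  by move=> fE; apply/(matching_chart prP prQ); rewrite -fE.
(* A point whose support contains all colors lies in only one chamber, since no gallery can leave
   it. *)
have full (i : sidx P) (j : sidx Q) : sdim i = n -> sdim j = n ->
    f @` simplex_image i = simplex_image j -> rP i = rQ j.
  move=> di dj fij.
  have vi := pr_vcol prP (i := i).
  have [z zS] := color_support_point vi di (finsetT_neq0 n).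
  have : (f @` simplex_image i) (f (chart i z)) by exists (chart i z) => //; exists z.
  rewrite fij => -[y _ /esym/fchart[_]]; rewrite zS.
  exact: conn_full.
exists f; split.
- split; first exact: matching_continuous prP prQ f mf.
  exists f'; split; last exact: matching_continuous prQ prP f' mf'.
  + move=> p; apply: (matching_functional prQ prP (mf' _)); exact/matching_sym.
  + move=> p; apply: (matching_functional prP prQ (mf _)); exact/matching_sym.
- exact: matching_affine prP prQ f mf.
- move=> i j di dj fij; have rij := full i j di dj fij.
  rewrite (pr_plus prP)// (pr_plus prQ)// rij; split=> // s.
    by rewrite (pr_plab prP) (pr_plab prQ) di dj rij.
  by rewrite (pr_mlab prP) (pr_mlab prQ) di dj rij.
- move=> i j k l fkl; have vi := pr_vcol prP (i := i); have vj := pr_vcol prQ (i := j).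
  have : (f @` face_image i [set k]) (f (chart i (vertex k))).
    exists (chart i (vertex k)) => //; exists (vertex k) => //.
    by apply/faceE; rewrite support_barycenter.
  rewrite fkl => -[y yl /esym/fchart[xy _]].
  have: vcol i k \in support (color_coord i (vertex k)).
    by rewrite in_support color_coord_vcol// coord_vertex eqxx oner_neq0.
  rewrite xy; move: yl => /(face_color_coord vj)/fintype.subsetP h /h.
  by rewrite imset_set1 inE => /eqP.
- move=> i j S T cS cT fST; have vi := pr_vcol prP (i := i); have vj := pr_vcol prQ (i := j).
  have [S0|S0] := eqVneq S finset.set0.
    by rewrite S0 cards0 in cS; rewrite -cS in n_gt0.
  have : (f @` face_image i S) (f (chart i (barycenter S0))).
    exists (chart i (barycenter S0)) => //; exists (barycenter S0) => //.
    by apply/faceE; rewrite support_barycenter.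
  rewrite fST => -[y yT /esym/fchart[xy _]].
  have ST : vcol i @: S = vcol j @: T.
    apply/eqP; rewrite eqEcard !card_imset// cS cT leqnn andbT.
    move: yT => /(face_color_coord vj); rewrite -xy support_color_coord//.
    by rewrite support_barycenter.
  (* Either face color is the one color missing among the vertices of the face. *)
  have cvS : #|vcol i @: S| = n by rewrite card_imset.
  apply: (missing_color cvS); first exact: pr_fcol prP _ _ cS.
  by rewrite ST; exact: pr_fcol prQ _ _ cT.
Qed.

End Comparison.

(** * Affine maps between simplices *)

Section AffineMaps.
Context {R : realType}.

Lemma face_sub d (S T : {set 'I_d.+1}) : S \subset T -> face S `<=` (face T : set (simplex R d)).
Proof. by move=> ST x /faceE xS; apply/faceE; exact: fintype.subset_trans ST. Qed.

Lemma face_vertex d (S : {set 'I_d.+1}) k : face S (vertex k : simplex R d) <-> k \in S.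
Proof. by rewrite faceE support_barycenter finset.sub1set. Qed.

Lemma face_image_vertex (X : simplex_quotient R) (i : sidx X) k : face_image i [set k] = [set chart i (vertex k)].
Proof.
apply/seteqP; split=> [_ [x /faceE xk <-]|_ ->] /=; last by exists (vertex k) => //; apply/face_vertex; rewrite inE.
congr chart; apply: coord_eq1; rewrite -[RHS](sum_coord x) (bigD1 k)//= big1 ?addr0// => l lk.
apply/eqP; apply: contraTT xk => xl; apply/negP => /fintype.subsetP/(_ l).
by rewrite in_support xl inE (negbTE lk) => /(_ isT).
Qed.

(** Here [t] is the coordinate of [x] at [k], and [x'] is the projection of [x] from this vertex to
    the opposite face. *)
Lemma split_vertex d (x : simplex R d) k : k \in support (set_val x) -> x <> vertex k ->
  exists (t : {i01 R}) (x' : simplex R d),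
    [/\ 0 < t%:num, t%:num < 1, set_val x = point_conv t (vertex k) x' &
        support (set_val x') \subset support (set_val x) :\ k].
Proof.
rewrite in_support => xk0 xk.
have t0 : 0 < coord x k by rewrite lt0r xk0 coord_ge0.
have t1 : coord x k < 1.
  by rewrite lt_neqAle coord_le1 andbT; apply: contra_notN xk => /eqP/coord_eq1.
have Hx' : simplex R d (\row_l (if l == k then 0 else coord x l / (1 - coord x k))).
  split=> [l|].
    by rewrite mxE; case: ifP => // _; rewrite divr_ge0 ?coord_ge0// subr_ge0 ltW.
  under eq_bigr do rewrite mxE.
  rewrite (bigD1 k)//= eqxx add0r.
  under eq_bigr => l /negbTE -> do [].
  rewrite -mulr_suml; have := sum_coord x; rewrite (bigD1 k)//= => /esym/eqP.
  by rewrite addrC -subr_eq => /eqP <-; rewrite divff// subr_eq0 gt_eqF.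
exists (Itv01 (ltW t0) (ltW t1)), (simplex_point Hx'); split=> //.
  apply/conv_coord => l; rewrite coord_vertex coord_simplex_point mxE/=.
  case: eqVneq => [->|_]; first by rewrite mulr1 mulr0 addr0.
  by rewrite mulr0 add0r mulrC divfK// subr_eq0 gt_eqF.
apply/fintype.subsetP => l; rewrite in_support mxE !inE.
case: (eqVneq l k) => [_|_]; first by rewrite eqxx.
by apply: contra_neq; rewrite /coord => ->; rewrite mul0r.
Qed.

(* An injective affine map sends a point in the interior of a segment to a
   point in the interior of a segment, hence no interior point to a vertex. *)
Lemma preimage_vertex d e (T : {set 'I_e.+1}) (h : simplex R e -> simplex R d -> Prop) k y :
  affine_on (face T) h -> (forall y, face T y -> exists x, h y x) ->
  (forall y y' x, h y x -> h y' x -> y = y') ->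
  face T y -> h y (vertex k) -> exists2 l, l \in T & y = vertex l.
Proof.
move=> ha ht hi yT hyk.
have /finset.set0Pn[l ly] := support_simplex_neq0 (simplex_val y).
have lT : l \in T by move: yT => /faceE/fintype.subsetP; exact.
exists l => //; apply: contrapT => yl.
have [t [y' [t0 t1 yE /fintype.subsetP y'S]]] := split_vertex ly yl.
have Tl : face T (vertex l : simplex R e).
  by apply/faceE; rewrite support_barycenter finset.sub1set.
have Ty' : face T y'.
  apply/faceE/fintype.subsetP => m /y'S; rewrite finset.in_setD => /andP[_].
  by move: m; apply/fintype.subsetP/faceE.
have [x hx] := ht _ Tl; have [x' hx'] := ht _ Ty'.
(* The coordinate [k] of the combination is 1, both terms are at most 1 and the weight of [x] is
   positive. So [x] is the vertex [k], and injectivity applies. *)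
have /conv_coord/(_ k) := ha _ _ _ _ _ _ _ Tl Ty' yT hx hx' hyk yE.
rewrite coord_vertex eqxx => kE.
have xk : coord x k = 1.
  have := coord_le1 x k; have := coord_le1 x' k => x'1 x1; apply/eqP.
  rewrite eq_le x1 leNgt; apply/negP => xk.
  have : t%:num * coord x k < t%:num by rewrite gtr_pMr.
  have : (1 - t%:num) * coord x' k <= 1 - t%:num by rewrite ger_pMr// subr_gt0.
  by move: kE => /= kE; lra.
by apply: yl; apply: hi hyk _; rewrite -(coord_eq1 xk).
Qed.

(** Induction on the number of vertices of the face carrying [x]: one vertex is split off, and both
    [h] and color coordinates respect the resulting convex combination. *)
Lemma affine_color n (X Y : colored R n) (i : sidx X) (j : sidx Y) S
    (h : simplex R (sdim i) -> simplex R (sdim j) -> Prop) :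
  affine_on (face S) h -> (forall x, face S x -> exists y, h x y) ->
  (forall k y, k \in S -> h (vertex k) y -> color_coord j y = color_coord i (vertex k)) ->
  forall x y, face S x -> h x y -> color_coord i x = color_coord j y.
Proof.
move=> ha ht hv x; have [m] := ubnP #|support (set_val x)|.
elim: m x => // m IH x xm y Sx hxy.
have /finset.set0Pn[k kx] := support_simplex_neq0 (simplex_val x).
have kS : k \in S by move: Sx => /faceE/fintype.subsetP; exact.
have [xk|xk] := pselect (x = vertex k).
  by rewrite xk; apply/esym/hv => //; rewrite -xk.
have [t [x' [t0 t1 xE x'S]]] := split_vertex kx xk.
have Sk : face S (vertex k : simplex R (sdim i)).
  by apply/faceE; rewrite support_barycenter finset.sub1set.
have Sx' : face S x'.
  apply/faceE/(fintype.subset_trans x'S)/(fintype.subset_trans (finset.subD1set _ _)).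
  exact/faceE.
have [y1 hy1] := ht _ Sk; have [y2 hy2] := ht _ Sx'.
have yE := ha _ _ _ _ _ _ _ Sk Sx' Sx hy1 hy2 hxy xE.
apply/rowP => c; rewrite (color_coord_conv _ xE) (color_coord_conv _ yE).
rewrite (hv _ _ kS hy1) (IH x' _ y2)//.
apply: leq_ltn_trans (subset_leq_card x'S) _.
by move: xm; rewrite (cardsD1 k) kx.
Qed.

End AffineMaps.

(** The numbers below [N] are listed twice, once starting with the elements of [A] and once starting
    with their images in the same order; the permutation sends each entry of the first list to the
    entry of the second at the same position. *)
Lemma extend_permutation N (A : pred nat) (f : nat -> nat) :
  (forall p, A p -> p < N)%N -> (forall p, A p -> f p < N)%N -> {in A &, injective f} ->
  exists2 s, Sinf s & forall p, A p -> s p = f p.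
Proof.
move=> AN fN fi.
pose s1 := seq.filter A (iota 0 N) ++ seq.filter (predC A) (iota 0 N).
pose B := map f (seq.filter A (iota 0 N)).
pose s2 := B ++ seq.filter [predC B] (iota 0 N).
have mA p : (p \in seq.filter A (iota 0 N)) = A p.
  by rewrite mem_filter mem_iota /= add0n; case Ap : (A p) => //=; exact: AN.
have uB : uniq B.
  by rewrite map_inj_in_uniq ?filter_uniq ?iota_uniq// => p q; rewrite !mA; exact: fi.
have s1P : perm_eq s1 (iota 0 N) by rewrite perm_filterC.
have u2 : uniq s2.
  rewrite cat_uniq uB filter_uniq ?iota_uniq// andbT -all_predC.
  by apply/allP => p; rewrite mem_filter /= => /andP[].
have s2P : perm_eq s2 (iota 0 N).
  apply: uniq_perm => //; first exact: iota_uniq.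
  move=> p; rewrite mem_cat mem_filter /=; case pB : (p \in B) => //=.
  move/mapP: pB => [q + ->]; rewrite mA => Aq.
  by rewrite mem_iota /= add0n fN.
have sz1 : size s1 = N by rewrite (perm_size s1P) size_iota.
have sz2 : size s2 = N by rewrite (perm_size s2P) size_iota.
have u1 : uniq s1 by rewrite (perm_uniq s1P) iota_uniq.
have m1 p : (p \in s1) = (p < N)%N by rewrite (perm_mem s1P) mem_iota add0n.
have m2 p : (p \in s2) = (p < N)%N by rewrite (perm_mem s2P) mem_iota add0n.
pose tr (t1 t2 : seq nat) p := if (p < N)%N then nth 0%N t2 (index p t1) else p.
have trK t1 t2 : uniq t1 -> uniq t2 -> size t1 = N -> size t2 = N ->
    t1 =i iota 0 N -> t2 =i iota 0 N -> cancel (tr t1 t2) (tr t2 t1).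
  move=> v1 v2 z1 z2 e1 e2 p; rewrite /tr; case: (ltnP p N) => pN; last by rewrite ltnNge pN.
  have pt : p \in t1 by rewrite e1 mem_iota.
  have it : (index p t1 < N)%N by rewrite -z1 index_mem.
  have -> : (nth 0 t2 (index p t1) < N)%N.
    by have := mem_nth 0%N (s := t2) (n := index p t1); rewrite z2 e2 mem_iota add0n; exact.
  by rewrite index_uniq ?z2// nth_index.
exists (tr s1 s2).
  split; last by exists N => m Nm; rewrite /tr ltnNge Nm.
  exists (tr s2 s1); apply: trK => // p; first exact: perm_mem.
  - exact: perm_mem.
  - exact: perm_mem.
  - exact: perm_mem.
move=> p Ap; rewrite /tr AN//; have pA : p \in seq.filter A (iota 0 N) by rewrite mA.
rewrite index_cat pA nth_cat size_map index_mem pA.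
by rewrite (nth_map 0%N) ?index_mem// nth_index.
Qed.

(** * Representatives and double cosets *)

Section DoubleCosetAlgebra.
Context {n : nat}.
Implicit Types g h : tuple_perm n.

Lemma Sinf_id : Sinf id.
Proof. by split; [exists id|exists 0%N]. Qed.

Lemma Sinf_comp f f' : Sinf f -> Sinf f' -> Sinf (f \o f').
Proof.
move=> [fb [N fN]] [fb' [N' fN']]; split; first exact: bij_comp.
by exists (maxn N N') => m; rewrite geq_max => /andP[? ?] /=; rewrite fN' ?fN.
Qed.

Lemma Sinf_inv f : Sinf f -> exists2 f', Sinf f' & cancel f f' /\ cancel f' f.
Proof.
move=> [[f' ff' f'f] [N fN]]; exists f' => //; split; first by exists f.
by exists N => m Nm; rewrite -[in LHS](fN m).
Qed.

Lemma Ginf_bij g : Ginf g -> forall c, bijective (g c).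
Proof. by move=> gG c; have [] := gG c. Qed.

Lemma Ginf_bound g : Ginf g -> exists N, forall c m, (N <= m)%N -> g c m = m.
Proof.
move=> gG; have /choice[N gN] c : exists N, forall m, (N <= m)%N -> g c m = m.
  by have [] := gG c.
by exists (\max_c N c) => c m cm; apply: gN; exact: leq_trans (leq_bigmax c) cm.
Qed.

Lemma Ginf_Gmul g h : Ginf g -> Ginf h -> Ginf (Gmul g h).
Proof. by move=> gG hG c; exact: Sinf_comp. Qed.

Definition fixes_below (a : nat) (f : nat -> nat) : Prop :=
  Sinf f /\ forall m, (m < a)%N -> f m = m.

Lemma dcosetP a b g h : dcoset a b g h <-> exists f f',
  [/\ fixes_below a f, fixes_below b f' & forall c p, h c p = f' (g c (f p))].
Proof.
split=> [[_ [_ [[f [Sf fa ->]] [f' [Sf' fb ->]] ->]]]|].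
  by exists f, f'; split=> //; split.
move=> [f [f' [[Sf fa] [Sf' fb] hE]]]; exists (fun=> f), (fun=> f'); split.
- by exists f.
- by exists f'.
- by apply/funext => c; apply/funext => p; rewrite hE.
Qed.

Lemma fixes_below_id a : fixes_below a id.
Proof. by split; [exact: Sinf_id|]. Qed.

Lemma fixes_below_comp a f f' : fixes_below a f -> fixes_below a f' -> fixes_below a (f \o f').
Proof.
by move=> [Sf fa] [Sf' fa']; split=> [|m ma]; [exact: Sinf_comp|rewrite /= fa' ?fa].
Qed.

Lemma fixes_below_inv a f : fixes_below a f ->
  exists f', [/\ fixes_below a f', cancel f f' & cancel f' f].
Proof.
move=> [/Sinf_inv[f' Sf' [ff' f'f]] fa]; exists f'; split=> //; split=> // m ma.
by rewrite -[in LHS](fa m).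
Qed.

Lemma fixes_below_geq a f m : fixes_below a f -> (a <= f m)%N = (a <= m)%N.
Proof.
move=> /[dup] -[_ fa] /fixes_below_inv[f' [[_ fa'] ff' f'f]].
apply/idP/idP; apply: contraTT; rewrite -!ltnNge => h; first by rewrite fa.
by rewrite -(ff' m) fa'.
Qed.

Lemma dcoset_refl a b g : dcoset a b g g.
Proof. by apply/dcosetP; exists id, id; split=> //; exact: fixes_below_id. Qed.

Lemma dcoset_sym a b g h : dcoset a b g h -> dcoset a b h g.
Proof.
move=> /dcosetP[f [f' [/fixes_below_inv[k [ka fk kf]] /fixes_below_inv[k' [kb fk' kf']] hE]]].
by apply/dcosetP; exists k, k'; split=> // c p; rewrite hE kf fk'.
Qed.

Lemma dcoset_trans a b g h k : dcoset a b g h -> dcoset a b h k -> dcoset a b g k.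
Proof.
move=> /dcosetP[f [f' [fa fb hE]]] /dcosetP[l [l' [la lb kE]]].
apply/dcosetP; exists (f \o l), (l' \o f'); split; try exact: fixes_below_comp.
by move=> c p; rewrite kE hE.
Qed.

Lemma dcoset_eq a b g h : dcoset a b g h -> dcoset a b g = dcoset a b h.
Proof.
move=> gh; apply/seteqP; split=> k; apply: dcoset_trans => //.
exact: dcoset_sym.
Qed.

Lemma dcoset_Ginf a b g h : Ginf g -> dcoset a b g h -> Ginf h.
Proof.
move=> gG /dcosetP[f [f' [[Sf _] [Sf' _] hE]]] c.
have -> : h c = f' \o (g c \o f) by apply/funext => p; rewrite hE.
by apply: Sinf_comp => //; exact: Sinf_comp.
Qed.

Lemma conn_map g h S (psi : chamber -> chamber) u v :
  (forall x y, adjacent g S x y -> adjacent h S (psi x) (psi y)) ->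
  conn g S u v -> conn h S (psi u) (psi v).
Proof.
move=> hpsi; elim=> {u v} [u v uv|u|u v _|u v w _ + _].
- exact/rst_step/hpsi.
- exact: conn_refl.
- exact: conn_sym.
- exact: conn_trans.
Qed.

End DoubleCosetAlgebra.

Section Representatives.
Context {R : realType} {n : nat} {a b : nat}.

(** If [h = f' g f], renumbering plus-chambers by the inverse of [f] and minus-chambers by [f']
    turns the edges of [g] into those of [h]. The labels stay in place because [f] and [f'] fix
    them. *)
Lemma presentation_dcoset (P : labeled R n 'I_a 'I_b) (g h : tuple_perm n) (r : sidx P -> chamber) :
  presentation (nontrivial a b g) g r -> dcoset a b g h ->
  exists r' : sidx P -> chamber, presentation (nontrivial a b h) h r'.
Proof.
move=> pr /dcosetP[f [f' [fa fb hE]]].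
have [k [ka fk kf]] := fixes_below_inv fa; have [k' [kb fk' kf']] := fixes_below_inv fb.
pose psi (u : chamber) : chamber := if u.1 then (true, k u.2) else (false, f' u.2).
pose phi (u : chamber) : chamber := if u.1 then (true, f u.2) else (false, k' u.2).
have psiK : cancel psi phi by case=> -[] p; rewrite /phi /psi /= ?kf ?fk'.
have phiK : cancel phi psi by case=> -[] p; rewrite /phi /psi /= ?fk ?kf'.
have psi_adj S u v : adjacent g S u v -> adjacent h S (psi u) (psi v).
  by move=> [c [p [cS -> ->]]]; exists c, (k p); split=> //; rewrite /psi /= hE kf.
have phi_adj S u v : adjacent h S u v -> adjacent g S (phi u) (phi v).
  by move=> [c [p [cS -> ->]]]; exists c, (f p); split=> //; rewrite /phi /= hE fk'.
have psi_triv u : trivial_chamber a b h (psi u) <-> trivial_chamber a b g u.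
  split=> -[p [q [[ap bq gpq] pqu]]].
    exists (f p), (k' q); split; first split.
    - by rewrite fixes_below_geq.
    - by rewrite fixes_below_geq.
    - by move=> c; rewrite -(gpq c) hE fk'.
    - by case: pqu => /(congr1 phi); rewrite psiK => ->; [left|right].
  exists (k p), (f' q); split; first split.
  - by rewrite fixes_below_geq.
  - by rewrite fixes_below_geq.
  - by move=> c; rewrite hE kf gpq.
  - by case: pqu => ->; [left|right].
exists (psi \o r); split.
- exact: pr_vcol pr.
- exact: pr_fcol pr.
- move=> i j x y; rewrite (pr_chart pr); split=> -[xy ij]; split=> //=.
    by apply: conn_map ij; exact: psi_adj.
  rewrite -[r i]psiK -[r j]psiK; apply: conn_map ij; exact: phi_adj.
- by move=> i di; rewrite (pr_plus pr)// /psi /=; case: (r i).1.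
- move=> i s; rewrite (pr_plab pr); split=> -[di ri]; split=> //=.
    by rewrite ri /psi /= (proj2 ka).
  by rewrite -[r i]psiK [psi _]ri /phi /= (proj2 fa).
- move=> i s; rewrite (pr_mlab pr); split=> -[di ri]; split=> //=.
    by rewrite ri /psi /= (proj2 fb).
  by rewrite -[r i]psiK [psi _]ri /phi /= (proj2 kb).
- by move=> i; have := pr_in pr i; apply: contra_not => /psi_triv.
- move=> u nu; have [|i di ri] := pr_onto pr (u := phi u).
    by apply: contra_not nu => /psi_triv; rewrite phiK.
  by exists i => //=; rewrite ri phiK.
Qed.

Lemma labeled_nontrivial (g : tuple_perm n) e p :
  (p < if e then a else b)%N -> nontrivial a b g (e, p).
Proof.
move=> pe [p' [q' [[ap bq _] []]]] [ee pp]; subst e p; move: pe => /=.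
  by rewrite ltnNge ap.
by rewrite ltnNge bq.
Qed.

(* The permutation matching plus-chambers extends to all of N, and determines
   the one of minus-chambers through the edges of color 0. *)
Lemma dcoset_of_matching (g h : tuple_perm n) (phi : chamber -> chamber) :
  Ginf g -> Ginf h ->
  (forall u, nontrivial a b g u -> nontrivial a b h (phi u)) ->
  {in nontrivial a b g &, injective phi} ->
  (forall v, nontrivial a b h v -> exists2 u, nontrivial a b g u & phi u = v) ->
  (forall u, nontrivial a b g u -> (phi u).1 = u.1) ->
  (forall p, (p < a)%N -> phi (true, p) = (true, p)) ->
  (forall p, (p < b)%N -> phi (false, p) = (false, p)) ->
  (forall c p, nontrivial a b g (true, p) ->
     phi (false, g c p) = (false, h c (phi (true, p)).2)) ->
  dcoset a b g h.
Proof.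
move=> gG hG phi_in phi_inj phi_onto phi_sign phi_a phi_b phi_adj.
have [Ng gN] := Ginf_bound gG; have [Nh hN] := Ginf_bound hG.
(* From [N] on, both tuples are the identity and there are no labels, so all chambers are trivial
   and the matching concerns only numbers below [N]. *)
pose N := maxn (maxn Ng Nh) (maxn a b).
have triv_big (k : tuple_perm n) M p : (forall c m, (M <= m)%N -> k c m = m) ->
    (maxn M (maxn a b) <= p)%N -> trivial_chamber a b k (true, p).
  move=> kM; rewrite !geq_max => /and3P[Mp ap bp]; exists p, p; split; last by left.
  by split=> // c; rewrite kM.
have gi c := bij_inj (Ginf_bij gG c).
have hi c := bij_inj (Ginf_bij hG c).
have phi_true p : nontrivial a b g (true, p) -> phi (true, p) = (true, (phi (true, p)).2).
  by move=> /phi_sign; case: (phi _) => /= ? ? ->.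
have [s [sb sN] sE] : exists2 s, Sinf s &
    forall p, `[< nontrivial a b g (true, p) >] -> s p = (phi (true, p)).2.
  apply: (@extend_permutation N (fun p => `[< nontrivial a b g (true, p) >]) (fun p => (phi (true, p)).2)).
  - move=> p /asboolP np; rewrite ltnNge; apply/negP => pN; apply: np.
    apply: (triv_big _ Ng) => //; apply: leq_trans pN.
    by rewrite /N !geq_max !leq_max !leqnn !orbT.
  - move=> p /asboolP np; rewrite ltnNge; apply/negP => pN.
    apply: (phi_in _ np); rewrite (phi_true _ np).
    apply: (triv_big _ Nh) => //; apply: leq_trans pN.
    by rewrite /N !geq_max !leq_max !leqnn !orbT.
  - move=> p q; rewrite !unfold_in => /asboolP np /asboolP nq pq.
    suff : (true, p) = (true, q) by case.
    by apply: phi_inj; rewrite ?inE//; rewrite phi_true// (phi_true q)// pq.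
have s_nontriv p : nontrivial a b h (true, s p) -> nontrivial a b g (true, p).
  move=> /phi_onto[[e q] nq pq].
  have e1 : e = true by rewrite -[e]/((e, q).1) -(phi_sign _ nq) pq.
  rewrite e1 in nq pq; have : s q = s p.
    by rewrite sE ?pq//; exact/asboolP.
  by move/(bij_inj sb) => <-.
have [g0' g0K g0'K] := Ginf_bij gG ord0.
(* The permutation [h ord0 \o s \o g0'] of minus-chambers is defined through color 0; this equation
   says that it serves all colors. At a trivial chamber the values of [g] and [h] do not depend on
   the color. *)
have l_adj c p : h c (s p) = h ord0 (s (g0' (g c p))).
  have [np|tp] := pselect (nontrivial a b g (true, p)).
    have nq : nontrivial a b g (false, g c p) by exact/(nontrivial_closed _ _ gi).
    have np' : nontrivial a b g (true, g0' (g c p)).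
      by apply/(nontrivial_closed _ _ gi ord0); rewrite g0'K.
    have := phi_adj c _ np; have := phi_adj ord0 _ np'; rewrite g0'K => -> [].
    by rewrite !sE //; exact/asboolP.
  have /contrapT[p' [q' [[ap bq gpq] pp]]] := tp.
  have pE : p = p' by case: pp => -[].
  rewrite -{}pE {pp} in ap gpq.
  rewrite gpq -(gpq ord0) g0K.
  have /contrapT[p1 [q1 [[_ _ hpq] pp]]] : ~ nontrivial a b h (true, s p).
    by move=> /s_nontriv.
  have -> : s p = p1 by case: pp => -[].
  by rewrite !hpq.
have [s' [Ss' s'N] [sK s'K]] := Sinf_inv (conj sb sN).
apply/dcosetP; exists s', (h ord0 \o s \o g0'); split.
- split; first by split.
  move=> m ma; rewrite -[in LHS](_ : s m = m) ?sK//.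
  by rewrite sE ?phi_a//; apply/asboolP; exact: labeled_nontrivial.
- split.
    apply: Sinf_comp; first by apply: Sinf_comp; [exact: hG|split].
    split; first by exists (g ord0).
    by exists Ng => m Nm; rewrite -[in LHS](gN ord0 m Nm) g0K.
  move=> m mb /=; have nm : nontrivial a b g (false, m) by exact: labeled_nontrivial.
  have np : nontrivial a b g (true, g0' m).
    by apply/(nontrivial_closed _ _ gi ord0); rewrite g0'K.
  have := phi_adj ord0 _ np; rewrite g0'K phi_b// => -[].
  by rewrite sE //; exact/asboolP.
- by move=> c p /=; rewrite -l_adj s'K.
Qed.


(** An isomorphism is only known to send the simplex to some face [T] of some simplex [j]. It is
    affine in both directions, so vertices go to vertices, of the same color; counting them shows
    that [j] is a chamber, and affinity then preserves all color coordinates. *)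
Lemma isomorphism_chamber (P Q : labeled R n 'I_a 'I_b) (U V : set chamber)
    (g h : tuple_perm n) (rP : sidx P -> chamber) (rQ : sidx Q -> chamber)
    (f : realization P -> realization Q) (i : sidx P) :
  presentation U g rP -> presentation V h rQ -> injective f -> affine_on_faces f ->
  (forall (i : sidx P) (j : sidx Q) k l,
        f @` face_image i [set k] = face_image j [set l] ->
        vcol i k = vcol j l) ->
  sdim i = n -> exists2 j : sidx Q, sdim j = n &
    forall x y, f (chart i x) = chart j y <-> color_coord i x = color_coord j y.
Proof.
move=> prP prQ fi fa fv di.
have vi := pr_vcol prP (i := i); have ci := presentation_chart_inj prP (i := i).
have [j [T [fiT fA]]] := fa i [set: 'I_(sdim i).+1]%SET (finsetT_neq0 _).
have vj := pr_vcol prQ (i := j); have cj := presentation_chart_inj prQ (i := j).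
have Fi (x : simplex R (sdim i)) : face [set: 'I_(sdim i).+1]%SET x.
  by apply/faceE; exact: finset.subsetT.
have fT x : exists2 y, face T y & f (chart i x) = chart j y.
  have : (f @` face_image i [set: 'I_(sdim i).+1]%SET) (f (chart i x)).
    by exists (chart i x) => //; exists x.
  by rewrite fiT => -[y Ty yE]; exists y.
have fT' y : face T y -> exists x, f (chart i x) = chart j y.
  move=> Ty; have : face_image j T (chart j y) by exists y.
  by rewrite -fiT => -[_ [x _ <-] <-]; exists x.
(* The inverse is affine: the combination [z'] of the preimages is sent to [w] by [fA], hence equals
   [z] by injectivity. *)
have fA' : affine_on (face T) (fun y x => f (chart i x) = chart j y).
  move=> y y' w x x' z t Ty Ty' Tw xy xy' zw wE.
  have [z' z'E] : exists z' : simplex R (sdim i), set_val z' = point_conv t x x'.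
    have t0 : 0 <= t%:num by []; have t1 : t%:num <= 1 by [].
    have Hz : simplex R (sdim i) (point_conv t x x').
      split=> [k|]; first by rewrite !mxE addr_ge0// mulr_ge0// ?coord_ge0// subr_ge0.
      under eq_bigr do rewrite !mxE.
      rewrite big_split/= -!mulr_sumr.
      by have := sum_coord x; have := sum_coord x'; rewrite /coord => -> ->; rewrite !mulr1 subrKC.
    by exists (simplex_point Hz).
  have [w' Tw' z'w'] := fT z'.
  have w'E := fA _ _ _ _ _ _ _ (Fi x) (Fi x') (Fi z') xy xy' z'w' z'E.
  have -> : z = z' by apply/ci/fi; rewrite zw z'w'; congr chart; apply: val_inj; exact: etrans wE (esym w'E).
  exact: z'E.
have vertices k : exists2 l, l \in T & f (chart i (vertex k)) = chart j (vertex l).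
  have [y Ty yE] := fT (vertex k).
  have [|l lT yl] := preimage_vertex (h := fun y x => f (chart i x) = chart j y) fA' fT' _ Ty yE.
    by move=> y1 y2 x -> /cj.
  by exists l => //; rewrite -yl.
have [s sP] : exists s : 'I_(sdim i).+1 -> 'I_(sdim j).+1, forall k, s k \in T /\
    f (chart i (vertex k)) = chart j (vertex (s k)).
  by have /choice[s sP] k : exists l, l \in T /\ f (chart i (vertex k)) = chart j (vertex l);
    [have [l] := vertices k; exists l|exists s].
have sv k : vcol j (s k) = vcol i k.
  by apply/esym/fv; rewrite !face_image_vertex image_set1 (sP k).2.
have si : injective s by move=> k l kl; apply: vi; rewrite -!sv kl.
(* At most n since its vertices have distinct colors, at least n since it receives n+1 distinct
   vertices. *)
have dj : sdim j = n.
  apply/eqP; rewrite eqn_leq; apply/andP; split.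
    by have := leq_card _ vj; rewrite !card_ord.
  by have := leq_card _ si; rewrite !card_ord di.
exists j => //.
have color x y : f (chart i x) = chart j y -> color_coord i x = color_coord j y.
  move=> xy; apply: (affine_color fA) (Fi x) xy => [z _|k y' _].
    by have [z' _ ?] := fT z; exists z'.
  rewrite (sP k).2 => /cj <-; apply/rowP => c.
  have : c \in vcol i @: [set: 'I_(sdim i).+1]%SET by rewrite (imset_vcol_full vi di) finset.in_setT.
  move=> /imsetP[k' _ ->]; rewrite [RHS]color_coord_vcol// -sv color_coord_vcol//.
  by rewrite !coord_vertex inj_eq.
move=> x y; split=> [/color//|xy].
have [y' _ xy'] := fT x; rewrite xy'; congr chart.
by apply: (color_coord_inj vj); rewrite -(color _ _ xy').
Qed.

Lemma isomorphic_dcoset (P Q : labeled R n 'I_a 'I_b) (g h : tuple_perm n)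
    (rP : sidx P -> chamber) (rQ : sidx Q -> chamber) :
  (1 <= n)%N -> Ginf g -> Ginf h ->
  presentation (nontrivial a b g) g rP -> presentation (nontrivial a b h) h rQ ->
  isomorphic P Q -> dcoset a b g h.
Proof.
move=> n_gt0 gG hG prP prQ [f [[fc [f' [ff' f'f f'c]]] fa fl fv _]].
have fi := can_inj ff'.
have gb := Ginf_bij gG; have hb := Ginf_bij hG.
have link (u : chamber) : nontrivial a b g u -> exists v i j,
    [/\ sdim i = n, sdim j = n, rP i = u, rQ j = v &
        forall x y, f (chart i x) = chart j y <-> color_coord i x = color_coord j y].
  move=> nu; have [i di iu] := pr_onto prP nu.
  have [j dj ij] := isomorphism_chamber prP prQ fi fa fv di.
  by exists (rQ j), i, j.
have {link} /choice[phi phiP] u : exists v, nontrivial a b g u -> exists i j,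
    [/\ sdim i = n, sdim j = n, rP i = u, rQ j = v &
        forall x y, f (chart i x) = chart j y <-> color_coord i x = color_coord j y].
  by have [/link[v ?]|nu] := pselect (nontrivial a b g u); [exists v|exists u].
(* A point of support [S] tests whether two chambers have the face of colors [S] in common, and [f]
   carries this test to [Q]. *)
have share u v S : S != finset.set0 -> nontrivial a b g u -> nontrivial a b g v ->
    conn g S u v <-> conn h S (phi u) (phi v).
  move=> S0 nu nv; have [i [j [di dj iu ju ij]]] := phiP u nu.
  have [k [l [dk dl kv lv kl]]] := phiP v nv.
  have [x xS] := color_support_point (pr_vcol prP (i := i)) di S0.
  have [z zx] := color_point (pr_vcol prP (i := k)) dk (color_coord_simplex x).
  have [y yx] := color_point (pr_vcol prQ (i := j)) dj (color_coord_simplex x).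
  have [w wx] := color_point (pr_vcol prQ (i := l)) dl (color_coord_simplex x).
  have -> : conn g S u v <-> chart i x = chart k z.
    by rewrite (pr_chart prP) zx xS iu kv; split=> [?|[]].
  have -> : conn h S (phi u) (phi v) <-> chart j y = chart l w.
    by rewrite (pr_chart prQ) yx wx xS ju lv; split=> [?|[]].
  rewrite -((ij x y).2 (esym yx)) -((kl z w).2 (etrans zx (esym wx))).
  by split=> [->|/fi].
have image_eq i j : sdim i = n -> sdim j = n ->
    (forall x y, f (chart i x) = chart j y <-> color_coord i x = color_coord j y) ->
    f @` simplex_image i = simplex_image j.
  move=> di dj ij; apply/seteqP; split=> [_ [_ [x _ <-] <-]|_ [y _ <-]].
    have [y yx] := color_point (pr_vcol prQ (i := j)) dj (color_coord_simplex x).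
    by exists y => //; apply/esym/ij; exact/esym.
  have [x xy] := color_point (pr_vcol prP (i := i)) di (color_coord_simplex y).
  by exists (chart i x); [exists x|apply/ij].
have phi_sign u : nontrivial a b g u -> (phi u).1 = u.1.
  move=> nu; have [i [j [di dj <- <- ij]]] := phiP u nu.
  have [e _ _] := fl i j di dj (image_eq i j di dj ij).
  by rewrite -(pr_plus prP)// e (pr_plus prQ).
refine (dcoset_of_matching (phi := phi) gG hG _ _ _ phi_sign _ _ _).
- move=> u nu; have [i [j [_ _ _ <- _]]] := phiP u nu; exact: pr_in prQ j.
- move=> u v; rewrite !inE => nu nv uv; apply: (@conn_full _ g).
  by apply/share => //; [exact: finsetT_neq0|rewrite uv; exact: conn_refl].
- move=> v nv; have [j dj jv] := pr_onto prQ nv.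
  have [y yT] := color_support_point (pr_vcol prQ (i := j)) dj (finsetT_neq0 n).
  have [m [z zE]] := chart_surj (f' (chart j y)).
  exists (rP m); first exact: pr_in prP m.
  have [i [j' [di dj' im j'm ij']]] := phiP _ (pr_in prP m).
  have [x _ xz] : simplex_image i (chart m z).
    by apply: (presentation_image_eq prP di (esym im)); exists z.
  have [y' _ y'x] : simplex_image j' (chart j y).
    have [y' y'x] := color_point (pr_vcol prQ (i := j')) dj' (color_coord_simplex x).
    exists y' => //; rewrite -(f'f (chart j y)) zE -xz; apply/esym/ij'; exact/esym.
  by move: y'x => /esym/(pr_chart prQ)[_]; rewrite yT => /conn_full; rewrite j'm jv => <-.
- move=> p pa; have nu : nontrivial a b g (true, p) by exact: labeled_nontrivial.
  have [i [j [di dj ri <- ij]]] := phiP _ nu.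
  have [_ lab _] := fl i j di dj (image_eq i j di dj ij).
  have : plab (Ordinal pa) i by apply/(pr_plab prP).
  by move=> /lab /(pr_plab prQ)[].
- move=> p pb; have nu : nontrivial a b g (false, p) by exact: labeled_nontrivial.
  have [i [j [di dj ri <- ij]]] := phiP _ nu.
  have [_ _ lab] := fl i j di dj (image_eq i j di dj ij).
  have : mlab (Ordinal pb) i by apply/(pr_mlab prP).
  by move=> /lab /(pr_mlab prQ)[].
- move=> c p np; have nq : nontrivial a b g (false, g c p).
    by apply/(nontrivial_closed _ _ (fun c => bij_inj (gb c))).
  (* Having the face of all colors but [c] in common means being on the same edge of color [c]. As
     signs are preserved, the images are the two ends of such an edge of [h]. *)
  have : conn g [set~ c]%SET (true, p) (false, g c p).
    by apply: rst_step; exists c, p; rewrite !inE eqxx.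
  move=> /(share _ _ _ (setC1_neq0 n_gt0 c) np nq)/(conn_plus_end (bij_inj (hb c)) (fintype.subxx _)).
  have := phi_sign _ np; have := phi_sign _ nq.
  case: (phi (true, p)) => -[]//= p' ; case: (phi (false, _)) => -[]//= q' _ _.
  by rewrite plus_end_plus => ->; rewrite plus_endK.
Qed.

End Representatives.

(** * Presented complexes are pseudobordisms *)

Lemma set_missing_color n (S : {set 'I_n.+1}) : #|S| = n -> exists c, S = [set~ c]%SET.
Proof.
move=> cS; have /cards1P[c cE] : #|~: S| == 1%N.
  by rewrite cardsCs finset.setCK cS card_ord subSn// subnn.
by exists c; rewrite -cE finset.setCK.
Qed.

Definition opposite {n} (g : tuple_perm n) c (u : chamber) : chamber :=
  if u.1 then (false, g c u.2) else (true, plus_end (g c) u).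

Lemma opposite_adjacent {n} (g : tuple_perm n) c u : bijective (g c) ->
  adjacent g [set~ c]%SET u (opposite g c u) \/ adjacent g [set~ c]%SET (opposite g c u) u.
Proof.
case: u => -[] p gb; [left|right]; first by exists c, p; rewrite !inE eqxx.
by exists c, (plus_end (g c) (false, p)); rewrite !inE eqxx plus_endK.
Qed.

Lemma conn_opposite {n} (g : tuple_perm n) c u : bijective (g c) ->
  conn g [set~ c]%SET u (opposite g c u).
Proof.
by move=> /opposite_adjacent -/(_ u)[?|?]; [exact: rst_step|exact/rst_sym/rst_step].
Qed.

Lemma opposite_sign {n} (g : tuple_perm n) c u : (opposite g c u).1 = ~~ u.1.
Proof. by case: u => -[]. Qed.

Lemma plus_end_inj (f : nat -> nat) u v : bijective f -> u.1 = v.1 ->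
  plus_end f u = plus_end f v -> u = v.
Proof.
case: u v => [[] p] [[] q] fb //= _; first by rewrite /plus_end/= => ->.
by move=> /(congr1 f); rewrite !plus_endK//= => ->.
Qed.

Lemma conn_edge {n} (g : tuple_perm n) c u v : bijective (g c) ->
  conn g [set~ c]%SET u v -> v = u \/ v = opposite g c u.
Proof.
move=> gb uv; have gi := bij_inj gb; have [e|e] := eqVneq v.1 u.1; [left|right].
  by apply/esym/(plus_end_inj gb (esym e)); apply: conn_plus_end uv.
apply: (plus_end_inj gb).
  by rewrite opposite_sign; move: e; case: v.1; case: u.1.
have := conn_plus_end gi (fintype.subxx _) uv.
by rewrite (conn_plus_end gi (fintype.subxx _) (conn_opposite u gb)).
Qed.

Lemma opposite_closed {n} (g : tuple_perm n) c (U : set chamber) u :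
  bijective (g c) -> adjacency_closed g U -> U u -> U (opposite g c u).
Proof.
by move=> gb Uc; have := conn_closed Uc (conn_opposite u gb) => -[].
Qed.

Section Faces.
Context {R : realType} {n : nat} {a b : nat} {U : set chamber} {g : tuple_perm n}
  {P : labeled R n 'I_a 'I_b} {r : sidx P -> chamber}.
Hypothesis pr : presentation U g r.

Lemma face_point (i : sidx P) (S : {set 'I_(sdim i).+1}) : S != finset.set0 ->
  exists2 x, face S x & support (color_coord i x) = vcol i @: S.
Proof.
move=> S0; exists (barycenter S0); first by apply/faceE; rewrite support_barycenter.
by rewrite support_color_coord ?support_barycenter//; exact: pr_vcol pr i.
Qed.

Lemma face_image_share (i j : sidx P) (S : {set 'I_(sdim i).+1}) : S != finset.set0 ->
  sdim j = n ->
  face_image i S `<=` simplex_image j <-> conn g (vcol i @: S) (r i) (r j).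
Proof.
move=> S0 dj; split=> [iSj|ij].
  have [x Sx <-] := face_point S0.
  by apply/(presentation_chart_share pr) => //; apply: iSj; exists x.
move=> _ [x Sx <-]; apply/(presentation_chart_share pr) => //.
by apply: conn_mono ij; apply/face_color_coord => //; exact: pr_vcol pr i.
Qed.

Lemma simplex_image_eq (i j : sidx P) : sdim i = n -> sdim j = n ->
  simplex_image i = simplex_image j <-> r i = r j.
Proof.
move=> di dj; split=> [ij|ij].
  have [x xT] := color_support_point (pr_vcol pr (i := i)) di (finsetT_neq0 n).
  have : simplex_image j (chart i x) by rewrite -ij; exists x.
  by move=> /(presentation_chart_share pr _ dj); rewrite xT => /conn_full.
apply/seteqP; split; first exact: (presentation_image_eq pr dj ij).
exact: (presentation_image_eq pr di (esym ij)).
Qed.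

Lemma face_image_full (i : sidx P) : face_image i [set: 'I_(sdim i).+1]%SET = simplex_image i.
Proof.
apply/seteqP; split=> [_ [x _ <-]|_ [x _ <-]]; exists x => //.
by apply/faceE; exact: finset.subsetT.
Qed.

Lemma card_full_face (i : sidx P) (T : {set 'I_(sdim i).+1}) : #|T| = n.+1 ->
  sdim i = n /\ T = [set: 'I_(sdim i).+1]%SET.
Proof.
move=> cT; have di : sdim i = n.
  apply/eqP; rewrite eqn_leq; apply/andP; split.
    by have := leq_card _ (pr_vcol pr (i := i)); rewrite !card_ord.
  by have := max_card (mem T); rewrite cT card_ord.
split=> //; apply/eqP; rewrite eqEcard finset.subsetT/= cardsT card_ord cT.
by rewrite di.
Qed.

Lemma face_image_same_color (i j : sidx P) (S : {set 'I_(sdim i).+1})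
    (T : {set 'I_(sdim j).+1}) : S != finset.set0 -> #|S| = #|T| ->
  face_image i S = face_image j T -> vcol i @: S = vcol j @: T.
Proof.
move=> S0 cST ST; have vi := pr_vcol pr (i := i); have vj := pr_vcol pr (i := j).
have [x Sx xS] := face_point S0.
have : face_image i S (chart i x) by exists x.
rewrite ST => -[y /(face_color_coord vj) yT /esym/(pr_chart pr)[xy _]].
by apply/eqP; rewrite eqEcard !card_imset// cST leqnn andbT -xS xy.
Qed.

Hypothesis n_gt0 : (1 <= n)%N.
Hypothesis gb : forall c, bijective (g c).
Hypothesis Uc : adjacency_closed g U.

Lemma card_face_neq0 (i : sidx P) (S : {set 'I_(sdim i).+1}) : #|S| = n -> S != finset.set0.
Proof. by move=> cS; rewrite -cards_eq0 cS; case: (n) n_gt0. Qed.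

Lemma presentation_coloring : is_coloring P.
Proof.
split.
- split.
  + by move=> i j di dj /(simplex_image_eq di dj) ij; rewrite !(pr_plus pr)// ij.
  + move=> i j k l /face_image_same_color; rewrite !cards1 !imset_set1.
    by move=> /(_ (finset1_neq0 _) erefl)/finset.set1_inj.
  + move=> i j S T cS cT /face_image_same_color - /(_ (card_face_neq0 cS)).
    rewrite cS cT => /(_ erefl) ST.
    have cvS : #|vcol i @: S| = n by rewrite card_imset//; exact: pr_vcol pr i.
    apply: (missing_color cvS); first exact: pr_fcol pr _ _ cS.
    by rewrite ST; exact: pr_fcol pr _ _ cT.
- move=> i j di dj nij [A [[m [S [cS ->]]] Si Sj]].
  rewrite prednK// in cS.
  have S0 := card_face_neq0 cS.
  (* With [c] the color missing in the common face, both chambers lie on the same edge of color [c].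
     Equal signs would make them the same end of it. *)
  have /set_missing_color[c cE] : #|vcol m @: S| = n by rewrite card_imset//; exact: pr_vcol pr m.
  move/(face_image_share S0 di): Si; move/(face_image_share S0 dj): Sj; rewrite cE.
  move=> mj mi; have ij := conn_trans (conn_sym mi) mj.
  rewrite !(pr_plus pr)// => e; apply: nij; apply/simplex_image_eq => //.
  exact: (plus_end_inj (gb c) e (conn_plus_end (bij_inj (gb c)) (fintype.subxx _) ij)).
- by move=> i S _ k l _ _; exact: pr_vcol pr i k l.
- move=> i S cS; have fE : {in S, forall k, fcol i (S :\ k) = vcol i k}.
    move=> k kS; have cSk : #|S :\ k| = n.
      by have := cardsD1 k S; rewrite kS cS add1n => -[].
    have vi := pr_vcol pr (i := i).
    have cvS : #|vcol i @: (S :\ k)| = n by rewrite card_imset.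
    apply: (missing_color cvS); first exact: pr_fcol pr _ _ cSk.
    by apply/imsetP => -[l + /vi kl]; rewrite kl !inE eqxx.
  split=> // k l kS lS; rewrite fE// fE//; exact: pr_vcol pr i k l.
Qed.

(** Color coordinates descend to a continuous map [cc] on the realization, and reading off the
    colors of the vertices of [i] recovers the point: the chart has a continuous left inverse. *)
Lemma presentation_embedding (i : sidx P) : embedding (chart i).
Proof.
split; [exact: presentation_chart_inj pr i|exact: chart_continuous|].
move=> A [V Vo <-].
have /choice[cc ccE] (p : realization P) : exists v : 'rV[R]_n.+1,
    forall (j : sidx P) x, p = chart j x -> color_coord j x = v.
  have [j [x ->]] := chart_surj p; exists (color_coord j x) => k y.
  by move=> /(pr_chart pr)[].
have ccc : continuous cc.
  apply: realization_continuous => j.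
  have -> : cc \o chart j = color_coord j by apply/funext => x; apply/esym/ccE.
  exact: color_coord_continuous.
pose pull (v : 'rV[R]_n.+1) : 'rV[R]_(sdim i).+1 := \row_k v 0 (vcol i k).
have pullc : continuous pull.
  apply: row_continuous => k.
  rewrite (_ : (fun _ => _) = fun v : 'rV[R]_n.+1 => v 0 (vcol i k)); last first.
    by apply/funext => v; rewrite mxE.
  exact: coord_continuous.
exists ((pull \o cc) @^-1` V).
  apply: open_comp => // p _; apply: continuous_comp; [exact: ccc|exact: pullc].
apply/seteqP; split=> x; rewrite /preimage /=.
  have -> : pull (cc (chart i x)) = set_val x.
    by apply/rowP => k; rewrite mxE -(ccE _ i x erefl) color_coord_vcol//; exact: pr_vcol pr i.
  by [].
have -> : pull (cc (chart i x)) = set_val x.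
  by apply/rowP => k; rewrite mxE -(ccE _ i x erefl) color_coord_vcol//; exact: pr_vcol pr i.
by [].
Qed.

Hypothesis dims : forall i : sidx P, sdim i = n.
Hypothesis fin : finite_set [set: sidx P].

Lemma presentation_complex : is_simplicial_cell_complex P.
Proof.
split=> //; first exact: presentation_embedding.
- move=> i j; have vi := pr_vcol pr (i := i).
  exists [set S | S != finset.set0 /\ conn g (vcol i @: S) (r i) (r j)].
  apply/seteqP; split=> [x ijx|x [S [S0 /(face_image_share S0 (dims j)) iSj] Sx]].
    exists (support (set_val x)); last exact/faceE.
    split; first exact/support_simplex_neq0/simplex_val.
    by rewrite -support_color_coord//; apply/(presentation_chart_share pr).
  by apply: iSj; exists x.
- move=> i j S _ x x' z y y' w t _ _ _.
  have vi := pr_vcol pr (i := i); have vj := pr_vcol pr (i := j).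
  move=> /(pr_chart pr)[xy _] /(pr_chart pr)[xy' _] /(pr_chart pr)[zw _].
  move=> /(color_coord_conv_iff vi) zE; apply/(color_coord_conv_iff vj).
  by rewrite -xy -xy' -zw.
Qed.

Lemma presentation_pseudomanifold : is_pseudomanifold n P.
Proof.
split; first exact: presentation_complex.
- move=> k A [i [S [_ ->]]]; exists (simplex_image i); last by move=> _ [x _ <-]; exists x.
  exists i, [set: 'I_(sdim i).+1]%SET; split; last by rewrite face_image_full.
  by rewrite cardsT card_ord dims.
- move=> A [i [S [cS ->]]]; rewrite prednK// in cS.
  have S0 := card_face_neq0 cS; have vi := pr_vcol pr (i := i).
  have /set_missing_color[c cE] : #|vcol i @: S| = n by rewrite card_imset.
  have [j dj rj] := pr_onto pr (opposite_closed (gb c) Uc (pr_in pr i)).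
  have is_chamber (m : sidx P) : is_face n (simplex_image m).
    exists m, [set: 'I_(sdim m).+1]%SET; split; last by rewrite face_image_full.
    by rewrite cardsT card_ord dims.
  exists (simplex_image i), (simplex_image j); split.
    move=> /(simplex_image_eq (dims i) (dims j)); rewrite rj => /(congr1 fst).
    by rewrite opposite_sign; case: (r i).1.
  apply/seteqP; split=> [E [[m [T [cT ->]]] Sm]|E [] ->] /=.
  + have [dm TT] := card_full_face cT; move: Sm; rewrite TT face_image_full.
    move=> /(face_image_share S0 dm); rewrite cE => /(conn_edge (gb c)) mi.
    by case: mi => mi; [left|right]; apply/simplex_image_eq => //; rewrite mi.
  + by split=> // _ [x _ <-]; exists x.
  + split=> //; apply/face_image_share => //; rewrite cE rj.
    exact: conn_opposite.
Qed.

Lemma presentation_no_labelless_double : (forall i, nontrivial a b g (r i)) ->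
  forall D : set (realization P), ~ labelless_double_chamber D.
Proof.
move=> nt D /[dup] -[_ [k [l [_ _ DE _]]] _] Dd; apply: (nt k).
by apply: (labelless_double_trivial pr n_gt0 gb Dd); rewrite DE; exact: subsetUl.
Qed.

Lemma presentation_labeling : nontrivial a b g `<=` U -> is_labeling P.
Proof.
move=> nU; split; split.
- move=> s; have [|i di ri] := pr_onto pr (u := (true, val s)).
    by apply/nU/labeled_nontrivial; exact: ltn_ord.
  exists i; first by rewrite (pr_plus pr)// ri.
  by apply/seteqP; split=> j; [move=> /(pr_plab pr)[dj rj]|move=> [dj /(simplex_image_eq dj di) rj]];
    [split=> //; apply/simplex_image_eq => //; rewrite rj ri|apply/(pr_plab pr); rewrite rj].
- by move=> s t i /(pr_plab pr)[_ rs] /(pr_plab pr)[_]; rewrite rs => -[st]; apply: val_inj.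
- move=> s; have [|i di ri] := pr_onto pr (u := (false, val s)).
    by apply/nU/labeled_nontrivial; exact: ltn_ord.
  exists i; first by rewrite (pr_plus pr)// ri.
  by apply/seteqP; split=> j; [move=> /(pr_mlab pr)[dj rj]|move=> [dj /(simplex_image_eq dj di) rj]];
    [split=> //; apply/simplex_image_eq => //; rewrite rj ri|apply/(pr_mlab pr); rewrite rj].
- by move=> s t i /(pr_mlab pr)[_ rs] /(pr_mlab pr)[_]; rewrite rs => -[st]; apply: val_inj.
Qed.

Lemma convex_hull_convex d (A : set 'rV[R]_d.+1) :
  is_convex [set x : simplex R d | convex_hull A (set_val x)].
Proof.
move=> x y z t Ax Ay zE B [Bc AB]; have := Bc _ _ t (mem_set (Ax B (conj Bc AB))) (mem_set (Ay B (conj Bc AB))).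
by rewrite zE => /set_mem.
Qed.

Lemma sub_convex_hull d (A B : set 'rV[R]_d.+1) : A `<=` B -> convex_hull A `<=` convex_hull B.
Proof. by move=> AB x Ax C [Cc BC]; apply: Ax; split=> //; exact: subset_trans BC. Qed.

Lemma convex_hull_gen d (A : set 'rV[R]_d.+1) : A `<=` convex_hull A.
Proof. by move=> x Ax C [_]; exact. Qed.

(** The link is the union of connected pieces [H i], one for each simplex containing [A]. Two
    chambers adjacent across a color [c] outside [S] also share the face spanned by [A] and the
    vertex of some other color [c'] outside [S], and the point chosen in that face lies in both
    pieces. Codimension at least 2 provides [c']. *)
Lemma presentation_normal : is_normal n P.
Proof.
move=> k A phi [i0 [S0 [cS0 AE]]] kn phiP.
have v0 := pr_vcol pr (i := i0).
have S0n : S0 != finset.set0 by rewrite -cards_eq0 cS0.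
pose S := vcol i0 @: S0; have cS : #|S| = k.+1 by rewrite card_imset.
pose good i := conn g S (r i0) (r i).
have goodP i : A `<=` simplex_image i <-> good i by rewrite AE; exact: face_image_share.
pose pts (i : sidx P) (c : 'I_n.+1) := [set l | vcol i l \in c |: S]%SET.
have ptsE i c : vcol i @: pts i c = c |: S.
  apply/finset.setP => d; apply/imsetP/idP => [[l + ->]|dS]; first by rewrite inE.
  have : d \in vcol i @: [set: 'I_(sdim i).+1]%SET by rewrite imset_vcol_full//; exact: pr_vcol pr i.
  by move=> /imsetP[l _ dl]; exists l => //; rewrite inE -dl.
pose F i c := face_image i (pts i c).
have pts0 i c : pts i c != finset.set0.
  have /imsetP[l lc _] : c \in vcol i @: pts i c by rewrite ptsE !inE eqxx.
  by apply/finset.set0Pn; exists l.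
have cpts i c : c \notin S -> #|pts i c| = k.+2.
  by move=> cS'; rewrite -(card_imset _ (pr_vcol pr (i := i))) ptsE cardsU1 cS' cS.
have F_face i c : c \notin S -> is_face k.+1 (F i c).
  by move=> cS'; exists i, (pts i c); rewrite cpts.
have F_sub i j c : conn g (c |: S) (r i) (r j) -> F i c `<=` F j c.
  move=> ij _ [x Sx <-].
  have xS : support (color_coord i x) \subset c |: S.
    by rewrite -(ptsE i); apply/face_color_coord => //; exact: pr_vcol pr i.
  have : simplex_image j (chart i x).
    by apply/(presentation_chart_share pr) => //; exact: conn_mono ij.
  move=> [y _ yx]; exists y => //; apply/(face_color_coord (pr_vcol pr (i := j))).
  by rewrite ptsE; move: yx => /(pr_chart pr)[-> _].
have AF i c : good i -> A `<=` F i c.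
  move=> gi; rewrite AE => _ [x Sx <-].
  have xS : support (color_coord i0 x) \subset S by exact/face_color_coord.
  have [y _ yx] : simplex_image i (chart i0 x) by apply: ((goodP i).2 gi); rewrite AE; exists x.
  exists y => //; apply/(face_color_coord (pr_vcol pr (i := i))); rewrite ptsE.
  move: yx => /(pr_chart pr)[-> _]; apply: fintype.subset_trans xS _.
  exact: finset.subsetUr.
pose gens i (T : {set 'I_(sdim i).+1}) := set_val @` [set y : simplex R (sdim i) | face T y /\
  exists B, [/\ is_face k.+1 B, A `<=` B, B `<=` face_image i T & chart i y = phi B]].
pose H i := chart i @` [set x | convex_hull (gens i [set: 'I_(sdim i).+1]%SET) (set_val x)].
have linkE : link k A phi = \bigcup_(i in good) H i.
  apply/seteqP; split=> [p [i [T [AT [x -> hx]]]]|p [i gi [x hx <-]]].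
    exists i; first by apply/goodP; apply: subset_trans AT _ => _ [y _ <-]; exists y.
    exists x => //; apply: sub_convex_hull hx => _ [y [Ty [B [fB AB BT yB]]] <-].
    exists y => //; split; first by apply/faceE; exact: finset.subsetT.
    exists B; split=> //; apply: subset_trans BT _ => _ [z _ <-]; exists z => //.
    by apply/faceE; exact: finset.subsetT.
  exists i, [set: 'I_(sdim i).+1]%SET; split; first by rewrite face_image_full; exact/goodP.
  by exists x.
have Hc i : connected (H i).
  apply: connected_continuous_connected.
    apply: convex_connected; exact: (@convex_hull_convex _ (gens i _)).
  exact/continuous_subspaceT/chart_continuous.
have phiF i c : good i -> c \notin S -> H i (phi (F i c)).
  move=> gi cS'; have [j [T [FE [x xT phix]]]] := phiP _ (F_face i c cS') (AF i c gi).
  have : F i c (phi (F i c)).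
    by rewrite [X in X _]FE -phix; exists x => //; case: xT.
  move=> [y Fy yphi]; exists y => //; apply: convex_hull_gen; exists y => //.
  split; first by apply/faceE; exact: finset.subsetT.
  exists (F i c); split=> //; first exact: F_face.
    exact: AF.
  by rewrite face_image_full => _ [z _ <-]; exists z.
have Hlink i : good i -> H i `<=` link k A phi by move=> gi; rewrite linkE; exact: bigcup_sup.
have comp_step i j c p q : good i -> good j -> c \notin S -> conn g (c |: S) (r i) (r j) ->
    H i p -> H j q -> connected_component (link k A phi) p q.
  move=> gi gj cS' ij Hp Hq; apply: (@connected_component_trans _ _ (phi (F i c))).
    apply: (@connected_component_max _ _ (H i)) => //; first exact: Hlink.
    exact: phiF.
  apply/connected_component_sym; apply: (@connected_component_max _ _ (H j)) => //; first exact: Hlink.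
  have -> : F i c = F j c by apply/seteqP; split; apply: F_sub => //; exact: conn_sym.
  exact: phiF.
(* The colors of [A] together with [c] number at most k+2, which is less than n+1. *)
have extra c : exists2 c', c' \notin S & c' != c.
  have : (0 < #|~: (c |: S)|)%N.
    rewrite cardsCs finset.setCK card_ord subn_gt0 ltnS.
    apply: leq_trans kn; rewrite addn2 -cS.
    by apply: leq_trans (leq_card_setU _ _) _; rewrite cards1 add1n.
  by case/card_gt0P => c'; rewrite !inE negb_or => /andP[cc cS']; exists c'.
have comp u v : conn g S u v -> forall i j p q, r i = u -> r j = v -> good i ->
    H i p -> H j q -> connected_component (link k A phi) p q.
  elim=> {u v} [u v [c [p' [cS' ue ve]]]|u|u v uv IH|u v w uv IH vw IH'] i j p q iu jv gi Hp Hq.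
  - have [c' cS'' cc] := extra c.
    have ij d : d != c -> conn g (d |: S) (r i) (r j).
      move=> dc; apply: rst_step; exists c, p'; rewrite iu jv; split=> //.
      by rewrite !inE negb_or eq_sym dc.
    apply: (comp_step i j c' p q) => //; last exact: ij.
    by apply: conn_trans gi _; apply: conn_mono (ij c' cc); exact: finset.subsetUr.
  - have [c' cS'' _] := extra ord0.
    have ij : r i = r j by rewrite iu jv.
    apply: (comp_step i j c' p q) => //; last by rewrite ij; exact: conn_refl.
    by rewrite /good -ij.
  - apply/connected_component_sym; apply: (IH j i q p) => //.
    by apply: conn_trans gi _; rewrite iu jv; exact: conn_sym.
  - have Uv : U v by apply/(conn_closed Uc uv); rewrite -iu; exact: pr_in pr i.
    have [m dm mv] := pr_onto pr Uv.
    have gm : good m by apply: conn_trans gi _; rewrite iu mv.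
    have [c' cS'' _] := extra ord0.
    have Hm := phiF m c' gm cS''.
    apply: (@connected_component_trans _ _ (phi (F m c'))).
      exact: (IH i m p (phi (F m c'))).
    exact: (IH' m j (phi (F m c')) q).
have good0 : good i0 by exact: conn_refl.
have [c0 c0S _] := extra ord0.
have -> : link k A phi = connected_component (link k A phi) (phi (F i0 c0)).
  apply/seteqP; split=> [p|p]; last exact: connected_component_sub.
  rewrite {1}linkE => -[i gi Hp].
  exact: (comp _ _ gi i0 i _ p erefl erefl good0 (phiF _ _ good0 c0S) Hp).
exact: component_connected.
Qed.

End Faces.

Lemma presentation_pseudobordism {R : realType} {n a b : nat} (g : tuple_perm n)
    (P : labeled R n 'I_a 'I_b) (r : sidx P -> chamber) :
  (1 <= n)%N -> Ginf g -> presentation (nontrivial a b g) g r ->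
  (forall i : sidx P, sdim i = n) -> finite_set [set: sidx P] -> is_pseudobordism P.
Proof.
move=> n_gt0 gG pr dims fin; have gb := Ginf_bij gG.
have Uc : adjacency_closed g (nontrivial a b g).
  by apply: nontrivial_closed => c; exact: bij_inj.
split.
- exact: presentation_pseudomanifold pr n_gt0 gb Uc dims fin.
- exact: (presentation_normal pr Uc dims).
- exact: presentation_coloring pr n_gt0 gb.
- exact: (presentation_labeling pr).
- by apply: (presentation_no_labelless_double pr n_gt0 gb) => i; exact: pr_in pr i.
Qed.

(** * Faces shared by chambers of a pseudomanifold *)

Section CellComplex.
Context {R : realType}.
Implicit Types X : simplex_quotient R.

Section Complex.
Context {X : simplex_quotient R} (Xc : is_simplicial_cell_complex X).

Lemma complex_chart_inj (i : sidx X) : injective (chart i).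
Proof. by have [_ /(_ i)[]] := Xc. Qed.

(** An overlap is a union of faces, so it contains the smallest face through each of its points. *)
Lemma overlap_face (i j : sidx X) x : overlap i j x -> face (support (set_val x)) `<=` overlap i j.
Proof.
have [_ _ /(_ i j)[F FE] _] := Xc; rewrite FE => -[S FS /faceE xS] y Sy.
by exists S => //; exact: face_sub xS y Sy.
Qed.

Lemma complex_affine (i j : sidx X) (S : {set 'I_(sdim i).+1}) : face S `<=` overlap i j ->
  affine_on (face S) (fun x y => chart i x = chart j y).
Proof. by have [_ _ _] := Xc; apply. Qed.

(** The transition map is affine and injective on the smallest face containing [y], so it cannot
    send a point that is not a vertex to a vertex. *)
Lemma chart_vertex (i j : sidx X) k y : chart i (vertex k) = chart j y ->
  exists2 l, l \in support (set_val y) & y = vertex l.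
Proof.
move=> ky; have yT : overlap j i y by exists (vertex k).
have fT := overlap_face yT.
apply: (@preimage_vertex _ _ _ _ (fun y x => chart j y = chart i x) k y).
- exact: complex_affine.
- by move=> z /fT[x _ xz]; exists x.
- by move=> z z' x zx z'x; apply: complex_chart_inj; rewrite zx z'x.
- exact/faceE.
- exact/esym.
Qed.

End Complex.
End CellComplex.

Section Pseudomanifold.
Context {R : realType} {n : nat} {P : colored R n}.
Hypothesis n_gt0 : (1 <= n)%N.
Hypothesis Pm : is_pseudomanifold n P.
Hypothesis Pc : is_coloring P.

Lemma pm_complex : is_simplicial_cell_complex P.
Proof. by have [] := Pm. Qed.

Lemma color_coord_vertex (i : sidx P) k c : color_coord i (vertex k) 0 c = (vcol i k == c)%:R.
Proof.
rewrite mxE; under eq_bigr do rewrite coord_vertex.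
have [kc|kc] := eqVneq (vcol i k) c.
  by rewrite (bigD1 k) ?kc//= eqxx big1 ?addr0// => l /andP[_ /negbTE ->].
by rewrite big1// => l lc; case: eqVneq => // lk; rewrite -lk lc in kc.
Qed.

Lemma pm_vertex_color (i j : sidx P) k l : chart i (vertex k) = chart j (vertex l) ->
  vcol i k = vcol j l.
Proof.
by move=> kl; have [[_ h _] _ _ _] := Pc; apply: h; rewrite !face_image_vertex kl.
Qed.

(** Transition maps are affine and send vertices to vertices of the same color. This makes color
    coordinates functions on the realization. *)
Lemma pm_color (i j : sidx P) x y : chart i x = chart j y ->
  color_coord i x = color_coord j y.
Proof.
move=> xy; have ox : overlap i j x by exists y.
have fS := overlap_face pm_complex ox.
apply: (affine_color (complex_affine pm_complex fS)) xy; last exact/faceE.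
- by move=> z /fS[w _ wz]; exists w.
- move=> k z _ kz; have [l _ zl] := chart_vertex pm_complex kz.
  rewrite zl in kz *; apply/rowP => c.
  by rewrite !color_coord_vertex (pm_vertex_color kz).
Qed.

(** The axioms of a coloring separate the vertex colors of faces with n+1 vertices only. A general
    simplex inherits this from such a face containing its image, since distinct vertices go to
    distinct vertices. *)
Lemma pm_cover_aux (i : sidx P) : exists j (T : {set 'I_(sdim j).+1}),
  [/\ #|T| = n.+1, injective (vcol i) & simplex_image i `<=` face_image j T].
Proof.
have [_ /(_ (sdim i) (face_image i [set: 'I_(sdim i).+1]%SET)) cov _] := Pm.
have [|_ [j [T [cT ->]]] iT] := cov.
  by exists i, [set: 'I_(sdim i).+1]%SET; rewrite cardsT card_ord.
have iT' : simplex_image i `<=` face_image j T.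
  by move=> _ [x _ <-]; apply: iT; exists x => //; apply/faceE; exact: finset.subsetT.
exists j, T; split=> //.
have [_ _ /(_ j T cT) Tinj _] := Pc.
have vert k : exists2 l, l \in T & chart i (vertex k) = chart j (vertex l).
  have [|y Ty /esym yk] := iT' (chart i (vertex k)); first by exists (vertex k).
  have [l _ yl] := chart_vertex pm_complex yk.
  by exists l; rewrite -?yl//; apply/(face_vertex (R := R)); rewrite -yl.
move=> k k' kk.
have [l lT kl] := vert k; have [l' lT' kl'] := vert k'.
have ll : l = l'.
  by apply: Tinj => //; rewrite -(pm_vertex_color kl) -(pm_vertex_color kl').
have /(complex_chart_inj pm_complex)/(congr1 (fun x => coord x k)) : chart i (vertex k) = chart i (vertex k').
  by rewrite kl kl' ll.
rewrite !coord_vertex eqxx; case: eqVneq => // _ /eqP; by rewrite oner_eq0.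
Qed.

Lemma pm_vcol_inj (i : sidx P) : injective (vcol i).
Proof. by have [j [T []]] := pm_cover_aux i. Qed.

Lemma pm_full_face (j : sidx P) (T : {set 'I_(sdim j).+1}) : #|T| = n.+1 ->
  sdim j = n /\ face_image j T = simplex_image j.
Proof.
move=> cT; have dj : sdim j = n.
  apply/eqP; rewrite eqn_leq; apply/andP; split.
    by have := leq_card _ (pm_vcol_inj (i := j)); rewrite !card_ord.
  by have := max_card (mem T); rewrite cT card_ord.
split=> //; have -> : T = [set: 'I_(sdim j).+1]%SET.
  by apply/eqP; rewrite eqEcard finset.subsetT/= cardsT card_ord cT dj.
apply/seteqP; split=> [_ [x _ <-]|_ [x _ <-]]; exists x => //.
by apply/faceE; exact: finset.subsetT.
Qed.

Lemma pm_cover (i : sidx P) : exists2 j : sidx P, sdim j = n & simplex_image i `<=` simplex_image j.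
Proof.
by have [j [T [/pm_full_face[dj TE] _ ij]]] := pm_cover_aux i; exists j; rewrite -?TE.
Qed.

Lemma pm_is_chamber (i : sidx P) : sdim i = n -> is_face n (simplex_image i).
Proof.
move=> di; have cT : #|[set: 'I_(sdim i).+1]%SET| = n.+1 by rewrite cardsT card_ord di.
by exists i, [set: 'I_(sdim i).+1]%SET; rewrite (pm_full_face cT).2.
Qed.

(* The i-th and j-th simplices have in common the face with set of colors S. *)
Definition share (i j : sidx P) (S : {set 'I_n.+1}) : Prop :=
  exists2 x, overlap i j x & support (color_coord i x) = S.

Lemma share_overlap (i j : sidx P) x : overlap i j x <-> share i j (support (color_coord i x)).
Proof.
split=> [ox|[y oy xy]]; first by exists x.
apply: (overlap_face pm_complex oy); apply/(face_color_coord (pm_vcol_inj (i := i))).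
by rewrite -xy support_color_coord//; exact: pm_vcol_inj.
Qed.

Lemma pm_chart (i j : sidx P) x y : chart i x = chart j y <->
  color_coord i x = color_coord j y /\ share i j (support (color_coord i x)).
Proof.
split=> [xy|[xy /share_overlap[y' _ y'x]]].
  by split; [exact: pm_color|apply/share_overlap; exists y].
rewrite -y'x; congr chart; apply: (color_coord_inj (pm_vcol_inj (i := j))).
by rewrite (pm_color y'x).
Qed.

Lemma share_mono (i j : sidx P) (S S' : {set 'I_n.+1}) : S' \subset S ->
  S' != finset.set0 -> share i j S -> share i j S'.
Proof.
move=> SS S0 [x ox xS]; have vi := pm_vcol_inj (i := i).
have [|x' x'E] := color_coord_onto vi (uniform_row_simplex (R := R) S0).
  rewrite support_uniform_row; apply: fintype.subset_trans SS _.
  by rewrite -xS support_color_coord//; apply: imsetS; exact: finset.subsetT.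
exists x'; last by rewrite x'E support_uniform_row.
apply: (overlap_face pm_complex ox); apply/(face_color_coord vi).
by rewrite -support_color_coord// xS x'E support_uniform_row.
Qed.

Lemma share_sym (i j : sidx P) S : share i j S -> share j i S.
Proof.
move=> [x [y _ yx] xS]; exists y; first by exists x.
by rewrite (pm_color yx).
Qed.

Lemma share_trans (i j k : sidx P) S : share i j S -> share j k S -> share i k S.
Proof.
move=> [x [y _ yx] xS] jk; exists x => //.
have : share j k (support (color_coord j y)) by rewrite (pm_color yx) xS.
by move=> /share_overlap[z _ zy]; exists z => //; rewrite zy.
Qed.

Lemma share_refl (i : sidx P) (S : {set 'I_n.+1}) : sdim i = n -> S != finset.set0 -> share i i S.
Proof.
move=> di S0; have [x xS] := color_support_point (pm_vcol_inj (i := i)) di S0.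
by exists x => //; exists x.
Qed.

Lemma share_sub (i j : sidx P) (S : {set 'I_n.+1}) : sdim i = n ->
  S != finset.set0 -> simplex_image i `<=` simplex_image j -> share i j S.
Proof.
move=> di S0 ij; have [x xS] := color_support_point (pm_vcol_inj (i := i)) di S0.
by exists x => //; apply: ij; exists x.
Qed.

Lemma share_full (i j : sidx P) : sdim i = n -> sdim j = n ->
  share i j [set: 'I_n.+1]%SET -> simplex_image i = simplex_image j.
Proof.
move=> di dj ij; suff H (k l : sidx P) : sdim k = n -> share k l [set: 'I_n.+1]%SET ->
    simplex_image k `<=` simplex_image l.
  by apply/seteqP; split; apply: H => //; exact: share_sym.
move=> dk kl _ [x _ <-]; apply/share_overlap; apply: share_mono kl.
  exact: finset.subsetT.
exact/support_simplex_neq0/color_coord_simplex.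
Qed.

Lemma pm_image_eq (i j : sidx P) : sdim i = n -> sdim j = n ->
  simplex_image i `<=` simplex_image j -> simplex_image i = simplex_image j.
Proof. by move=> di dj ij; apply: share_full => //; apply: share_sub => //; exact: finsetT_neq0. Qed.

Definition color_face (i : sidx P) (S : {set 'I_n.+1}) : {set 'I_(sdim i).+1} :=
  [set k | vcol i k \in S].

Lemma imset_color_face (i : sidx P) S : sdim i = n -> vcol i @: color_face i S = S.
Proof.
move=> di; apply/finset.setP => d; apply/imsetP/idP => [[l + ->]|dS]; first by rewrite inE.
have : d \in vcol i @: [set: 'I_(sdim i).+1]%SET by rewrite (imset_vcol_full (pm_vcol_inj (i := i)) di) finset.in_setT.
by move=> /imsetP[l _ dl]; exists l => //; rewrite inE -dl.
Qed.

Lemma card_color_face (i : sidx P) S : sdim i = n -> #|color_face i S| = #|S|.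
Proof.
by move=> di; rewrite -(card_imset _ (pm_vcol_inj (i := i))) imset_color_face.
Qed.

Lemma share_face (i j : sidx P) S : sdim i = n -> S != finset.set0 ->
  share i j S <-> face_image i (color_face i S) `<=` simplex_image j.
Proof.
move=> di S0; have vi := pm_vcol_inj (i := i); split=> [ij _ [x xS <-]|ij].
  apply/share_overlap; apply: share_mono ij; last exact/support_simplex_neq0/color_coord_simplex.
  by rewrite -(imset_color_face S di); apply/(face_color_coord vi).
have [x xS] := color_support_point vi di S0.
exists x => //; apply: ij; exists x => //; apply/(face_color_coord vi).
by rewrite imset_color_face// xS.
Qed.

Lemma pm_neighbor (i : sidx P) c : sdim i = n -> exists j : sidx P,
  [/\ sdim j = n, is_plus j = ~~ is_plus i, share i j [set~ c]%SET &
      forall k : sidx P, sdim k = n -> share i k [set~ c]%SET ->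
        simplex_image k = simplex_image i \/ simplex_image k = simplex_image j].
Proof.
move=> di; pose A := face_image i (color_face i [set~ c]%SET).
have c0 := setC1_neq0 n_gt0 c.
have Ai : A `<=` simplex_image i by move=> _ [x _ <-]; exists x.
have fA : is_face n.-1 A.
  exists i, (color_face i [set~ c]%SET); split=> //.
  by rewrite card_color_face// cardsC1 card_ord prednK.
have [_ _ /(_ A fA)[C [D [CD CDE]]]] := Pm.
(* The chamber [i] contains the face, so it is one of the two chambers; the other one is the
   neighbor. *)
wlog Ci : C D CD CDE / C = simplex_image i.
  move=> H; have : [set C; D] (simplex_image i) by rewrite -CDE; split=> //; exact: pm_is_chamber.
  case=> iE; first exact: (H C D).
  by apply: (H D C) => //; [exact/nesym|rewrite CDE setUC].
have [/= [j [T [cT DE]]] AD] : [set E | is_face n E /\ A `<=` E] D by rewrite CDE; right.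
have [dj TE] := pm_full_face cT; rewrite {}TE in DE; subst C D.
exists j; split=> //.
- have [_ h _ _] := Pc; have := h i j di dj CD.
  have Aij : exists A, [/\ is_face n.-1 A, A `<=` simplex_image i & A `<=` simplex_image j] by exists A.
  by move=> /(_ Aij); case: (is_plus i); case: (is_plus j).
- by apply/share_face.
- move=> k dk /(share_face _ di c0) Ak.
  have : [set E | is_face n E /\ A `<=` E] (simplex_image k) by split=> //; exact: pm_is_chamber.
  by rewrite CDE.
Qed.

End Pseudomanifold.

(** * Normality *)

Lemma closed_face {R : realType} d (S : {set 'I_d.+1}) : closed (face S : set (simplex R d)).
Proof.
rewrite (_ : face S = \bigcap_(k in [set k | k \notin S]) ((fun x : simplex R d => coord x k) @^-1` [set 0])).
  apply: closed_bigI => k _; apply: closed_comp => [x _|]; first exact: coord_continuous_simplex.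
  exact: closed_eq.
by apply/seteqP; split.
Qed.

(** Its preimage under each chart is a finite union of closed faces. *)
Lemma complex_image_closed {R : realType} (X : simplex_quotient R) (i : sidx X) :
  is_simplicial_cell_complex X -> closed (simplex_image i).
Proof.
move=> [_ _ ov _]; apply/realization_closedP => j.
have [F FE] := ov j i; rewrite -[_ @^-1` _]/(overlap j i) FE.
apply: closed_bigcup => [|S _]; first exact: finite_finset.
exact: closed_face.
Qed.

Section Normality.
Context {R : realType} {n : nat} {P : colored R n}.
Hypothesis n_gt0 : (1 <= n)%N.
Hypothesis Pm : is_pseudomanifold n P.
Hypothesis Pc : is_coloring P.
Hypothesis Pn : is_normal n P.

(** The counterpart of [conn] before any numbering is available. The first alternative passes
    between simplices with the same image. *)
Definition gallery (S : {set 'I_n.+1}) : sidx P -> sidx P -> Prop :=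
  clos_refl_sym_trans (sidx P) (fun k l => [/\ sdim k = n, sdim l = n &
    simplex_image k = simplex_image l \/ exists2 c, c \notin S & share k l [set~ c]%SET]).

Lemma gallery_mono (S S' : {set 'I_n.+1}) (i j : sidx P) : S' \subset S -> gallery S i j -> gallery S' i j.
Proof.
move=> /fintype.subsetP SS; apply: clos_rst_mono => k l [dk dl kl]; apply: rst_step.
by split=> //; case: kl => [|[c cS cl]]; [left|right; exists c => //; apply: contra cS => /SS].
Qed.

(** A face may be the image of several faces of simplices; color supports do not depend on which one
    exhibits the interior point. *)
Lemma relative_interior_support k (B : set (realization P)) (i : sidx P) y :
  is_face k B -> relative_interior B (chart i y) ->
  #|support (color_coord i y)| = k.+1 /\
  forall (j : sidx P) z, B (chart j z) -> support (color_coord j z) \subset support (color_coord i y).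
Proof.
move=> [m [T [cT ->]]] [m' [T' [TE [x xT' xy]]]].
have v := pm_vcol_inj Pm Pc; have co := pm_color Pm Pc.
have xS : support (color_coord i y) = vcol m' @: T'.
  by rewrite -(co _ _ _ _ xy) support_color_coord//; move/face_interiorE: xT' => ->.
have sub j z : face_image m' T' (chart j z) -> support (color_coord j z) \subset support (color_coord i y).
  by rewrite xS => -[w /(face_color_coord (v m')) wT' /co <-].
split=> [|j z]; last by rewrite TE; exact: sub.
have T0 : T != finset.set0 by rewrite -cards_eq0 cT.
have <- : vcol m @: T = support (color_coord i y); last by rewrite (card_imset _ (v m)).
apply/eqP; rewrite finset.eqEsubset; apply/andP; split.
  have := sub m (barycenter T0); rewrite -TE support_color_coord// support_barycenter.
  apply; exists (barycenter T0) => //; apply/faceE; by rewrite support_barycenter.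
have : face_image m' T' (chart i y) by rewrite -xy; exists x => //; case: xT'.
by rewrite -TE => -[w /(face_color_coord (v m)) wT /co <-].
Qed.

Lemma conv_pos (t : {i01 R}) (u v : R) : 0 < u -> 0 < v -> 0 < t%:num * u + (1 - t%:num) * v.
Proof. exact: (@convR_gt0 R u v t). Qed.

(** Each point chosen in a (k+1)-face has all colors of [S] and one more in its support. Positivity
    on [S] and positive total mass outside [S] are convex conditions, so they pass to the hull. *)
Lemma link_support k (A : set (realization P)) phi (S : {set 'I_n.+1}) (i : sidx P) x :
  #|S| = k.+1 ->
  (exists (j : sidx P) z, A (chart j z) /\ support (color_coord j z) = S) ->
  (forall B, is_face k.+1 B -> A `<=` B -> relative_interior B (phi B)) ->
  link k A phi (chart i x) -> S \proper support (color_coord i x).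
Proof.
move=> cS [j0 [z0 [Az0 z0S]]] phiP [m [T [AT [x' xx' hx']]]].
rewrite (pm_color Pm Pc xx').
pose w (v : 'rV[R]_(sdim m).+1) (c : 'I_n.+1) := \sum_(l | vcol m l == c) v 0 l.
have wE (z : simplex R (sdim m)) c : w (set_val z) c = color_coord m z 0 c by rewrite mxE.
have wconv t (u v : 'rV[R]_(sdim m).+1) c :
    w ((u : convex_lmodType _) <| t |> v) c = t%:num * w u c + (1 - t%:num) * w v c.
  by rewrite /w !mulr_sumr -big_split/=; apply: eq_bigr => l _; rewrite !mxE.
pose W := [set v : 'rV[R]_(sdim m).+1 | (forall c, c \in S -> 0 < w v c) /\
  0 < \sum_(c | c \notin S) w v c].
have : W (set_val x').
  apply: hx'; split.
    move=> u v t /set_mem[u1 u2] /set_mem[v1 v2]; apply/mem_set; split=> [c cS'|].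
      by rewrite wconv conv_pos ?u1 ?v1.
    under eq_bigr do rewrite wconv.
    by rewrite big_split/= -!mulr_sumr conv_pos.
  move=> _ [y [_ [B [fB AB _ yB]]] <-].
  have := phiP B fB AB; rewrite -yB => /(relative_interior_support fB)[cy sub].
  have Sy : S \subset support (color_coord m y) by rewrite -z0S; apply: sub; exact: AB.
  have pos c : 0 <= color_coord m y 0 c by have [] := color_coord_simplex y.
  split=> [c /(fintype.subsetP Sy)|]; first by rewrite wE in_support lt0r pos andbT.
  have : (0 < #|support (color_coord m y) :\: S|)%N.
    by rewrite cardsDS// cy cS subn_gt0.
  case/card_gt0P => c; rewrite inE => /andP[cS' cy'].
  rewrite (bigD1 c)//= ltr_pwDl//; first by rewrite wE lt0r pos andbT -in_support.
  by apply: sumr_ge0 => d _; rewrite wE.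
move=> [W1 W2]; rewrite finset.properEneq andbC; apply/andP; split.
  by apply/fintype.subsetP => c /W1; rewrite wE in_support => /lt0r_neq0.
apply/eqP => SE; move: W2; rewrite big1 ?ltxx// => c; rewrite wE SE in_support negbK.
by move/eqP.
Qed.

(* Otherwise the chambers containing the common face fall into two families
   such that, by induction, two chambers of distinct families meet in no larger
   face; they split the link of that face into two disjoint closed sets. *)
Lemma share_gallery (S : {set 'I_n.+1}) (i j : sidx P) : S != finset.set0 ->
  sdim i = n -> sdim j = n -> share i j S -> gallery S i j.
Proof.
have [m] := ubnP (n.+1 - #|S|); elim: m S i j => // m IH S i j Sm S0 di dj ij.
have cS : (#|S| <= n.+1)%N by have := max_card (mem S); rewrite card_ord.
have [cS1|cS1] := eqVneq #|S| n.+1.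
  have ST : S = [set: 'I_n.+1]%SET.
    by apply/eqP; rewrite eqEcard finset.subsetT/= cardsT card_ord cS1.
  rewrite ST in ij; apply: rst_step; split=> //; left.
  exact: (share_full Pm Pc).
have [/set_missing_color[c cE]|cS2] := eqVneq #|S| n.
  apply: rst_step; split=> //; right; exists c; last by rewrite -cE.
  by rewrite cE !inE eqxx.
have [k cSk] : exists k, #|S| = k.+1 by exists #|S|.-1; rewrite prednK// card_gt0.
have kn : (k + 2 <= n)%N by lia.
have vc := pm_vcol_inj Pm Pc; have co := pm_color Pm Pc.
pose A := face_image i (color_face i S).
have fA : is_face k A by exists i, (color_face i S); rewrite (card_color_face Pm Pc).
have /choice[phi phiP] (B : set (realization P)) :
    exists q, is_face k.+1 B -> relative_interior B q.
  have [[l [T [cT BE]]]|nB] := pselect (is_face k.+1 B); last by exists (chart i (vertex ord0)).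
  have T0 : T != finset.set0 by rewrite -cards_eq0 cT.
  exists (chart l (barycenter T0)) => _; exists l, T; split=> //.
  by exists (barycenter T0) => //; apply/face_interiorE; exact: support_barycenter.
have Lc := Pn fA kn (fun B fB _ => phiP B fB).
have [x0 x0S] := color_support_point (vc i) di S0.
have Ax0 : A (chart i x0).
  by exists x0 => //; apply/(face_color_coord (vc i)); rewrite (imset_color_face Pm Pc)// x0S.
have Lsupp l x : link k A phi (chart l x) -> S \proper support (color_coord l x).
  apply: link_support => //; first by exists i, x0.
  by move=> B fB _; exact: phiP.
have Asub l : sdim l = n -> share i l S -> forall c, A `<=` face_image l (color_face l (c |: S)).
  move=> dl /(share_face Pm Pc l di S0) il c p Ap; have [y _ yp] := il p Ap.
  exists y => //; apply/(face_color_coord (vc l)); rewrite (imset_color_face Pm Pc)//.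
  move: Ap => [x /(face_color_coord (vc i)) xS xp].
  rewrite (imset_color_face Pm Pc)// in xS; rewrite -yp in xp; rewrite -(co _ _ _ _ xp).
  exact: fintype.subset_trans xS (finset.subsetUr _ _).
have [c0 c0S] : exists c, c \notin S.
  have : (0 < #|~: S|)%N by rewrite cardsCs finset.setCK card_ord subn_gt0 cSk; lia.
  by case/card_gt0P => c; rewrite inE; exists c.
have Lpt l : sdim l = n -> share i l S -> exists2 p, link k A phi p & simplex_image l p.
  move=> dl il; pose B := face_image l (color_face l (c0 |: S)).
  have fB : is_face k.+1 B.
    by exists l, (color_face l (c0 |: S)); rewrite (card_color_face Pm Pc)// cardsU1 c0S cSk.
  have [j' [T' [BE [x' x'T phix]]]] := phiP B fB.
  have : B (phi B) by rewrite [X in X _]BE -phix; exists x' => //; case: x'T.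
  move=> [y yB yphi]; exists (phi B); last by exists y.
  exists l, (color_face l (c0 |: S)); split; first exact: Asub.
  exists y; first exact/esym.
  apply: convex_hull_gen; exists y => //; split=> //.
  by exists B; split=> //; exact: Asub.
apply: contrapT => nij.
pose Z := [set l : sidx P | sdim l = n /\ gallery S i l].
pose Z' := [set l : sidx P | [/\ sdim l = n, share i l S & ~ gallery S i l]].
have [fin _ _ _] := pm_complex Pm.
have fZ (Y : set (sidx P)) : closed (\bigcup_(l in Y) simplex_image l).
  apply: closed_bigcup => [|l _]; first exact: sub_finite_set fin.
  exact: complex_image_closed (pm_complex Pm).
set U1 := \bigcup_(l in Z) simplex_image l; set U2 := \bigcup_(l in Z') simplex_image l.
have cover p : link k A phi p -> U1 p \/ U2 p.
  move=> Lp; have [q [T [AT [x px _]]]] := Lp.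
  have [l dl ql] := pm_cover Pm Pc q.
  have lp : simplex_image l p by apply: ql; rewrite px; exists x.
  have il : share i l S.
    apply/(share_face Pm Pc) => //; apply: subset_trans AT _ => _ [y _ <-].
    by apply: ql; exists y.
  by have [il'|il'] := pselect (gallery S i l); [left|right]; exists l.
have disj p : link k A phi p -> U1 p -> U2 p -> False.
  move=> Lp [l [dl il] [y _ yp]] [l' [dl' il' nil'] [y' _ y'p]]; apply: nil'.
  have Sy : S \proper support (color_coord l y) by apply: Lsupp; rewrite yp.
  apply: rst_trans il _; apply: (gallery_mono (proper_sub Sy)).
  apply: IH => //.
  - by have := proper_card Sy; have := max_card (mem (support (color_coord l y))); rewrite card_ord; lia.
  - exact/support_simplex_neq0/color_coord_simplex.
  - by apply/(share_overlap Pm Pc); exists y' => //; rewrite yp y'p.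
have [p1 Lp1 ip1] := Lpt i di (share_refl Pm Pc di S0).
have [p2 Lp2 jp2] := Lpt j dj ij.
(* On the link, [U1] is closed and is also the complement of the closed set [U2]. It is not empty,
   so connectedness makes it everything, against the point [p2]. *)
have LE : link k A phi `&` U1 = link k A phi.
  apply: Lc.
  - by exists p1; split=> //; exists i => //; split=> //; exact: rst_refl.
  - exists (~` U2); first by rewrite openC; exact: fZ.
    apply/seteqP; split=> p [Lp] => [Up|Up]; split=> //; first exact: disj.
    by case: (cover p Lp).
  - by exists U1 => //; exact: fZ.
have : (link k A phi `&` U1) p2 by rewrite LE.
by move=> [_ Up]; apply: (disj p2 Lp2 Up); exists j.
Qed.

End Normality.

(** * Every pseudobordism is presented *)

(** Listing the labeled chambers first makes the label of a chamber its position in the list. *)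
Lemma enumeration_with_prefix (T : choiceType) (F : set T) m (lab : 'I_m -> T) :
  finite_set F -> injective lab -> (forall s, F (lab s)) ->
  exists l : seq T, [/\ uniq l, forall x, x \in l <-> F x, (m <= size l)%N &
    forall x0 s, nth x0 l (val s) = lab s].
Proof.
move=> /finite_seqP[s0 FE] li labF.
pose l1 := map lab (enum 'I_m); pose l2 := [seq x <- undup s0 | x \notin l1].
have s1 : size l1 = m by rewrite size_map size_enum_ord.
exists (l1 ++ l2); split.
- rewrite cat_uniq map_inj_uniq// enum_uniq filter_uniq ?undup_uniq// andbT/= -all_predC.
  by apply/allP => x; rewrite mem_filter => /andP[].
- move=> x; rewrite mem_cat mem_filter mem_undup FE /=.
  case x1 : (x \in l1) => //=; split=> // _.
  by move: x1 => /mapP[s _ ->]; have := labF s; rewrite FE.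
- by rewrite size_cat s1 leq_addr.
- move=> x0 s; rewrite nth_cat s1 ltn_ord (nth_map s) ?nth_ord_enum//.
  by rewrite size_enum_ord; exact: ltn_ord.
Qed.

Section Classification.
Context {R : realType} {n a b : nat} {P : labeled R n 'I_a 'I_b}.
Hypothesis n_gt0 : (1 <= n)%N.
Hypothesis Pb : is_pseudobordism P.

Let Pm : is_pseudomanifold n P. Proof. by have [] := Pb. Qed.
Let Pn : is_normal n P. Proof. by have [] := Pb. Qed.
Let Pc : is_coloring P. Proof. by have [] := Pb. Qed.
Let Pl : is_labeling P. Proof. by have [] := Pb. Qed.

Let sign_eq (i j : sidx P) : sdim i = n -> sdim j = n ->
  simplex_image i = simplex_image j -> is_plus i = is_plus j.
Proof. by move=> di dj ij; have [[h _ _] _ _ _] := Pc; exact: h. Qed.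

Let image_share (i j : sidx P) (S : {set 'I_n.+1}) : S != finset.set0 -> sdim i = n ->
  simplex_image i = simplex_image j -> share i j S.
Proof. by move=> S0 di ij; apply: (share_sub Pm Pc) => //; rewrite ij. Qed.

(** The choice is made on chambers as subsets, so that simplices with the same image get the same
    neighbor. *)
Lemma opposite_chamber : exists opp : 'I_n.+1 -> set (realization P) -> set (realization P),
  (forall c (i : sidx P), sdim i = n -> exists j : sidx P,
     [/\ sdim j = n, is_plus j = ~~ is_plus i, simplex_image j = opp c (simplex_image i) &
         share i j [set~ c]%SET]) /\
  (forall c (i k : sidx P), sdim i = n -> sdim k = n -> share i k [set~ c]%SET ->
     simplex_image k = simplex_image i \/ simplex_image k = opp c (simplex_image i)).
Proof.
have /choice[opp oppP] (cE : 'I_n.+1 * set (realization P)) : exists E',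
    forall i : sidx P, sdim i = n -> simplex_image i = cE.2 -> (exists j : sidx P,
     [/\ sdim j = n, is_plus j = ~~ is_plus i, simplex_image j = E' &
         share i j [set~ cE.1]%SET]) /\
  (forall k : sidx P, sdim k = n -> share i k [set~ cE.1]%SET ->
     simplex_image k = simplex_image i \/ simplex_image k = E').
  case: cE => c E /=.
  have [[i0 [d0 <-]]|nE] := pselect (exists i : sidx P, sdim i = n /\ simplex_image i = E); last first.
    by exists E => i di iE; case: nE; exists i.
  have [j [dj pj ij jP]] := pm_neighbor n_gt0 Pm Pc c d0.
  exists (simplex_image j) => i di ii0.
  have c0 := setC1_neq0 n_gt0 c.
  have si := image_share c0 di ii0; have si' := share_sym Pm Pc si.
  split; first by exists j; split=> //; [rewrite (sign_eq di d0 ii0)|exact: (share_trans Pm Pc) ij].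
  move=> k dk ik; rewrite ii0; apply: jP => //; exact: (share_trans Pm Pc) ik.
exists (fun c E => opp (c, E)); split=> [c i di|c i k di].
  exact: (oppP (c, simplex_image i) i di erefl).1.
exact: (oppP (c, simplex_image i) i di erefl).2.
Qed.

Definition chambers e : set (set (realization P)) :=
  [set E | exists i : sidx P, [/\ sdim i = n, is_plus i = e & E = simplex_image i]].

Lemma finite_chambers e : finite_set (chambers e).
Proof.
have [fin _ _ _] := pm_complex Pm.
apply: (@sub_finite_set _ _ ((fun i : sidx P => simplex_image i) @` [set: sidx P])).
  by move=> E [i [_ _ ->]]; exists i.
exact: finite_image.
Qed.

Lemma chamber_lists : exists l : bool -> seq (set (realization P)),
  [/\ forall e, uniq (l e), forall e E, E \in l e <-> chambers e E,
      (a <= size (l true))%N /\ (b <= size (l false))%N,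
      forall s (i : sidx P), plab s i <-> sdim i = n /\ simplex_image i = nth set0 (l true) (val s) &
      forall s (i : sidx P), mlab s i <-> sdim i = n /\ simplex_image i = nth set0 (l false) (val s)].
Proof.
have side e m (lab : 'I_m -> set (sidx P)) : is_injective_chamber_map e lab ->
    exists l, [/\ uniq l, forall E, E \in l <-> chambers e E, (m <= size l)%N &
      forall s (i : sidx P), lab s i <-> sdim i = n /\ simplex_image i = nth set0 l (val s)].
  move=> [labP labi]; have /choice[k kP] s : exists i : sidx P, [/\ sdim i = n, is_plus i = e &
      lab s = [set j | sdim j = n /\ simplex_image j = simplex_image i]].
    by have [i [di pi] E] := labP s; exists i.
  have [|s t st|s|l [lu lF lm ln]] :=
    @enumeration_with_prefix _ (chambers e) m (fun s => simplex_image (k s)).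
  - exact: finite_chambers.
  - have [ds _ sE] := kP s; have [dt _ tE] := kP t; apply: (labi s t (k s)).
      by rewrite sE.
    by rewrite tE.
  - by have [ds ps _] := kP s; exists (k s).
  - by exists l; split=> // s i; rewrite ln; have [_ _ ->] := kP s.
have [/side[l1 [u1 F1 m1 n1]] /side[l2 [u2 F2 m2 n2]]] := Pl.
by exists (fun e => if e then l1 else l2); split=> [[]|[]||s i|s i].
Qed.

Theorem pseudobordism_presentation : exists2 g : tuple_perm n, Ginf g &
  exists r : sidx P -> chamber, presentation (nontrivial a b g) g r.
Proof.
have vc := pm_vcol_inj Pm Pc; have co := pm_color Pm Pc.
have [opp [opp_ex opp_un]] := opposite_chamber.
have [l [lu lP [la lb] lpl lml]] := chamber_lists.
have mem_l (i : sidx P) : sdim i = n -> simplex_image i \in l (is_plus i).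
  by move=> di; apply/lP; exists i.
have oppK c (i : sidx P) : sdim i = n -> opp c (opp c (simplex_image i)) = simplex_image i.
  move=> di; have [j [dj pj jE ij]] := opp_ex c i di.
  have [E|] := opp_un c j i dj di (share_sym Pm Pc ij); last by rewrite jE.
  by have := sign_eq di dj E; rewrite pj; case: (is_plus i).
have opp_mem c e E : E \in l e -> opp c E \in l (~~ e) /\ opp c (opp c E) = E.
  move=> /lP[i [di <- ->]]; split; last exact: oppK.
  by have [j [dj pj <- _]] := opp_ex c i di; apply/lP; exists j.
(* Crossing color 0 is injective from each sign to the other, so there are as many plus- as
   minus-chambers. *)
have size_le e : (size (l e) <= size (l (~~ e)))%N.
  rewrite -(size_map (opp ord0) (l e)); apply: uniq_leq_size.
    rewrite map_inj_in_uniq// => E E' /opp_mem-/(_ ord0)[_ {2}<-] /opp_mem-/(_ ord0)[_ {2}<-].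
    by move=> ->.
  by move=> _ /mapP[E /opp_mem-/(_ ord0)[? _] ->].
pose N := size (l true).
have sizeN e : size (l e) = N.
  by apply/eqP; rewrite eqn_leq; case: e; rewrite ?leqnn// (size_le true) (size_le false).
(* The position of the neighbor across color [c], extended by the identity from [N] on; [trK] says
   that crossing back undoes it. *)
pose tr c e p := if (p < N)%N then index (opp c (nth set0 (l e) p)) (l (~~ e)) else p.
have trN c e p : (tr c e p < N)%N = (p < N)%N.
  rewrite /tr; case: (ltnP p N) => pN; last by rewrite ltnNge pN.
  by rewrite -(sizeN (~~ e)) index_mem (opp_mem c e _ _).1// mem_nth// sizeN.
have trK c e : cancel (tr c e) (tr c (~~ e)).
  move=> p; rewrite {1}/tr trN; case: (ltnP p N) => pN; last by rewrite /tr ltnNge pN.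
  have pl : nth set0 (l e) p \in l e by rewrite mem_nth// sizeN.
  have [opl oppE] := opp_mem c e _ pl.
  by rewrite /tr pN nth_index// oppE negbK index_uniq// sizeN.
pose g : tuple_perm n := fun c => tr c true.
have gG : Ginf g.
  move=> c; split; first by exists (tr c false); [exact: trK|exact: (trK c false)].
  by exists N => m Nm; rewrite /g /tr ltnNge Nm.
have gb := Ginf_bij gG.
(* Every simplex is represented by a chamber [m i] containing its image, which settles those of
   smaller dimension. *)
have /choice[m mP] (i : sidx P) : exists j : sidx P, sdim j = n /\ simplex_image i `<=` simplex_image j.
  by have [j dj ij] := pm_cover Pm Pc i; exists j.
have dm i : sdim (m i) = n by have [] := mP i.
pose r (i : sidx P) : chamber := (is_plus (m i), index (simplex_image (m i)) (l (is_plus (m i)))).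
have rE (i : sidx P) : sdim i = n -> r i = (is_plus i, index (simplex_image i) (l (is_plus i))).
  move=> di; have im := pm_image_eq Pm Pc di (dm i) (mP i).2.
  by rewrite /r -(sign_eq di (dm i) im) im.
have rN i : ((r i).2 < N)%N by rewrite /r /= -(sizeN (is_plus (m i))) index_mem mem_l.
have r_nth (i : sidx P) : sdim i = n -> nth set0 (l (r i).1) (r i).2 = simplex_image i.
  by move=> di; rewrite rE //= nth_index// mem_l.
have r_inj (i j : sidx P) : sdim i = n -> sdim j = n -> r i = r j -> simplex_image i = simplex_image j.
  by move=> di dj ij; rewrite -(r_nth i)// ij r_nth.
have r_eq (i j : sidx P) : sdim i = n -> sdim j = n -> simplex_image i = simplex_image j -> r i = r j.
  by move=> di dj ij; rewrite !rE// ij (sign_eq di dj ij).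
have r_onto u : (u.2 < N)%N -> exists2 i : sidx P, sdim i = n & r i = u.
  case: u => e p /= pN; have : nth set0 (l e) p \in l e by rewrite mem_nth// sizeN.
  move=> /lP[i [di ie iE]]; exists i => //.
  by rewrite rE// ie -iE index_uniq// sizeN.
pose U := [set u : chamber | (u.2 < N)%N].
have Uc : adjacency_closed g U by move=> c p; rewrite /U /= /g trN.
have r_opp (i j : sidx P) c : sdim i = n -> sdim j = n -> is_plus i -> is_plus j = false ->
    simplex_image j = opp c (simplex_image i) -> r j = (false, g c (r i).2).
  move=> di dj pi pj jE; rewrite (rE j)// pj jE; congr pair.
  by rewrite /g /tr rN -(r_nth i)// rE //= pi.
have gallery_conn (S : {set 'I_n.+1}) (i j : sidx P) : gallery S i j -> conn g S (r i) (r j).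
  elim=> {i j} [i j [di dj ij]|i|i j _|i j k _ + _]; last 3 first.
  - exact: conn_refl.
  - exact: conn_sym.
  - exact: conn_trans.
  case: ij => [/(r_eq _ _ di dj) ->|[c cS ij]]; first exact: conn_refl.
  have [/(r_eq _ _ dj di) ->|jE] := opp_un c i j di dj ij; first exact: conn_refl.
  have [j' [dj' pj' j'E _]] := opp_ex c i di.
  have pj : is_plus j = ~~ is_plus i by rewrite -pj'; apply: sign_eq => //; rewrite jE j'E.
  case pi : (is_plus i) in pj.
    apply: rst_step; exists c, (r i).2; split=> //; last exact: r_opp.
    by rewrite rE// pi.
  apply: conn_sym; apply: rst_step; exists c, (r j).2; split=> //.
    by rewrite (rE j)// pj.
  by apply: r_opp => //; rewrite jE oppK.
have conn_share (S : {set 'I_n.+1}) u v : S != finset.set0 -> conn g S u v ->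
    forall i j : sidx P, sdim i = n -> sdim j = n -> r i = u -> r j = v -> share i j S.
  move=> S0; elim=> {u v} [u v [c [p [cS ue ve]]]|u|u v _ IH|u v w uv IH vw IH'] i j di dj iu jv.
  - have c0 := setC1_neq0 n_gt0 c.
    apply: (@share_mono R n P Pm Pc i j [set~ c]%SET) => //.
      by apply/fintype.subsetP => d dS; rewrite !inE; apply: contraNneq cS => <-.
    have [j' [dj' pj' j'E ij']] := opp_ex c i di.
    have pi : is_plus i by have := rE i di; rewrite iu ue => -[].
    have /(r_inj _ _ dj' dj) jj' : r j' = r j.
      by rewrite jv ve (r_opp i j' c)// ?pj' ?pi// iu ue.
    by apply: (share_trans Pm Pc) ij' _; exact: image_share.
  - by apply: image_share => //; apply: r_inj => //; rewrite iu jv.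
  - by apply: (share_sym Pm Pc); exact: IH.
  - have Uv : U v by apply/(conn_closed Uc uv); rewrite -iu; exact: rN.
    have [k dk kv] := r_onto _ Uv.
    exact: (share_trans Pm Pc) (IH i k di dk iu kv) (IH' k j dk dj kv jv).
have lift (i : sidx P) x : exists2 y, chart i x = chart (m i) y & color_coord (m i) y = color_coord i x.
  have [y _ yx] : simplex_image (m i) (chart i x) by apply: (mP i).2; exists x.
  by exists y => //; exact: co.
have pr : presentation U g r.
  split.
  - exact: vc.
  (* The coloring axioms relate face and vertex colors in chambers only, so the face is first moved
     to [m i], where it is opposite to a vertex [k]. *)
  - move=> i S cS; pose T := color_face (m i) (vcol i @: S).
    have TE : vcol (m i) @: T = vcol i @: S by exact: (imset_color_face Pm Pc).
    have ST : face_image i S = face_image (m i) T.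
      apply/seteqP; split=> [_ [x /(face_color_coord (vc i)) xS <-]|_ [y /(face_color_coord (vc (m i))) yT <-]].
        have [y -> yx] := lift i x; exists y => //.
        by apply/(face_color_coord (vc (m i))); rewrite yx TE.
      rewrite TE in yT; have [|x xy] := color_coord_onto (vc i) (color_coord_simplex y).
        by apply: fintype.subset_trans yT _; apply: imsetS; exact: finset.subsetT.
      exists x; first by apply/(face_color_coord (vc i)); rewrite xy.
      have [y' -> y'x] := lift i x; congr chart.
      by apply: (color_coord_inj (vc (m i))); rewrite y'x xy.
    have cT : #|T| = n by rewrite (card_color_face Pm Pc)// card_imset//; exact: vc.
    have [[_ _ /(_ _ _ _ _ cS cT ST) ->] _ _ /(_ (m i) [set: 'I_(sdim (m i)).+1]%SET)] := Pc.
    have full : #|[set: 'I_(sdim (m i)).+1]%SET| = n.+1 by rewrite cardsT card_ord dm.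
    move=> /(_ full)[_ fE].
    have [k kT] : exists k, T = [set: 'I_(sdim (m i)).+1]%SET :\ k.
      have /set_missing_color[c cE] : #|vcol (m i) @: T| = n by rewrite card_imset//; exact: vc.
      have : c \in vcol (m i) @: [set: 'I_(sdim (m i)).+1]%SET.
        by rewrite (imset_vcol_full (vc (m i)) (dm i)) finset.in_setT.
      move=> /imsetP[k _ ck]; exists k; apply/finset.setP => k'.
      rewrite !inE andbT; have := congr1 (fun A : {set 'I_n.+1} => vcol (m i) k' \in A) cE.
      rewrite mem_imset; last exact: vc.
      by rewrite /T inE => ->; rewrite !inE ck inj_eq//; exact: vc.
    rewrite {1}kT fE ?finset.in_setT// -TE; apply/imsetP => -[k' + /vc kk'].
    by rewrite -kk' kT !inE eqxx.
  - move=> i j x y; have [x' -> x'x] := lift i x; have [y' -> y'y] := lift j y.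
    rewrite -x'x -y'y (pm_chart Pm Pc).
    have S0 := support_simplex_neq0 (color_coord_simplex x').
    have rm k : r (m k) = r k by rewrite rE.
    split=> -[xy ij]; split=> //; rewrite ?xy in S0 *.
      rewrite -(rm i) -(rm j); apply/gallery_conn/(share_gallery n_gt0 Pm Pc Pn) => //.
      by rewrite -xy.
    by rewrite xy in ij; apply: (conn_share _ _ _ S0 ij); rewrite ?rm.
  - by move=> i di; rewrite rE.
  - move=> i s; rewrite lpl; split=> -[di iE]; split=> //.
      have pi : is_plus i.
        have : chambers true (simplex_image i).
          by apply/lP; rewrite iE; apply: mem_nth; exact: leq_trans (ltn_ord s) la.
        by move=> [k [dk pk ik]]; rewrite (sign_eq di dk ik).
      by rewrite rE// pi iE index_uniq//; exact: leq_trans (ltn_ord s) la.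
    by rewrite -r_nth// iE.
  - move=> i s; rewrite lml; split=> -[di iE]; split=> //.
      have pi : is_plus i = false.
        have : chambers false (simplex_image i).
          by apply/lP; rewrite iE; apply: mem_nth; exact: leq_trans (ltn_ord s) lb.
        by move=> [k [dk pk ik]]; rewrite (sign_eq di dk ik).
      by rewrite rE// pi iE index_uniq//; exact: leq_trans (ltn_ord s) lb.
    by rewrite -r_nth// iE.
  - exact: rN.
  - exact: r_onto.
(* Below [N] a trivial chamber would give an unlabeled double-chamber of [P], which has none; from
   [N] on, [g] is the identity beyond all labels. *)
have UE : U = nontrivial a b g.
  have [_ _ _ _ nld] := Pb.
  apply/seteqP; split=> [u /r_onto[i di <-] /(labelless_double_iff pr n_gt0 gb Uc)[D [Dd _]]|].
    exact: nld Dd.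
  move=> [e p] nt; rewrite /U /= ltnNge; apply/negP => Np; apply: nt.
  exists p, p; split; last by case: e; [left|right].
  split; [exact: leq_trans la _|by apply: leq_trans lb _; rewrite sizeN|].
  by move=> c; rewrite /g /tr ltnNge Np.
by exists g => //; exists r; rewrite -UE.
Qed.

End Classification.

(** * Composition *)

Lemma trivial_plusP n a b (g : tuple_perm n) p : trivial_chamber a b g (true, p) <->
  (a <= p)%N /\ exists2 q, (b <= q)%N & forall c, g c p = q.
Proof.
split=> [[p' [q [[ap bq gq] [[->]|//]]]]|[ap [q bq gq]]]; first by split=> //; exists q.
by exists p, q; split; [split|left].
Qed.

Lemma trivial_minusP n a b (g : tuple_perm n) q : trivial_chamber a b g (false, q) <->
  (b <= q)%N /\ exists2 p, (a <= p)%N & forall c, g c p = q.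
Proof.
split=> [[p [q' [[ap bq gq] [//|[->]]]]]|[bq [p ap gq]]]; first by split=> //; exists p.
by exists p, q; split; [split|right].
Qed.

Section Composition.
Context {R : realType} {n a b d : nat}.
Context {P : labeled R n 'I_a 'I_b} {Q : labeled R n 'I_b 'I_d}.
Context {g h : tuple_perm n} {rP : sidx P -> chamber} {rQ : sidx Q -> chamber}.
Hypothesis n_gt0 : (1 <= n)%N.
Hypotheses (gG : Ginf g) (hG : Ginf h).
Hypothesis prP : presentation (nontrivial a b g) g rP.
Hypothesis prQ : presentation (nontrivial b d h) h rQ.
Context {tau taui : nat -> nat}.
Hypotheses (tauK : cancel tau taui) (tauiK : cancel taui tau).
Hypothesis tau_fix : fixes_below b tau.
(** Beyond the labels, at least one of the two chambers that [tau] puts together is trivial, hence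
    absent from the pseudobordism in question. *)
Hypothesis generic : forall q, (b <= q)%N ->
  trivial_chamber a b g (false, q) \/ trivial_chamber b d h (true, tau q).

Let gb := Ginf_bij gG.
Let hb := Ginf_bij hG.
Let gi c := bij_inj (gb c).
Let hi c := bij_inj (hb c).
Let gcl := nontrivial_closed a b gi.
Let hcl := nontrivial_closed b d hi.
Let CG := cut_and_glue P Q.
Let NM := normalization CG.
Let k : tuple_perm n := Gmul (Gmul g (fun=> tau)) h.

Let kE c p : k c p = h c (tau (g c p)). Proof. by []. Qed.

Let kG : Ginf k.
Proof. by have [tauS _] := tau_fix; apply: Ginf_Gmul => //; apply: Ginf_Gmul. Qed.

Let kb := Ginf_bij kG.
Let ki c := bij_inj (kb c).

Let taui_fix : fixes_below b taui.
Proof.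
have [t [tb t1 t2]] := fixes_below_inv tau_fix.
by have -> : taui = t by apply/funext => m; rewrite -[in RHS](tauiK m) t1.
Qed.

Let tau_geq q : (b <= tau q)%N = (b <= q)%N.
Proof. exact: fixes_below_geq. Qed.

Let taui_geq q : (b <= taui q)%N = (b <= q)%N.
Proof. exact: fixes_below_geq. Qed.

Let g_pre c q : g c (plus_end (g c) (false, q)) = q. Proof. by rewrite plus_endK. Qed.
Let h_pre c q : h c (plus_end (h c) (false, q)) = q. Proof. by rewrite plus_endK. Qed.

(** A kept minus-chamber [q] of [P] has its [tau q] trivial for [h], so [h c (tau q)] is the same
    for all [c], and color 0 is an arbitrary choice. The same applies to the kept plus-chambers of
    [Q] with [g] in place of [h]. *)
Definition glued_chamber (i : cut_idx P Q) : chamber :=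
  match i with
  | inl i => if (rP (\val i)).1 then rP (\val i) else (false, h ord0 (tau (rP (\val i)).2))
  | inr j => if (rQ (\val j)).1 then (true, plus_end (g ord0) (false, taui (rQ (\val j)).2))
             else rQ (\val j)
  end.
Let rho := glued_chamber.

(* The color-c edge of k to which the points of the i-th simplex of colors
   other than c belong. *)
Definition glued_edge c (i : cut_idx P Q) : nat :=
  match i with
  | inl i => plus_end (g c) (rP (\val i))
  | inr j => plus_end (g c) (false, taui (plus_end (h c) (rQ (\val j))))
  end.

(** [P] and [Q] are glued along boundaries of chambers only, so a point whose support has all colors
    determines its piece and its chamber; see [glue_side]. *)
Let side (i : cut_idx P Q) : chamber + chamber :=
  match i with inl i => inl (rP (\val i)) | inr j => inr (rQ (\val j)) end.

Let rho_side i j : side i = side j -> rho i = rho j.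
Proof.
rewrite /rho /glued_chamber.
by case: i => i; case: j => j //= [->].
Qed.

Let cg_vcol (i : sidx CG) : injective (vcol i).
Proof. by case: i => i; [exact: (pr_vcol prP (i := \val i))|exact: (pr_vcol prQ (i := \val i))]. Qed.

Let cg_fcol (i : sidx CG) (S : {set 'I_(sdim i).+1}) : #|S| = n -> fcol i S \notin vcol i @: S.
Proof. by case: i S => i S; [exact: (pr_fcol prP)|exact: (pr_fcol prQ)]. Qed.

Let pt : Type := simplex_sum R (@cut_dim R n 'I_a 'I_b 'I_d P Q).
Let ccol (p : pt) : 'rV[R]_n.+1 := @color_coord R n CG (projT1 p) (projT2 p).
Let glue (p q : pt) : Prop := cut_glue (projT2 p) (projT2 q).

Let glue_color p q : glue p q -> ccol p = ccol q.
Proof.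
case: p => -[] i x; case: q => -[] j y //=.
- by move=> /(pr_chart prP)[].
- move=> [s [i' [j' [_ _ [x' [y' [/(pr_chart prP)[xx _] /(pr_chart prQ)[yy _] _ _ xy]]]]]]].
  by transitivity (color_coord i' x'); [exact: xx|rewrite xy; exact/esym].
- by move=> /(pr_chart prQ)[].
Qed.

Let glue_edge p q c : glue p q -> [set~ c]%SET \subset support (ccol p) ->
  glued_edge c (projT1 p) = glued_edge c (projT1 q).
Proof.
case: p => -[] i x; case: q => -[] j y //=.
- by move=> /(pr_chart prP)[_ ij] cS; rewrite (conn_plus_end (@gi c) cS ij).
- move=> [s [i' [j' [/(pr_mlab prP)[di' ri'] /(pr_plab prQ)[dj' rj'] [x' [y' [xx yy _ _ xy]]]]]]] cS.
  move: xx yy => /(pr_chart prP)[xx ii] /(pr_chart prQ)[yy jj].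
  have cS' : [set~ c]%SET \subset support (color_coord (\val j) y) by rewrite yy -xy -xx.
  rewrite (conn_plus_end (@gi c) cS ii) (conn_plus_end (@hi c) cS' jj) ri' rj' plus_end_plus.
  by rewrite (proj2 taui_fix)//; exact: ltn_ord.
- by move=> /(pr_chart prQ)[_ ij] cS; rewrite (conn_plus_end (@hi c) cS ij).
Qed.

Let glue_side p q : glue p q -> support (ccol p) = [set: 'I_n.+1]%SET -> side (projT1 p) = side (projT1 q).
Proof.
case: p => -[] i x; case: q => -[] j y //=.
- by move=> /(pr_chart prP)[_ ij] S; rewrite /ccol /= in S; rewrite S in ij; rewrite (conn_full ij).
- move=> [s [i' [j' [/(pr_mlab prP)[di' ri'] _ [x' [y' [xx _ bx' _ _]]]]]]] S.
  move: xx => /(pr_chart prP)[xx _].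
  have [c] := (boundary_support x' (pr_vcol prP (i := i')) di').1 bx'.
  by rewrite -xx [support _]S finset.in_setT.
- by move=> /(pr_chart prQ)[_ ij] S; rewrite /ccol /= in S; rewrite S in ij; rewrite (conn_full ij).
Qed.

Let cg_chart (i j : sidx CG) x y : chart i x = chart j y <->
  clos_refl_sym_trans pt glue (existT _ i x) (existT _ j y).
Proof. exact: chart_glue. Qed.

Let clos_color p q : clos_refl_sym_trans pt glue p q -> ccol p = ccol q.
Proof. by elim=> {p q} [p q /glue_color|//|//|p q r _ -> _ ->]. Qed.

Let cg_color (i j : sidx CG) x y : chart i x = chart j y -> color_coord i x = color_coord j y.
Proof. by move=> /cg_chart/clos_color. Qed.

Let clos_edge c p q : clos_refl_sym_trans pt glue p q -> [set~ c]%SET \subset support (ccol p) ->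
  glued_edge c (projT1 p) = glued_edge c (projT1 q).
Proof.
elim=> {p q} [p q /glue_edge E|//|p q pq IH|p q r pq IH _ IH']; first exact: E.
  by rewrite -(clos_color pq) => /IH.
by move=> /[dup]/IH -> cS; apply: IH'; rewrite -(clos_color pq).
Qed.

Let clos_side p q : clos_refl_sym_trans pt glue p q -> support (ccol p) = [set: 'I_n.+1]%SET ->
  side (projT1 p) = side (projT1 q).
Proof.
elim=> {p q} [p q /glue_side E|//|p q pq IH|p q r pq IH _ IH']; first exact: E.
  by rewrite -(clos_color pq) => /IH.
by move=> /[dup]/IH -> cS; apply: IH'; rewrite -(clos_color pq).
Qed.

Let cg_edge c (i j : sidx CG) x y : chart i x = chart j y ->
  [set~ c]%SET \subset support (color_coord i x) -> glued_edge c i = glued_edge c j.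
Proof. by move=> /cg_chart/clos_edge; exact. Qed.

Let cg_side (i j : sidx CG) x y : chart i x = chart j y ->
  support (color_coord i x) = [set: 'I_n.+1]%SET -> side i = side j.
Proof. by move=> /cg_chart/clos_side; exact. Qed.

(** The chamber is unlabeled, so [q] is at least [b], and it belongs to [P], so it is not trivial
    for [g]; genericity leaves only that [tau q] is trivial for [h]. *)
Let kept_minus (i : {i : sidx P | `[< forall s, ~ mlab s i >]}) q : sdim (\val i) = n ->
  rP (\val i) = (false, q) -> (b <= q)%N /\
  exists2 q', (d <= q')%N & forall c, h c (tau q) = q'.
Proof.
move=> di ri; have bq : (b <= q)%N.
  rewrite leqNgt; apply/negP => qb; have /asboolP/(_ (Ordinal qb)) := valP i.
  by apply; apply/(pr_mlab prP).
split=> //; have := pr_in prP (\val i); rewrite ri; case: (generic bq) => // t _.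
by move: t => /trivial_plusP[_ []]q' ? ?; exists q'.
Qed.

Let kept_plus (j : {j : sidx Q | `[< forall s, ~ plab s j >]}) p2 : sdim (\val j) = n ->
  rQ (\val j) = (true, p2) -> (b <= p2)%N /\
  exists2 p, (a <= p)%N & forall c, g c p = taui p2.
Proof.
move=> dj rj; have bp : (b <= p2)%N.
  rewrite leqNgt; apply/negP => pb; have /asboolP/(_ (Ordinal pb)) := valP j.
  by apply; apply/(pr_plab prQ).
split=> //; have := pr_in prQ (\val j); rewrite rj.
have := generic (q := taui p2); rewrite taui_geq tauiK => /(_ bp)[] // t _.
by move: t => /trivial_minusP[_ []]p ? ?; exists p.
Qed.

Let plus_preE c p q : g c p = q -> plus_end (g c) (false, q) = p.
Proof. by move=> <-; exact: plus_end_minus. Qed.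

Let edge_rho c (i : cut_idx P Q) : cut_dim i = n -> plus_end (k c) (rho i) = glued_edge c i.
Proof.
case: i => i /= di.
  case ri : (rP (\val i)) => [[] p] /=; first by rewrite !plus_end_plus.
  have [bp [q' dq' hq']] := kept_minus di ri.
  by rewrite hq' -(hq' c) -[in LHS](g_pre c p) -kE plus_end_minus.
case ri : (rQ (\val i)) => [[] p] /=.
  have [bp [p' ap' gp']] := kept_plus di ri.
  by rewrite !plus_end_plus !(plus_preE (gp' _)).
have E : k c (plus_end (g c) (false, taui (plus_end (h c) (false, p)))) = p.
  by rewrite kE g_pre tauiK h_pre.
by rewrite -[X in plus_end (k c) (false, X)]E plus_end_minus.
Qed.

Let rho_sign (i : sidx CG) : sdim i = n -> is_plus i = (rho i).1.
Proof.
case: i => i /= di; first by rewrite (pr_plus prP)//; rewrite /rho /=; case: ifP.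
by rewrite (pr_plus prQ)//; rewrite /rho /=; case: ifP.
Qed.

Let cg_inl i j x y : chart (\val i) x = chart (\val j) y ->
  @chart R CG (inl i) x = @chart R CG (inl j) y.
Proof. by move=> ij; apply/cg_chart; exact: rst_step. Qed.

Let cg_inr i j x y : chart (\val i) x = chart (\val j) y ->
  @chart R CG (inr i) x = @chart R CG (inr j) y.
Proof. by move=> ij; apply/cg_chart; exact: rst_step. Qed.

Let rho_inj (i j : sidx CG) x y : sdim i = n -> sdim j = n -> rho i = rho j ->
  color_coord i x = color_coord j y -> chart i x = chart j y.
Proof.
wlog : i j x y / if i is inl _ then true else if j is inr _ then true else false.
  move=> H; case: i x => i x; case: j y => j y; try exact: H.
  by move=> di dj ij xy; apply/esym; apply: H.
case: i x => i x; case: j y => j y //= _ di dj; rewrite /rho /glued_chamber /=.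
- case ri : (rP (\val i)) => [[] p]; case rj : (rP (\val j)) => [[] q] //= [pq] xy.
    by apply: cg_inl; apply/(pr_chart prP); rewrite ri rj pq; split=> //; exact: conn_refl.
  have {}pq := can_inj tauK (hi pq).
  by apply: cg_inl; apply/(pr_chart prP); rewrite ri rj pq; split=> //; exact: conn_refl.
(* A chamber of [P] and one of [Q] never get the same place: a kept plus-chamber of [Q] is placed at
   the plus end of a double-chamber absent from [P], and dually for minus-chambers. *)
- case ri : (rP (\val i)) => [[] p]; case rj : (rQ (\val j)) => [[] q] //= [pq] xy.
    have [bq [p' ap' gp']] := kept_plus dj rj.
    have := pr_in prP (\val i); rewrite ri pq (plus_preE (gp' _)); case.
    by apply/trivial_plusP; split=> //; exists (taui q); rewrite ?taui_geq.
  have [bp [q' dq' hq']] := kept_minus di ri.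
  have := pr_in prQ (\val j); rewrite rj -pq hq'; case.
  by apply/trivial_minusP; split=> //; exists (tau p); rewrite ?tau_geq.
- case ri : (rQ (\val i)) => [[] p]; case rj : (rQ (\val j)) => [[] q] //= [pq] xy.
    have [bp [p' ap' gp']] := kept_plus di ri; have [bq [q' aq' gq']] := kept_plus dj rj.
    move: pq; rewrite (plus_preE (gp' _)) (plus_preE (gq' _)) => pq.
    have {}pq : p = q by rewrite -(tauiK p) -(gp' ord0) pq gq' tauiK.
    by apply: cg_inr; apply/(pr_chart prQ); rewrite ri rj pq; split=> //; exact: conn_refl.
  by apply: cg_inr; apply/(pr_chart prQ); rewrite ri rj pq; split=> //; exact: conn_refl.
Qed.

(** The removed chambers with label [s] contain the points with the coordinates of [x]: vanishing of
    coordinate [c] puts these on their boundaries and on the faces of color [c] towards [i] and [j],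
    so the gluing along label [s] identifies [x] with [y]. *)
Let cg_across i j x y c s : sdim (\val i) = n -> sdim (\val j) = n -> (s < b)%N ->
  plus_end (g c) (rP (\val i)) = plus_end (g c) (false, s) ->
  plus_end (h c) (rQ (\val j)) = s ->
  c \notin support (color_coord (\val i) x) ->
  color_coord (\val i) x = color_coord (\val j) y ->
  @chart R CG (inl i) x = @chart R CG (inr j) y.
Proof.
move=> di dj sb ri rj cS xy; apply/cg_chart; apply: rst_step => /=.
have [i' di' ri'] := pr_onto prP (@labeled_nontrivial n a b g false s sb).
have [j' dj' rj'] := pr_onto prQ (@labeled_nontrivial n b d h true s sb).
have [x' x'x] := color_point (pr_vcol prP (i := i')) di' (color_coord_simplex x).
have [y' y'x] := color_point (pr_vcol prQ (i := j')) dj' (color_coord_simplex x).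
exists (Ordinal sb), i', j'; split.
- by apply/(pr_mlab prP).
- by apply/(pr_plab prQ).
- exists x', y'; split.
  + apply/(pr_chart prP); rewrite x'x; split=> //.
    by apply: (plus_end_conn (gb c) cS); rewrite ri ri'.
  + apply/(pr_chart prQ); rewrite y'x; split; first exact/esym.
    by rewrite -xy; apply: (plus_end_conn (hb c) cS); rewrite rj rj' plus_end_plus.
  + by apply/boundary_support => //; [exact: pr_vcol prP i'|exists c; rewrite x'x].
  + by apply/boundary_support => //; [exact: pr_vcol prQ j'|exists c; rewrite y'x].
  + by rewrite x'x y'x.
Qed.


(** Across color [c] one finds either a kept chamber of the same piece or a removed one with some
    label [s]; in the latter case the neighbor is the chamber across color [c] from the removed
    chamber [s] of the other piece. *)
Let neighbor c (i : sidx CG) : sdim i = n -> exists2 j : sidx CG, sdim j = n &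
  rho j = opposite k c (rho i) /\ forall x y, c \notin support (color_coord i x) ->
    color_coord i x = color_coord j y -> chart i x = chart j y.
Proof.
(* The edge of color [c] together with the sign determines a chamber of [k]. *)
have finish (j : sidx CG) : sdim i = n -> sdim j = n -> (rho j).1 = ~~ (rho i).1 ->
    glued_edge c j = glued_edge c i -> rho j = opposite k c (rho i).
  move=> di dj s e; apply: (plus_end_inj (kb c)); first by rewrite opposite_sign.
  rewrite edge_rho// e -edge_rho//.
  by apply: (conn_plus_end (@ki c) (fintype.subxx _)); exact: conn_opposite.
case: i finish => i finish di.
  have inP u : nontrivial a b g u -> plus_end (g c) u = plus_end (g c) (rP (\val i)) ->
      u.1 = ~~ (rP (\val i)).1 -> (u.1 = false -> (b <= u.2)%N) ->
      exists2 j : sidx CG, sdim j = n & rho j = opposite k c (rho (inl i)) /\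
        forall x y, c \notin support (@color_coord R n CG (inl i) x) ->
          @color_coord R n CG (inl i) x = color_coord j y -> @chart R CG (inl i) x = chart j y.
    move=> nu e su bu; have [j dj rj] := pr_onto prP nu.
    have jk : `[< forall s, ~ mlab s j >].
      apply/asboolP => s /(pr_mlab prP)[_]; rewrite rj => uE.
      by have := bu; rewrite uE /= leqNgt ltn_ord => /(_ erefl).
    exists (inl (exist _ j jk)) => //; split.
      apply: finish => //; last by rewrite /= rj.
      by rewrite -!rho_sign//= !(pr_plus prP)// rj.
    move=> x y cS xy; apply: cg_inl; apply/(pr_chart prP); split=> //=.
    by apply: (plus_end_conn (gb c) cS); rewrite rj e.
  have inQ s : (s < b)%N -> rP (\val i) = (true, plus_end (g c) (false, s)) ->
      exists2 j : sidx CG, sdim j = n & rho j = opposite k c (rho (inl i)) /\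
        forall x y, c \notin support (@color_coord R n CG (inl i) x) ->
          @color_coord R n CG (inl i) x = color_coord j y -> @chart R CG (inl i) x = chart j y.
    move=> sb ri; have nu : nontrivial b d h (false, h c s).
      by apply/hcl; exact: labeled_nontrivial.
    have [j dj rj] := pr_onto prQ nu.
    have jk : `[< forall s, ~ plab s j >].
      by apply/asboolP => s' /(pr_plab prQ)[_]; rewrite rj.
    exists (inr (exist _ j jk)) => //; split.
      apply: finish => //.
        by rewrite -!rho_sign//= (pr_plus prP)// (pr_plus prQ)// rj ri.
      by rewrite /= rj ri plus_end_plus (plus_end_minus _ (@hi c)) (proj2 taui_fix).
    move=> x y cS xy; apply: (@cg_across _ _ x y c s) => //=.
      by rewrite ri plus_end_plus.
    by rewrite rj plus_end_minus.
  case ri : (rP (\val i)) => [[] p].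
    have nr := pr_in prP (\val i); rewrite ri in nr.
    have [bq|qb] := leqP b (g c p).
      apply: (inP (false, g c p)) => //; last by rewrite ri.
        exact/gcl.
      by rewrite ri plus_end_minus.
    by apply: (inQ (g c p)) => //; rewrite ri plus_end_minus.
  have nr := pr_in prP (\val i); rewrite ri in nr.
  apply: (inP (true, plus_end (g c) (false, p))) => //; try by rewrite ri.
  by apply/(gcl c); rewrite g_pre.
have inQ u : nontrivial b d h u -> plus_end (h c) u = plus_end (h c) (rQ (\val i)) ->
    u.1 = ~~ (rQ (\val i)).1 -> (u.1 = true -> (b <= u.2)%N) ->
    exists2 j : sidx CG, sdim j = n & rho j = opposite k c (rho (inr i)) /\
      forall x y, c \notin support (@color_coord R n CG (inr i) x) ->
        @color_coord R n CG (inr i) x = color_coord j y -> @chart R CG (inr i) x = chart j y.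
  move=> nu e su bu; have [j dj rj] := pr_onto prQ nu.
  have jk : `[< forall s, ~ plab s j >].
    apply/asboolP => s /(pr_plab prQ)[_]; rewrite rj => uE.
    by have := bu; rewrite uE /= leqNgt ltn_ord => /(_ erefl).
  exists (inr (exist _ j jk)) => //; split.
    apply: finish => //; last by rewrite /= rj e.
    by rewrite -!rho_sign//= !(pr_plus prQ)// rj.
  move=> x y cS xy; apply: cg_inr; apply/(pr_chart prQ); split=> //=.
  by apply: (plus_end_conn (hb c) cS); rewrite rj e.
have nr := pr_in prQ (\val i).
case ri : (rQ (\val i)) nr => [[] p] nr.
  apply: (inQ (false, h c p)) => //; first exact/hcl.
    by rewrite ri plus_end_minus.
  by rewrite ri.
have nu : nontrivial b d h (true, plus_end (h c) (false, p)) by apply/(hcl c); rewrite h_pre.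
have [bq|sb] := leqP b (plus_end (h c) (false, p)).
  by apply: (inQ (true, plus_end (h c) (false, p))) => //; rewrite ri.
pose s := plus_end (h c) (false, p).
have nu' : nontrivial a b g (true, plus_end (g c) (false, s)).
  by apply/(gcl c); rewrite g_pre; exact: labeled_nontrivial.
have [j dj rj] := pr_onto prP nu'.
have jk : `[< forall s, ~ mlab s j >].
  by apply/asboolP => s' /(pr_mlab prP)[_]; rewrite rj.
exists (inl (exist _ j jk)) => //; split.
  apply: finish => //.
    by rewrite -!rho_sign//= (pr_plus prP)// (pr_plus prQ)// rj ri.
  by rewrite /= rj ri plus_end_plus (proj2 taui_fix).
move=> x y cS xy; apply/esym; apply: (@cg_across _ _ y x c s) => //=.
- by rewrite rj.
- by rewrite ri.
- by rewrite -[color_coord j y]xy.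
Qed.

(** It may exceed the nontrivial chambers of [k]: gluing can close up to unlabeled double-chambers,
    which are removed at the end. *)
Let U : set chamber := [set u | exists2 i : sidx CG, sdim i = n & rho i = u].

Let U_closed : adjacency_closed k U.
Proof.
move=> c p; split=> -[i di ri]; have [j dj [rj _]] := neighbor c di; exists j => //.
  by rewrite rj ri.
by rewrite rj ri /opposite /= plus_end_minus.
Qed.

(** A plus-chamber absent from [P] is trivial for [g] and so leads to a single [q1]. If [tau q1]
    were trivial for [h] as well, the chamber would be trivial for [k]; hence it comes from [Q].
    Minus-chambers are treated dually. *)
Let nontrivial_U : nontrivial a d k `<=` U.
Proof.
move=> [[] p] np.
  have [nt|/contrapT/trivial_plusP[ap [q1 bq gq]]] := pselect (nontrivial a b g (true, p)).
    have [i di ri] := pr_onto prP nt.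
    have ik : `[< forall s, ~ mlab s i >].
      by apply/asboolP => s /(pr_mlab prP)[_]; rewrite ri.
    by exists (inl (exist _ i ik)); rewrite /rho //= ri.
  have nt : nontrivial b d h (true, tau q1).
    move=> /trivial_plusP[_ [q2 dq hq]]; apply: np; apply/trivial_plusP; split=> //.
    by exists q2 => // c; rewrite kE gq.
  have [j dj rj] := pr_onto prQ nt.
  have jk : `[< forall s, ~ plab s j >].
    apply/asboolP => s /(pr_plab prQ)[_]; rewrite rj => -[sE].
    by have := tau_geq q1; rewrite bq sE leqNgt ltn_ord.
  exists (inr (exist _ j jk)) => //; rewrite /rho /= rj /= tauK.
  by rewrite (plus_preE (gq _)).
have [nt|/contrapT/trivial_minusP[dp [p2 bp hp]]] := pselect (nontrivial b d h (false, p)).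
  have [j dj rj] := pr_onto prQ nt.
  have jk : `[< forall s, ~ plab s j >].
    by apply/asboolP => s /(pr_plab prQ)[_]; rewrite rj.
  by exists (inr (exist _ j jk)); rewrite /rho //= rj.
have nt : nontrivial a b g (false, taui p2).
  move=> /trivial_minusP[_ [p1 ap gp]]; apply: np; apply/trivial_minusP; split=> //.
  by exists p1 => // c; rewrite kE gp tauiK.
have [i di ri] := pr_onto prP nt.
have ik : `[< forall s, ~ mlab s i >].
  apply/asboolP => s /(pr_mlab prP)[_]; rewrite ri => -[sE].
  by have := taui_geq p2; rewrite bp sE leqNgt ltn_ord.
by exists (inl (exist _ i ik)) => //; rewrite /rho /= ri /= tauiK hp.
Qed.

Let nmG (i j : sidx NM) (x : simplex R (sdim i)) (y : simplex R (sdim j)) : Prop :=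
  @chart R CG (\val i) x = @chart R CG (\val j) y /\
  (@simplex_image R CG (\val i) = simplex_image (\val j) \/
   exists A : set (realization CG), [/\ is_face n.-1 A, A `<=` simplex_image (\val i),
     A `<=` simplex_image (\val j) & A (chart (\val i) x)]).

Let nm_chart (i j : sidx NM) x y : chart i x = chart j y <->
  clos_refl_sym_trans (simplex_sum R (fun i : sidx NM => sdim i))
    (fun p q => nmG (projT2 p) (projT2 q)) (existT _ i x) (existT _ j y).
Proof. exact: chart_glue. Qed.

Let nm_dim (i : sidx NM) : @sdim R CG (\val i) = n.
Proof. exact/eqP/(valP i). Qed.

(** A common (n-1)-face misses just one color [c], so its barycenter forces both chambers onto the
    same edge of color [c] of [k], and coordinate [c] vanishes at the given point of the face. *)
Let nmG_conn (i j : sidx NM) x y : @nmG i j x y ->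
  @color_coord R n CG (\val i) x = color_coord (\val j) y /\
  conn k (support (@color_coord R n CG (\val i) x)) (rho (\val i)) (rho (\val j)).
Proof.
move=> [xy h']; split; first exact: cg_color.
have vi := @cg_vcol (\val i); have vj := @cg_vcol (\val j).
case: h' => [ij|[A [[m [T [cT AE]]] Ai Aj Ax]]].
  have [z zS] := color_support_point vi (nm_dim i) (finsetT_neq0 n).
  have : simplex_image (\val j) (@chart R CG (\val i) z) by rewrite -ij; exists z.
  by move=> [w _ /esym/cg_side/(_ zS)/rho_side ->]; exact: conn_refl.
rewrite prednK// in cT; have vm := @cg_vcol m.
have T0 : T != finset.set0 by rewrite -cards_eq0 cT; case: (n) n_gt0.
have /set_missing_color[c cE] : #|vcol m @: T| = n by rewrite card_imset.
have zS : support (@color_coord R n CG m (barycenter T0)) = [set~ c]%SET.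
  by rewrite support_color_coord// support_barycenter.
have Az : A (chart m (barycenter T0)).
  by rewrite AE; exists (barycenter T0) => //; apply/faceE; rewrite support_barycenter.
have [x' _ /esym/cg_edge-/(_ c)] := Ai _ Az; rewrite zS fintype.subxx => /(_ isT) ei.
have [y' _ /esym/cg_edge-/(_ c)] := Aj _ Az; rewrite zS fintype.subxx => /(_ isT) ej.
apply: (plus_end_conn (kb c)); last by rewrite (edge_rho c (nm_dim i)) (edge_rho c (nm_dim j)) -ei -ej.
move: Ax; rewrite AE => -[w /(face_color_coord vm) wT /cg_color <-].
by apply/negP => /(fintype.subsetP wT); rewrite cE !inE eqxx.
Qed.

(** For one step across [c], [neighbor] identifies the entire faces of color [c] and not just the
    given point; this is the common (n-1)-face that normalization asks for. *)
Let conn_nmG S u v : conn k S u v -> forall (i j : sidx NM) x y,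
  rho (\val i) = u -> rho (\val j) = v ->
  @color_coord R n CG (\val i) x = color_coord (\val j) y ->
  support (@color_coord R n CG (\val i) x) = S ->
  @chart R NM i x = @chart R NM j y.
Proof.
have full (i j : sidx NM) x y : rho (\val i) = rho (\val j) ->
    @color_coord R n CG (\val i) x = color_coord (\val j) y -> @chart R NM i x = @chart R NM j y.
  move=> ij xy; apply/nm_chart; apply: rst_step; split=> /=.
    exact: rho_inj (nm_dim i) (nm_dim j) ij xy.
  left; suff H (i' j' : sidx NM) : rho (\val i') = rho (\val j') ->
      @simplex_image R CG (\val i') `<=` simplex_image (\val j').
    by apply/seteqP; split; apply: H.
  move=> ij' _ [z _ <-].
  have [w wz] := color_point (@cg_vcol (\val j')) (nm_dim j') (color_coord_simplex z).
  by exists w => //; apply/esym/rho_inj => //; exact/esym.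
elim=> {u v} [u v [c [p [cS ue ve]]]|u|u v uv IH|u v w uv IH vw IH'] i j x y iu jv xy xS.
- have [j0 dj0 [rj0 j0P]] := neighbor c (nm_dim i).
  have j0j : rho j0 = rho (\val j) by rewrite rj0 iu jv ue ve.
  have H z w : c \notin support (@color_coord R n CG (\val i) z) ->
      @color_coord R n CG (\val i) z = color_coord (\val j) w ->
      @chart R CG (\val i) z = chart (\val j) w.
    move=> cz zw; have [w0 w0z] := color_point (@cg_vcol j0) dj0 (color_coord_simplex z).
    rewrite (j0P z w0 cz (esym w0z)); apply: rho_inj => //.
    by rewrite w0z.
  apply/nm_chart; apply: rst_step; split=> /=; first by apply: H; rewrite ?xS.
  have vi := @cg_vcol (\val i).
  right; pose T := [set l | @vcol R n CG (\val i) l != c]%SET.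
  have cT z : face T z -> c \notin support (@color_coord R n CG (\val i) z).
    move=> /(face_color_coord vi) zT; apply/negP => /(fintype.subsetP zT)/imsetP[l].
    by rewrite inE => lc cl; rewrite cl eqxx in lc.
  exists (@face_image R CG (\val i) T); split.
  + exists (\val i), T; split=> //; rewrite prednK//.
    have /imsetP[l0 _ cl0] : c \in @vcol R n CG (\val i) @: [set: 'I_(@sdim R CG (\val i)).+1]%SET.
      by rewrite (imset_vcol_full vi (nm_dim i)) finset.in_setT.
    have -> : T = [set~ l0]%SET by apply/finset.setP => l; rewrite !inE cl0 inj_eq.
    by rewrite cardsC1 card_ord nm_dim.
  + by move=> _ [z _ <-]; exists z.
  + move=> _ [z zT <-].
    have [w wz] := color_point (@cg_vcol (\val j)) (nm_dim j) (color_coord_simplex z).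
    by exists w => //; apply/esym/H; [exact: cT|exact/esym].
  + exists x => //; apply/(face_color_coord vi); apply/fintype.subsetP => e ex.
    have /imsetP[l _ el] : e \in @vcol R n CG (\val i) @: [set: 'I_(@sdim R CG (\val i)).+1]%SET.
      by rewrite (imset_vcol_full vi (nm_dim i)) finset.in_setT.
    rewrite el; apply: imset_f; rewrite inE -el.
    by apply: contraNneq cS => <-; rewrite -xS.
- by apply: full => //; rewrite iu jv.
- by apply/esym; apply: IH => //; rewrite -?xy.
- have Uv : U v by apply/(conn_closed U_closed uv); exists (\val i) => //; exact: nm_dim.
  have [m dm mv] := Uv; have mn : sdim m == n by apply/eqP.
  have [z zx] := color_point (@cg_vcol m) dm (color_coord_simplex x).
  transitivity (@chart R NM (exist _ m mn) z).
    by apply: IH => //; exact/esym.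
  by apply: IH' => //=; rewrite zx.
Qed.

Let nm_presentation : presentation U k (fun i : sidx NM => rho (\val i)).
Proof.
split.
- by move=> i; exact: (@cg_vcol (\val i)).
- by move=> i; exact: (@cg_fcol (\val i)).
- move=> i j x y; split=> [/nm_chart|[xy ij]]; last exact: conn_nmG ij _ _ _ _ erefl erefl xy erefl.
  set p := existT _ i x; set q := existT _ j y.
  suff H (p' q' : simplex_sum R (fun i : sidx NM => sdim i)) :
      clos_refl_sym_trans (simplex_sum R (fun i : sidx NM => sdim i))
        (fun p q => nmG (projT2 p) (projT2 q)) p' q' ->
      @color_coord R n CG (\val (projT1 p')) (projT2 p') =
        color_coord (\val (projT1 q')) (projT2 q') /\
      conn k (support (@color_coord R n CG (\val (projT1 p')) (projT2 p')))
        (rho (\val (projT1 p'))) (rho (\val (projT1 q'))) by move=> /H.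
  elim=> {p q p' q'} [p' q' /nmG_conn//|p'|p' q' _ [E1 E2]|p' q' r' _ [E1 E2] _ [E3 E4]].
  + by split=> //; exact: conn_refl.
  + by rewrite -E1; split=> //; exact: conn_sym.
  + by rewrite E1 -E3; split=> //; rewrite E1 in E2; exact: conn_trans E2 E4.
- by move=> i _; exact: rho_sign (nm_dim i).
- move=> [[i|j] ni] s; rewrite /rho /=.
    rewrite (pr_plab prP); split=> -[di ri]; split=> //; first by rewrite ri.
    by case: (rP (\val i)) ri => -[].
  (* A kept plus-chamber of [Q] is placed at a number at least [a], beyond the plus-labels. *)
  split=> // -[dj]; case rj : (rQ (\val j)) => [[] p]//= [pE].
  have [_ [p' ap gp]] := kept_plus dj rj.
  by move: ap; rewrite -(plus_preE (gp ord0)) pE leqNgt ltn_ord.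
- move=> [[i|j] ni] s; rewrite /rho /=.
    split=> // -[di]; case ri : (rP (\val i)) => [[] q]//= [qE].
    have [_ [q' dq hq]] := kept_minus di ri.
    by move: dq; rewrite -(hq ord0) qE leqNgt ltn_ord.
  rewrite (pr_mlab prQ); split=> -[dj rj]; split=> //; first by rewrite rj.
  by case: (rQ (\val j)) rj => -[].
- by move=> i; exists (\val i) => //; exact: nm_dim.
- move=> u [i di iu]; have ni : @sdim R CG i == n by apply/eqP.
  by exists (exist _ i ni).
Qed.

Theorem bordism_comp_presentation :
  exists r : sidx (bordism_comp P Q) -> chamber, presentation (nontrivial a d k) k r.
Proof.
exists (fun i : sidx (bordism_comp P Q) => rho (\val (\val i))).
exact: (remove_presentation n_gt0 kb U_closed nontrivial_U nm_presentation).
Qed.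

End Composition.

(** * The equivalence *)

Lemma finite_injective_image T V (A : set T) (f : T -> V) :
  injective f -> finite_set (f @` A) -> finite_set A.
Proof. by move=> fi; rewrite (eq_finite_set (inj_card_eq (in2W fi))). Qed.

Lemma finite_sig (T : choiceType) (p : pred T) (A : set T) :
  (forall x, p x -> A x) -> finite_set A -> finite_set [set: {x : T | p x}].
Proof.
move=> pA fA; apply: (finite_injective_image (f := \val)); first exact: val_inj.
by apply: sub_finite_set fA => _ [x _ <-]; apply: pA; exact: valP.
Qed.

Definition shuffle (b j m : nat) : nat :=
  if (b <= m < b + j)%N then (m + j)%N
  else if (b + j <= m < b + j + j)%N then (m - j)%N else m.

Lemma theta_shuffle n b j : @theta n b j = fun=> shuffle b j.
Proof. by []. Qed.

Lemma shuffle_low b j m : (b <= m)%N -> (m < b + j)%N -> shuffle b j m = (m + j)%N.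
Proof. by move=> bm mj; rewrite /shuffle bm mj. Qed.

Lemma shuffle_high b j m : (b + j <= m)%N -> (m < b + j + j)%N -> shuffle b j m = (m - j)%N.
Proof. by move=> bm mj; rewrite /shuffle bm mj ltnNge bm andbF. Qed.

Lemma shuffle_out b j m : (m < b)%N || (b + j + j <= m)%N -> shuffle b j m = m.
Proof. by move=> h; rewrite /shuffle !ifF //; lia. Qed.

Lemma shuffleK b j : involutive (shuffle b j).
Proof.
move=> m; have [h|h] := boolP ((m < b)%N || (b + j + j <= m)%N).
  by rewrite !shuffle_out.
move: h; rewrite negb_or -leqNgt -ltnNge => /andP[bm mbj].
have [mj|jm] := ltnP m (b + j).
  by rewrite (@shuffle_low b j m)// shuffle_high; lia.
by rewrite (@shuffle_high b j m)// shuffle_low; lia.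
Qed.

Lemma shuffle_fixes b j : fixes_below b (shuffle b j).
Proof.
split=> [|m mb]; last by rewrite shuffle_out// mb.
split; first by exists (shuffle b j); exact: shuffleK.
by exists (b + j + j)%N => m bm; rewrite shuffle_out// bm orbT.
Qed.

(** * Shuffles that separate two tuples *)

Section Shuffles.
Context {n : nat}.

Definition separates (a b d : nat) (g h : tuple_perm n) (tau : nat -> nat) : Prop :=
  forall q, (b <= q)%N -> trivial_chamber a b g (false, q) \/ trivial_chamber b d h (true, tau q).

Definition stable_above (N a b : nat) (g : tuple_perm n) : Prop :=
  [/\ (a <= N)%N, (b <= N)%N & forall c m, (N <= m)%N -> g c m = m].

Lemma stable_ex a b g : Ginf g -> exists N, forall M, (N <= M)%N -> stable_above M a b g.
Proof.
move=> /Ginf_bound[N gN]; exists (maxn N (maxn a b)) => M.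
rewrite !geq_max => /and3P[NM aM bM]; split=> // c m Mm.
by apply: gN; exact: leq_trans Mm.
Qed.

Lemma stable_trivial_minus N a b g q : stable_above N a b g -> (N <= q)%N ->
  trivial_chamber a b g (false, q).
Proof.
move=> [aN bN gN] Nq; apply/trivial_minusP; split; first exact: leq_trans Nq.
by exists q => [|c]; [exact: leq_trans Nq|exact: gN].
Qed.

Lemma stable_trivial_plus N a b g q : stable_above N a b g -> (N <= q)%N ->
  trivial_chamber a b g (true, q).
Proof.
move=> [aN bN gN] Nq; apply/trivial_plusP; split; first exact: leq_trans Nq.
by exists q => [|c]; [exact: leq_trans Nq|exact: gN].
Qed.

(** If [q] is below [b + j], the shuffle adds [j] and lands where [h] is trivial; otherwise [q]
    itself is already where [g] is trivial. *)
Lemma shuffle_separates N j a b d g h : stable_above N a b g -> stable_above N b d h ->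
  (N <= j)%N -> separates a b d g h (shuffle b j).
Proof.
move=> gN hN Nj q bq; have [qj|jq] := ltnP q (b + j).
  right; rewrite shuffle_low//; apply: (stable_trivial_plus hN).
  exact: leq_trans Nj (leq_addl _ _).
left; apply: (stable_trivial_minus gN); apply: leq_trans jq.
exact: leq_trans Nj (leq_addl _ _).
Qed.

Lemma shuffle_separates_near a b d g h : Ginf g -> Ginf h ->
  exists N, forall j, (N <= j)%N -> separates a b d g h (shuffle b j).
Proof.
move=> /(stable_ex a b)[N gN] /(stable_ex b d)[M hM]; exists (maxn N M) => j.
rewrite geq_max => /andP[Nj Mj]; apply: (@shuffle_separates j) => //.
- exact: gN.
- exact: hM.
Qed.

(* The first shuffle displaces the support of g beyond those of h and f, and
   the second one displaces everything that precedes beyond the support of f. *)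
Lemma separates_triple a b c d (g h f : tuple_perm n) : Ginf g -> Ginf h -> Ginf f ->
  exists i j, let s := fun=> shuffle b i in let t := fun=> shuffle c j in
  [/\ separates a b c g h (shuffle b i), separates b c d h f (shuffle c j),
      separates a c d (Gmul (Gmul g s) h) f (shuffle c j) &
      separates a b d g (Gmul (Gmul h t) f) (shuffle b i)].
Proof.
move=> gG hG fG.
have [N1 s1] := stable_ex a b gG; have [N2 s2] := stable_ex b c hG; have [N3 s3] := stable_ex c d fG.
pose i := maxn N1 (maxn N2 N3).
have gi : stable_above i a b g by apply: s1; rewrite leq_max leqnn.
have hi : stable_above i b c h by apply: s2; rewrite !leq_max leqnn orbT.
have fi : stable_above i c d f by apply: s3; rewrite !leq_max leqnn !orbT.
have sG : @Ginf n (fun=> shuffle b i) by move=> _; have [] := shuffle_fixes b i.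
have kG : Ginf (Gmul (Gmul g (fun=> shuffle b i)) h) by apply: Ginf_Gmul => //; exact: Ginf_Gmul.
have [N4 s4] := stable_ex a c kG.
(* The first shuffle moves only numbers below [b + i + i]; the second one must shift all of these
   that are at least [c]. *)
pose j := maxn N4 (b + i + i).
have ij : (i <= j)%N by rewrite leq_max; apply/orP; right; lia.
have fj : stable_above j c d f.
  by apply: s3; apply: leq_trans ij; rewrite !leq_max leqnn !orbT.
have hj : stable_above j b c h.
  by apply: s2; apply: leq_trans ij; rewrite !leq_max leqnn !orbT.
have kj : stable_above j a c (Gmul (Gmul g (fun=> shuffle b i)) h).
  by apply: s4; rewrite leq_max leqnn.
exists i, j; split.
- exact: shuffle_separates gi hi (leqnn _).
- exact: shuffle_separates hj fj (leqnn _).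
- exact: shuffle_separates kj fj (leqnn _).
- move=> q bq; have [qi|iq] := ltnP q (b + i); last first.
    by left; apply: (stable_trivial_minus gi); apply: leq_trans iq; exact: leq_addl.
  have [_ ci hE] := hi; have [_ di fE] := fi.
  have jb : (b + i + i <= j)%N by rewrite leq_max leqnn orbT.
  right; rewrite shuffle_low//; apply/trivial_plusP; split; first lia.
  (* The first shuffle gives [q + i], which [h] fixes; the second adds [j], and [f] fixes the
     result. *)
  exists (q + i + j)%N => [|e]; first lia.
  rewrite /Gmul /= hE; last by rewrite leq_addl.
  rewrite shuffle_low; [|lia|lia].
  by rewrite fE//; lia.
Qed.

Lemma Gmul_shuffle_dcoset a b (g : tuple_perm n) j : dcoset a b g (Gmul g (@theta n b j)).
Proof.
apply/dcosetP; exists id, (shuffle b j); split=> //; first exact: fixes_below_id.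
exact: shuffle_fixes.
Qed.

End Shuffles.

(** * The double coset of a pseudobordism and the two functors *)

Section Class.
Context {R : realType} {n : nat}.
Hypothesis n_gt0 : (1 <= n)%N.

Definition represents a b (P : labeled R n 'I_a 'I_b) (g : tuple_perm n) : Prop :=
  exists r : sidx P -> chamber, presentation (nontrivial a b g) g r.

(** By [class_eq] any tuple representing [P] gives the same value; [set0] is the default when there
    is none. *)
Definition class a b (P : labeled R n 'I_a 'I_b) : set (tuple_perm n) :=
  xget set0 [set gg | exists g, [/\ Ginf g, represents P g & gg = dcoset a b g]].

Lemma represents_isomorphic a b (P Q : labeled R n 'I_a 'I_b) g :
  represents P g -> represents Q g -> isomorphic P Q.
Proof. by move=> [rP prP] [rQ prQ]; exact: presentation_isomorphic prP prQ n_gt0. Qed.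

Lemma represents_dcoset a b (P Q : labeled R n 'I_a 'I_b) g h : Ginf g -> Ginf h ->
  represents P g -> represents Q h -> isomorphic P Q -> dcoset a b g = dcoset a b h.
Proof.
move=> gG hG [rP prP] [rQ prQ] PQ; apply: dcoset_eq.
exact: isomorphic_dcoset n_gt0 gG hG prP prQ PQ.
Qed.

Lemma dcoset_represents a b (P : labeled R n 'I_a 'I_b) g h :
  represents P g -> dcoset a b g h -> represents P h.
Proof. by move=> [r pr] gh; exact: presentation_dcoset pr gh. Qed.

Lemma class_eq a b (P : labeled R n 'I_a 'I_b) g : Ginf g -> represents P g ->
  class P = dcoset a b g.
Proof.
move=> gG Pg; rewrite /class; set S := [set gg | _].
have [h [hG Ph ->]] : S (xget set0 S) by apply: xgetPex; exists (dcoset a b g), g.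
exact: (represents_dcoset hG gG Ph Pg (represents_isomorphic Pg Pg)).
Qed.

Lemma class_ex a b (P : labeled R n 'I_a 'I_b) : is_pseudobordism P ->
  exists g, [/\ Ginf g, represents P g & class P = dcoset a b g].
Proof.
move=> /(pseudobordism_presentation n_gt0)[g gG Pg]; exists g; split=> //.
exact: class_eq.
Qed.

(** Replaces isomorphism by equality of double cosets, so that with [class_comp] the laws of [PsBor]
    become identities between double cosets. *)
Lemma isomorphic_class a b (P Q : labeled R n 'I_a 'I_b) :
  is_pseudobordism P -> is_pseudobordism Q -> isomorphic P Q <-> class P = class Q.
Proof.
move=> /class_ex[g [gG Pg ->]] /class_ex[h [hG Qh ->]].
split=> [|gh]; first exact: represents_dcoset.
apply: (represents_isomorphic _ Qh); apply: dcoset_represents Pg _.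
by rewrite gh; exact: dcoset_refl.
Qed.

Lemma bordism_of_represents a b (g : tuple_perm n) : Ginf g -> represents (bordism_of R a b g) g.
Proof.
by move=> gG; eexists; exact: (@bordism_of_presentation R n a b g n_gt0 (Ginf_bij gG)).
Qed.

Lemma bordism_of_pseudobordism a b (g : tuple_perm n) : Ginf g ->
  is_pseudobordism (bordism_of R a b g).
Proof.
move=> gG; have gb := Ginf_bij gG; have pr := @bordism_of_presentation R n a b g n_gt0 gb.
apply: (presentation_pseudobordism n_gt0 gG pr) => //.
(* From [N] on every chamber is trivial, so only finitely many remain. *)
have [N /(_ N (leqnn _)) gN] := stable_ex a b gG.
apply: (finite_injective_image (f := \val)); first exact: val_inj.
apply: (@sub_finite_set _ _ ((@setT bool) `*` [set p | (p < N)%N])).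
  move=> _ [i _ <-] /=; split=> //; rewrite ltnNge; apply/negP => Nq.
  have nt : nontrivial a b g (sval i) := pr_in pr i.
  case: (sval i) nt Nq => -[] q nt Nq; apply: nt.
    exact: stable_trivial_plus gN Nq.
  exact: stable_trivial_minus gN Nq.
by apply: finite_setX; [exact: finite_finset|exact: finite_II].
Qed.

Lemma bordism_comp_represents a b d (P : labeled R n 'I_a 'I_b) (Q : labeled R n 'I_b 'I_d)
    g h tau : Ginf g -> Ginf h -> fixes_below b tau -> separates a b d g h tau ->
  represents P g -> represents Q h ->
  represents (bordism_comp P Q) (Gmul (Gmul g (fun=> tau)) h).
Proof.
move=> gG hG tb sep [rP prP] [rQ prQ].
have [taui [_ tK tiK]] := fixes_below_inv tb.
exact: (bordism_comp_presentation n_gt0 gG hG prP prQ tK tiK tb sep).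
Qed.

Lemma finite_sidx a b (P : labeled R n 'I_a 'I_b) : is_pseudobordism P -> finite_set [set: sidx P].
Proof. by move=> [[[]]]. Qed.

(** No axiom is checked on the glued complex itself: the composite is presented by a tuple, and this
    suffices once its simplices are finitely many and all of dimension n. *)
Lemma bordism_comp_pseudobordism a b d (P : labeled R n 'I_a 'I_b) (Q : labeled R n 'I_b 'I_d) :
  is_pseudobordism P -> is_pseudobordism Q -> is_pseudobordism (bordism_comp P Q).
Proof.
move=> Pb Qb; have [g [gG Pg _]] := class_ex Pb; have [h [hG Qh _]] := class_ex Qb.
have [N sN] := shuffle_separates_near a b d gG hG.
have sF := shuffle_fixes b N.
have [r pr] := bordism_comp_represents gG hG sF (sN N (leqnn _)) Pg Qh.
apply: (presentation_pseudobordism n_gt0 _ pr).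
- apply: Ginf_Gmul => //; apply: Ginf_Gmul => // _; by case: sF.
- by move=> i; apply/eqP; exact: (valP (\val i)).
- apply: (@finite_sig _ _ setT) => //; apply: (@finite_sig _ _ setT) => //.
  have -> : [set: cut_idx P Q] = (inl @` setT) `|` (inr @` setT).
    by apply/seteqP; split=> // -[i|i] _; [left|right]; exists i.
  rewrite finite_setU; split; apply: finite_image; apply: (@finite_sig _ _ setT) => //.
    exact: finite_sidx Pb.
  exact: finite_sidx Qb.
Qed.

Lemma is_dcoset_class a b (P : labeled R n 'I_a 'I_b) : is_pseudobordism P -> is_dcoset a b (class P).
Proof. by move=> /class_ex[g [gG _ ->]]; exists g. Qed.

(* Both products represent the composite of the pseudobordisms of g and h. *)
Lemma separated_product_unique a b d (g g' h h' : tuple_perm n) tau tau' :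
  Ginf g -> Ginf h -> dcoset a b g g' -> dcoset b d h h' ->
  fixes_below b tau -> fixes_below b tau' ->
  separates a b d g h tau -> separates a b d g' h' tau' ->
  dcoset a d (Gmul (Gmul g (fun=> tau)) h) = dcoset a d (Gmul (Gmul g' (fun=> tau')) h').
Proof.
move=> gG hG gg hh tb tb' sep sep'.
have gG' := dcoset_Ginf gG gg; have hG' := dcoset_Ginf hG hh.
have Pg := bordism_of_represents a b gG; have Qh := bordism_of_represents b d hG.
have Pg' := dcoset_represents Pg gg; have Qh' := dcoset_represents Qh hh.
have PQ := bordism_comp_represents gG hG tb sep Pg Qh.
have PQ' := bordism_comp_represents gG' hG' tb' sep' Pg' Qh'.
have tG f : fixes_below b f -> @Ginf n (fun=> f) by move=> [fS _] _.
rewrite -(class_eq _ PQ) -?(class_eq _ PQ')//; apply: Ginf_Gmul => //; apply: Ginf_Gmul => //; exact: tG.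
Qed.

(** Large shuffles separate any representatives, and all separated products lie in one double coset.
    So the sequence is eventually constant, and its limit can be computed with any separating
    [tau]. *)
Lemma dcoset_comp_separated a b d (g h : tuple_perm n) tau :
  Ginf g -> Ginf h -> fixes_below b tau -> separates a b d g h tau ->
  dcoset_comp a b d (dcoset a b g) (dcoset b d h) = dcoset a d (Gmul (Gmul g (fun=> tau)) h).
Proof.
move=> gG hG tb sep; set ff := dcoset a d _.
have ffP : is_dcoset_comp a b d (dcoset a b g) (dcoset b d h) ff.
  move=> g' h' gg hh.
  have [N sN] := shuffle_separates_near a b d (dcoset_Ginf gG gg) (dcoset_Ginf hG hh).
  exists N => // j /= Nj; rewrite theta_shuffle; apply/esym.
  exact: (separated_product_unique gG hG gg hh tb (shuffle_fixes b j) sep (sN j Nj)).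
rewrite /dcoset_comp; have := xgetPex set0 (ex_intro _ _ ffP).
move: (xget _ _) => ff' ff'P.
have gg := dcoset_refl a b g; have hh := dcoset_refl b d h.
have [N _ HN] := ffP g h gg hh; have [M _ HM] := ff'P g h gg hh.
(* Two eventual values of one sequence agree at a common large index, so [xget] has no choice. *)
by rewrite -(HM (maxn N M)) -?(HN (maxn N M)) //= leq_max leqnn ?orbT.
Qed.

Lemma class_comp a b d (P : labeled R n 'I_a 'I_b) (Q : labeled R n 'I_b 'I_d) :
  is_pseudobordism P -> is_pseudobordism Q ->
  class (bordism_comp P Q) = dcoset_comp a b d (class P) (class Q).
Proof.
move=> /class_ex[g [gG Pg ->]] /class_ex[h [hG Qh ->]].
have [N sN] := shuffle_separates_near a b d gG hG.
have sF := shuffle_fixes b N; have sep := sN N (leqnn _).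
rewrite (dcoset_comp_separated gG hG sF sep); apply: class_eq.
  by apply: Ginf_Gmul => //; apply: Ginf_Gmul => // _; case: sF.
exact: bordism_comp_represents.
Qed.

Definition one_coset (a : nat) : set (tuple_perm n) := dcoset a a Gone.

Lemma Ginf_one : @Ginf n Gone. Proof. by move=> c; exact: Sinf_id. Qed.

Lemma is_dcoset_one a : is_dcoset a a (one_coset a).
Proof. by exists Gone => //; exact: Ginf_one. Qed.

Lemma is_dcoset_dcoset_comp a b d (gg hh : set (tuple_perm n)) :
  is_dcoset a b gg -> is_dcoset b d hh -> is_dcoset a d (dcoset_comp a b d gg hh).
Proof.
move=> [g gG ->] [h hG ->].
have [N sN] := shuffle_separates_near a b d gG hG.
have sF := shuffle_fixes b N.
rewrite (dcoset_comp_separated gG hG sF (sN N (leqnn _))); eexists; last by [].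
by apply: Ginf_Gmul => //; apply: Ginf_Gmul => // _; case: sF.
Qed.

Lemma dcoset_comp1 a b (gg : set (tuple_perm n)) : is_dcoset a b gg ->
  dcoset_comp a b b gg (one_coset b) = gg.
Proof.
move=> [g gG ->].
have [N sN] := shuffle_separates_near a b b gG Ginf_one.
rewrite (dcoset_comp_separated gG Ginf_one (shuffle_fixes b N) (sN N (leqnn _))).
exact/esym/dcoset_eq/(Gmul_shuffle_dcoset a b g N).
Qed.

Lemma dcoset_1comp a b (gg : set (tuple_perm n)) : is_dcoset a b gg ->
  dcoset_comp a a b (one_coset a) gg = gg.
Proof.
move=> [g gG ->].
have [N sN] := shuffle_separates_near a a b Ginf_one gG.
rewrite (dcoset_comp_separated Ginf_one gG (shuffle_fixes a N) (sN N (leqnn _))).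
apply/esym/dcoset_eq/dcosetP; exists (shuffle a N), id; split=> //; first exact: shuffle_fixes.
exact: fixes_below_id.
Qed.

(** With shuffles separating all four products, both bracketings come from the same tuple: [f],
    shuffle, [g], shuffle, [h], composed in this order. *)
Lemma dcoset_compA a b c d (ff gg hh : set (tuple_perm n)) :
  is_dcoset a b ff -> is_dcoset b c gg -> is_dcoset c d hh ->
  dcoset_comp a b d ff (dcoset_comp b c d gg hh) = dcoset_comp a c d (dcoset_comp a b c ff gg) hh.
Proof.
move=> [f fG ->] [g gG ->] [h hG ->].
have [i [j [s1 s2 s3 s4]]] := separates_triple a b c d fG gG hG.
have bi := shuffle_fixes b i; have cj := shuffle_fixes c j.
have tG b' t : fixes_below b' t -> @Ginf n (fun=> t) by move=> [tS _] _.
rewrite (dcoset_comp_separated gG hG cj s2) (dcoset_comp_separated fG gG bi s1).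
rewrite (dcoset_comp_separated fG _ bi s4) ?(dcoset_comp_separated _ hG cj s3)//.
- by apply: Ginf_Gmul => //; apply: Ginf_Gmul => //; exact: tG bi.
- by apply: Ginf_Gmul => //; apply: Ginf_Gmul => //; exact: tG cj.
Qed.

Lemma class_bordism_of a b (g : tuple_perm n) : Ginf g -> class (bordism_of R a b g) = dcoset a b g.
Proof. by move=> gG; apply: class_eq => //; exact: bordism_of_represents. Qed.

Lemma dcoset_xget a b gg : is_dcoset a b gg ->
  Ginf (xget (@Gone n) gg) /\ gg = dcoset a b (xget Gone gg).
Proof.
move=> [g gG ggE]; have gx : dcoset a b g (xget Gone gg).
  by rewrite -ggE; apply: xgetPex; exists g; rewrite ggE; exact: dcoset_refl.
by split; [exact: dcoset_Ginf gG gx|rewrite {1}ggE; exact: dcoset_eq].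
Qed.

Definition functor_arr a b (gg : set (tuple_perm n)) : labeled R n 'I_a 'I_b :=
  bordism_of R a b (xget Gone gg).

Lemma functor_arr_pseudobordism a b gg : is_dcoset a b gg -> is_pseudobordism (functor_arr a b gg).
Proof. by move=> /dcoset_xget[gG _]; exact: bordism_of_pseudobordism. Qed.

Lemma class_functor_arr a b gg : is_dcoset a b gg -> class (functor_arr a b gg) = gg.
Proof. by move=> /dcoset_xget[gG {2}->]; exact: class_bordism_of. Qed.

Lemma double_coset_is_category : is_category (double_coset_category n).
Proof.
split=> //=.
- by move=> a b f g h _ _ _ -> ->.
- by move=> a b c g f; exact: is_dcoset_dcoset_comp.
- by move=> a b c g g' f f' _ _ _ _ -> ->.
- by move=> a b c d h g f; exact: dcoset_compA.
- move=> a; exists (one_coset a); split=> [|b f|b f]; first exact: is_dcoset_one.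
    exact: dcoset_comp1.
  exact: dcoset_1comp.
Qed.

Lemma one_coset_identity a : @is_identity (double_coset_category n) a (one_coset a).
Proof.
split=> [|b f|b f]; first exact: is_dcoset_one.
- exact: dcoset_comp1.
- exact: dcoset_1comp.
Qed.

(** An identity is recognized by composing it with the image of the trivial double coset: the law
    for this single arrow already determines its class. *)
Lemma identity_class a (P : labeled R n 'I_a 'I_a) : is_pseudobordism P ->
  class P = one_coset a <-> @is_identity (PsBor R n) a P.
Proof.
move=> Pb; have oneB := functor_arr_pseudobordism (is_dcoset_one a).
have oneC := class_functor_arr (is_dcoset_one a).
split=> [P1|[_ _ /(_ a _ oneB)]].
  split=> // b Q Qb /=; apply/isomorphic_class => //; try exact: bordism_comp_pseudobordism.
    by rewrite class_comp// P1 dcoset_comp1//; exact: is_dcoset_class.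
  by rewrite class_comp// P1 dcoset_1comp//; exact: is_dcoset_class.
have PB := bordism_comp_pseudobordism Pb oneB.
move=> /= /(isomorphic_class PB oneB); rewrite class_comp// oneC dcoset_comp1//.
exact: is_dcoset_class.
Qed.

Lemma PsBor_is_category : is_category (PsBor R n).
Proof.
split=> /=.
- by move=> a b P Pb; apply/isomorphic_class.
- by move=> a b P Q Pb Qb /(isomorphic_class Pb Qb) PQ; apply/isomorphic_class.
- move=> a b P Q S Pb Qb Sb /(isomorphic_class Pb Qb) PQ /(isomorphic_class Qb Sb) QS.
  by apply/isomorphic_class => //; rewrite PQ.
- by move=> a b c P Q; exact: bordism_comp_pseudobordism.
- move=> a b c P P' Q Q' Pb Pb' Qb Qb' /(isomorphic_class Pb Pb') PP /(isomorphic_class Qb Qb') QQ.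
  apply/isomorphic_class; try exact: bordism_comp_pseudobordism.
  by rewrite !class_comp// PP QQ.
- move=> a b c d P Q S Pb Qb Sb.
  have QS := bordism_comp_pseudobordism Qb Sb; have PQ := bordism_comp_pseudobordism Pb Qb.
  apply/isomorphic_class; try exact: bordism_comp_pseudobordism.
  by rewrite !class_comp// dcoset_compA//; exact: is_dcoset_class.
- move=> a; exists (functor_arr a a (one_coset a)); apply/identity_class.
    exact/functor_arr_pseudobordism/is_dcoset_one.
  exact/class_functor_arr/is_dcoset_one.
Qed.

Lemma bordism_functor_is_functor : is_functor (bordism_functor R n).
Proof.
have ob := functor_arr_pseudobordism; have oc := class_functor_arr.
split=> /=.
- by move=> a b gg; exact: ob.
- by move=> a b gg hh gB _ <-; apply/isomorphic_class; try exact: ob.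
- move=> a b c gg hh gB hB; have cB := is_dcoset_dcoset_comp gB hB.
  apply/isomorphic_class; [exact: ob|by apply: bordism_comp_pseudobordism; exact: ob|].
  rewrite (oc _ _ _ cB) class_comp; [|exact: ob|exact: ob].
  by rewrite (oc _ _ _ gB) (oc _ _ _ hB).
(* Composing the identity [e] with [one_coset a] shows that the two are equal. *)
- move=> a e [eB _ /(_ a _ (is_dcoset_one a))] /=; rewrite dcoset_comp1// => e1.
  by apply/identity_class; [exact: ob|rewrite oc].
Qed.

(** The quasi-inverse. It inverts the functor on arrows, strictly on double cosets and up to
    isomorphism on pseudobordisms, so both natural isomorphisms can have identity arrows as
    components. *)
Definition class_functor : functor_data (PsBor R n) (double_coset_category n) :=
  @FunctorData (PsBor R n) (double_coset_category n) id (fun b a P => class P).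

Lemma class_functor_is_functor : is_functor class_functor.
Proof.
split=> /=.
- by move=> a b P; exact: is_dcoset_class.
- by move=> a b P Q Pb Qb /(isomorphic_class Pb Qb).
- by move=> a b c P Q; exact: class_comp.
- move=> a P Pi; have Pb : is_pseudobordism P by case: Pi.
  by move/(identity_class Pb): Pi => ->; exact: one_coset_identity.
Qed.

Lemma one_coset_iso a : @is_iso (double_coset_category n) a a (one_coset a).
Proof.
have aB := is_dcoset_one a; split=> //; exists (one_coset a).
by rewrite /= dcoset_comp1//; split=> //; exact: one_coset_identity.
Qed.

Lemma functor_one_iso a : @is_iso (PsBor R n) a a (functor_arr a a (one_coset a)).
Proof.
have aB := is_dcoset_one a; have ob := functor_arr_pseudobordism aB.
split=> //; exists (functor_arr a a (one_coset a)).
have id2 : @is_identity (PsBor R n) a (bordism_comp (functor_arr a a (one_coset a)) (functor_arr a a (one_coset a))).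
  apply/identity_class; first exact: bordism_comp_pseudobordism.
  by rewrite class_comp// class_functor_arr// dcoset_comp1.
by split.
Qed.

(** Both composites have the class of [P], since the image of the trivial double coset is neutral
    for classes. *)
Lemma functor_class_natural a b (P : labeled R n 'I_b 'I_a) : is_pseudobordism P ->
  isomorphic (bordism_comp (functor_arr b b (one_coset b)) (functor_arr b a (class P)))
    (bordism_comp P (functor_arr a a (one_coset a))).
Proof.
move=> Pb; have oB e := functor_arr_pseudobordism (is_dcoset_one e).
have cB := is_dcoset_class Pb; have fB := functor_arr_pseudobordism cB.
apply: (isomorphic_class (bordism_comp_pseudobordism (oB b) fB)
  (bordism_comp_pseudobordism Pb (oB a))).2.
have left : class (bordism_comp (functor_arr b b (one_coset b)) (functor_arr b a (class P))) = class P.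
  refine (etrans (class_comp (oB b) fB) _).
  refine (etrans (f_equal2 (dcoset_comp b b a) (class_functor_arr (is_dcoset_one b))
    (class_functor_arr cB)) _).
  exact: dcoset_1comp.
refine (etrans left (esym (etrans (class_comp Pb (oB a)) _))).
refine (etrans (f_equal (dcoset_comp b a a (class P)) (class_functor_arr (is_dcoset_one a))) _).
exact: dcoset_comp1.
Qed.

Lemma representative_isomorphic a b (gg : set (tuple_perm n)) g : is_dcoset a b gg -> gg g ->
  isomorphic (bordism_of R a b g) (functor_arr a b gg).
Proof.
move=> ggB; have [h hG ->] := ggB => hg; have gG := dcoset_Ginf hG hg.
have hB : is_dcoset a b (dcoset a b h) by exists h.
apply/isomorphic_class; [exact: bordism_of_pseudobordism|exact: functor_arr_pseudobordism|].
by rewrite class_bordism_of// (class_functor_arr hB) (dcoset_eq hg).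
Qed.

Lemma bordism_functor_is_equivalence : is_equivalence (bordism_functor R n).
Proof.
split; first exact: bordism_functor_is_functor.
exists class_functor; split; first exact: class_functor_is_functor.
- exists one_coset; split=> [a|a b f fB /=]; first exact: one_coset_iso.
  by rewrite (class_functor_arr fB) dcoset_1comp// dcoset_comp1.
- exists (fun a => functor_arr a a (one_coset a)); split=> [a|a b P Pb /=]; first exact: functor_one_iso.
  exact: functor_class_natural.
Qed.

End Class.

Theorem theorem3p3 (R : realType) (n : nat) (hn : (1 <= n)%N) :
  [/\ is_category (double_coset_category n),
      is_category (PsBor R n),
      forall (a b : nat) (gg : set (tuple_perm n)) (g : tuple_perm n),
        is_dcoset a b gg -> gg g ->
        isomorphic (bordism_of R a b g)
          (@farr _ _ (bordism_functor R n) b a gg) &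
      is_equivalence (bordism_functor R n)].
Proof.
split.
- exact: (double_coset_is_category (R := R)).
- exact: PsBor_is_category.
- by move=> a b gg g; exact: representative_isomorphic.
- exact: bordism_functor_is_equivalence.
Qed.
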